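(* Let $T>0$, let $k,d,m$ be positive integers and $\mathcal J=\{1,\dots,m\}$. Let $b:[0,T]\times\mathbb R^k\to\mathbb R^k$ and $\sigma:[0,T]\times\mathbb R^k\to\mathbb R^{k\times d}$ be jointly continuous with $|b(t,x)|+|\sigma(t,x)|\le C(1+|x|)$ and $|b(t,x)-b(t,x')|+|\sigma(t,x)-\sigma(t,x')|\le C|x-x'|$ for some constant $C\ge 0$ and all $t\in[0,T]$, $x,x'\in\mathbb R^k$. Assume that for every $i\in\mathcal J$ the function $f_i:[0,T]\times\mathbb R^{k}\times\mathbb R^m\times\mathbb R^d\to\mathbb R$, $(t,x,y^1,\dots,y^m,z)\mapsto f_i(t,x,y^1,\dots,y^m,z)$, satisfies: (1) $(t,x)\mapsto f_i(t,x,y^1,\dots,y^m,z)$ is continuous uniformly with respect to $(y^1,\dots,y^m,z)$; (2) for some $C\ge0$ and all arguments, $|f_i(t,x,y^1,\dots,y^m,z)-f_i(t,x,\bar y^1,\dots,\bar y^m,\bar z)|\le C(|y^1-\bar y^1|+\dots+|y^m-\bar y^m|+|z-\bar z|)$; (3) $(t,x)\mapsto f_i(t,x,0,\dots,0)$ is Borel measurable and of polynomial growth; (4) for every $l\in\mathcal J\setminus\{i\}$, $y^l\mapsto f_i(t,x,y^1,\dots,y^m,z)$ is non-decreasing when all other arguments are fixed. Assume that for all $i\ne j$ in $\mathcal J$ the function $g_{ij}:[0,T]\times\mathbb R^k\to\mathbb R$ is continuous, non-negative and of polynomial growth, and that for every $(t,x)\in[0,T]\times\mathbb R^k$ and every finite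 sequence $i_1,\dots,i_N\in\mathcal J$ with $N\ge3$, $i_1=i_N$ and $\mathrm{card}\{i_1,\dots,i_N\}=N-1$ one has $g_{i_1i_2}(t,x)+\dots+g_{i_{N-1}i_N}(t,x)>0$. Assume that every $h_i:\mathbb R^k\to\mathbb R$ is continuous, of polynomial growth, and $h_i(x)\ge\max_{j\in\mathcal J\setminus\{i\}}(h_j(x)-g_{ij}(T,x))$ for all $x\in\mathbb R^k$. Then the system: for all $i\in\mathcal J$, $$\min\Big\{v_i(t,x)-\max_{j\in\mathcal J\setminus\{i\}}(v_j(t,x)-g_{ij}(t,x));\ -\partial_tv_i(t,x)-\mathcal Lv_i(t,x)-f_i(t,x,v_1(t,x),\dots,v_m(t,x),\sigma^\top(t,x)D_xv_i(t,x))\Big\}=0,\qquad v_i(T,x)=h_i(x),$$ has a continuous viscosity solution $(v_1,\dots,v_m)$ with components of polynomial growth.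
   Context: $\mathcal L\varphi(t,x)=\frac12\mathrm{Tr}[(\sigma\sigma^\top)(t,x)D^2_{xx}\varphi(t,x)]+b(t,x)^\top D_x\varphi(t,x)$. A function $\phi$ is of polynomial growth if $|\phi(t,x)|\le C(1+|x|^\gamma)$ (resp. $|\phi(x)|\le C(1+|x|^\gamma)$) for some constants $C,\gamma\ge0$. A maximum over the empty set is read as $-\infty$. Jets. For $u:[0,T]\times\mathbb R^k\to\mathbb R$ lower (resp. upper) semicontinuous, the parabolic subjet $J^-u(t,x)$ (resp. superjet $J^+u(t,x)$) is the set of triples $(p,q,M)\in\mathbb R\times\mathbb R^k\times\mathbb S^k$ ($\mathbb S^k$ = symmetric real $k\times k$ matrices) with $u(t',x')\ge$ (resp. $\le$) $u(t,x)+p(t'-t)+\langle q,x'-x\rangle+\frac12\langle x'-x,M(x'-x)\rangle+o(|t'-t|+|x'-x|^2)$ as $(t',x')\to(t,x)$ in $[0,T]\times\mathbb R^k$. The limiting subjet $\bar J^-u(t,x)$ (resp. limiting superjet $\bar J^+u(t,x)$) is the set of limits $(p,q,M)=\lim_n(p_n,q_n,M_n)$ with $(p_n,q_n,M_n)\in J^-u(t_n,x_n)$ (resp. $J^+u(t_n,x_n)$), $(t_n,x_n)\to(t,x)$ and $u(t_n,x_n)\to u(t,x)$. Viscosity solutions. $(v_i)_{i\in\mathcal J}$ with every $v_i$ lower (resp. upper) semicontinuous on $[0,T]\times\mathbb R^k$ is a viscosity supersolution (resp. subsolution) of the system if for every $i\in\mathcal J$, every $(t,x)\in[0,T)\times\mathbb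 R^k$ and every $(p,q,M)\in\bar J^-v_i(t,x)$ (resp. $\bar J^+v_i(t,x)$), $$\min\Big\{v_i(t,x)-\max_{j\in\mathcal J\setminus\{i\}}(v_j(t,x)-g_{ij}(t,x));\ -p-b(t,x)^\top q-\tfrac12\mathrm{Tr}[(\sigma\sigma^\top)(t,x)M]-f_i(t,x,v_1(t,x),\dots,v_m(t,x),\sigma(t,x)^\top q)\Big\}\ge0\ (\text{resp. }\le0),$$ and $v_i(T,x)\ge h_i(x)$ (resp. $\le h_i(x)$) for all $x\in\mathbb R^k$. A tuple of continuous functions is a viscosity solution if it is both a viscosity supersolution and a viscosity subsolution. *)

(* Defs.v *)
From HB Require Import structures.
From mathcomp Require Import all_boot all_order all_algebra.
From mathcomp Require Import all_classical all_reals all_analysis.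

Set Implicit Arguments.
Unset Strict Implicit.
Unset Printing Implicit Defensive.

Import Order.TTheory GRing.Theory Num.Theory.
Import numFieldNormedType.Exports.

Local Open Scope classical_set_scope.
Local Open Scope ring_scope.

(* Points of [0, T] x R^k are pairs tx : R * 'cV[R]_k.  Functions on
   [0, T] x R^k are represented by total functions on R * 'cV[R]_k of which only
   the values on [strip k T] are ever constrained or used. *)
Definition strip (R : realType) (k : nat) (T : R) : set (R * 'cV[R]_k) :=
  [set tx | 0 <= tx.1 <= T].

(* Euclidean norm on column vectors, Frobenius norm on matrices; the norm
   `|A| of the library is the maximum of the absolute values of the entries. *)
Definition enorm (R : realType) (p q : nat) (A : 'M[R]_(p, q)) : R :=
  Num.sqrt (\sum_i \sum_j A i j ^+ 2).

Definition poly_growth_on (R : realType) (k : nat) (T : R)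
    (phi : R * 'cV[R]_k -> R) : Prop :=
  exists C gamma : R, [/\ 0 <= C, 0 <= gamma &
    forall tx, strip T tx -> `|phi tx| <= C * (1 + enorm tx.2 `^ gamma)].

Definition poly_growth (R : realType) (k : nat) (phi : 'cV[R]_k -> R) : Prop :=
  exists C gamma : R, [/\ 0 <= C, 0 <= gamma &
    forall x, `|phi x| <= C * (1 + enorm x `^ gamma)].

Definition lsc_on (R : realType) (k : nat) (T : R)
    (u : R * 'cV[R]_k -> R) : Prop :=
  @lower_semicontinuous (subspace (@strip R k T)) R (fun tx => (u tx)%:E).

Definition usc_on (R : realType) (k : nat) (T : R)
    (u : R * 'cV[R]_k -> R) : Prop :=
  lsc_on T (fun tx => - u tx).

(* u(t,x) + p (t'-t) + <q, x'-x> + 1/2 <x'-x, M (x'-x)>, at tx' = (t',x') *)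
Definition jet_poly (R : realType) (k : nat) (u : R * 'cV[R]_k -> R)
    (tx : R * 'cV[R]_k) (p : R) (q : 'cV[R]_k) (M : 'M[R]_k)
    (tx' : R * 'cV[R]_k) : R :=
  let dx := tx'.2 - tx.2 in
  u tx + p * (tx'.1 - tx.1) + (q^T *m dx) 0 0
    + 2^-1 * (dx^T *m (M *m dx)) 0 0.

(* The one-sided o(|t'-t| + |x'-x|^2) is spelled out with an arbitrary eps > 0,
   and tx' tends to tx inside [0, T] x R^k. *)
Definition subjet (R : realType) (k : nat) (T : R) (u : R * 'cV[R]_k -> R)
    (tx : R * 'cV[R]_k) : set (R * 'cV[R]_k * 'M[R]_k) :=
  [set pqM | let: (p, q, M) := pqM in
    M^T = M /\
    forall eps : R, 0 < eps ->
      \forall tx' \near within (strip T) (nbhs tx),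
        u tx' >= jet_poly u tx p q M tx'
                 - eps * (`|tx'.1 - tx.1| + enorm (tx'.2 - tx.2) ^+ 2)].

Definition superjet (R : realType) (k : nat) (T : R) (u : R * 'cV[R]_k -> R)
    (tx : R * 'cV[R]_k) : set (R * 'cV[R]_k * 'M[R]_k) :=
  [set pqM | let: (p, q, M) := pqM in
    M^T = M /\
    forall eps : R, 0 < eps ->
      \forall tx' \near within (strip T) (nbhs tx),
        u tx' <= jet_poly u tx p q M tx'
                 + eps * (`|tx'.1 - tx.1| + enorm (tx'.2 - tx.2) ^+ 2)].

Definition limiting_jet (R : realType) (k : nat) (T : R)
    (J : R * 'cV[R]_k -> set (R * 'cV[R]_k * 'M[R]_k))
    (u : R * 'cV[R]_k -> R) (tx : R * 'cV[R]_k) :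
    set (R * 'cV[R]_k * 'M[R]_k) :=
  [set pqM | exists (txn : nat -> R * 'cV[R]_k)
                    (pqMn : nat -> R * 'cV[R]_k * 'M[R]_k),
    [/\ forall n, strip T (txn n) /\ J (txn n) (pqMn n),
        txn n @[n --> \oo] --> tx,
        u (txn n) @[n --> \oo] --> u tx &
        pqMn n @[n --> \oo] --> pqM]].

Definition limiting_subjet (R : realType) (k : nat) (T : R)
    (u : R * 'cV[R]_k -> R) := limiting_jet T (subjet T u) u.

Definition limiting_superjet (R : realType) (k : nat) (T : R)
    (u : R * 'cV[R]_k -> R) := limiting_jet T (superjet T u) u.

(* max_(j != i) (w_j - c_ij), in \bar R so that it is -oo when m = 1. *)
Definition obstacle (R : realType) (m : nat) (c : 'I_m -> 'I_m -> R)
    (w : 'I_m -> R) (i : 'I_m) : \bar R :=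
  \big[maxe/-oo%E]_(j < m | j != i) (w j - c i j)%:E.

(* The left-hand side of the i-th variational inequality at tx, with p, q, M in
   place of the time derivative, the gradient and the Hessian of v_i. *)
Definition system_operator (R : realType) (k d m : nat)
    (b : R * 'cV[R]_k -> 'cV[R]_k) (sigma : R * 'cV[R]_k -> 'M[R]_(k, d))
    (f : 'I_m -> R * 'cV[R]_k -> 'cV[R]_m -> 'cV[R]_d -> R)
    (g : 'I_m -> 'I_m -> R * 'cV[R]_k -> R)
    (v : 'I_m -> R * 'cV[R]_k -> R) (i : 'I_m) (tx : R * 'cV[R]_k)
    (p : R) (q : 'cV[R]_k) (M : 'M[R]_k) : \bar R :=
  mine ((v i tx)%:E - obstacle (fun l j => g l j tx) (fun j => v j tx) i)%E
       (- p - ((b tx)^T *m q) 0 0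
        - 2^-1 * \tr (sigma tx *m (sigma tx)^T *m M)
        - f i tx (\col_j v j tx) ((sigma tx)^T *m q))%:E.

Definition viscosity_supersolution (R : realType) (k d m : nat) (T : R)
    (b : R * 'cV[R]_k -> 'cV[R]_k) (sigma : R * 'cV[R]_k -> 'M[R]_(k, d))
    (f : 'I_m -> R * 'cV[R]_k -> 'cV[R]_m -> 'cV[R]_d -> R)
    (g : 'I_m -> 'I_m -> R * 'cV[R]_k -> R) (h : 'I_m -> 'cV[R]_k -> R)
    (v : 'I_m -> R * 'cV[R]_k -> R) : Prop :=
  [/\ forall i, lsc_on T (v i),
      forall i tx, 0 <= tx.1 < T ->
        forall p q M, limiting_subjet T (v i) tx (p, q, M) ->
          (0 <= system_operator b sigma f g v i tx p q M)%E &
      forall i x, h i x <= v i (T, x)].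

Definition viscosity_subsolution (R : realType) (k d m : nat) (T : R)
    (b : R * 'cV[R]_k -> 'cV[R]_k) (sigma : R * 'cV[R]_k -> 'M[R]_(k, d))
    (f : 'I_m -> R * 'cV[R]_k -> 'cV[R]_m -> 'cV[R]_d -> R)
    (g : 'I_m -> 'I_m -> R * 'cV[R]_k -> R) (h : 'I_m -> 'cV[R]_k -> R)
    (v : 'I_m -> R * 'cV[R]_k -> R) : Prop :=
  [/\ forall i, usc_on T (v i),
      forall i tx, 0 <= tx.1 < T ->
        forall p q M, limiting_superjet T (v i) tx (p, q, M) ->
          (system_operator b sigma f g v i tx p q M <= 0)%E &
      forall i x, v i (T, x) <= h i x].

Definition viscosity_solution (R : realType) (k d m : nat) (T : R)
    (b : R * 'cV[R]_k -> 'cV[R]_k) (sigma : R * 'cV[R]_k -> 'M[R]_(k, d))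
    (f : 'I_m -> R * 'cV[R]_k -> 'cV[R]_m -> 'cV[R]_d -> R)
    (g : 'I_m -> 'I_m -> R * 'cV[R]_k -> R) (h : 'I_m -> 'cV[R]_k -> R)
    (v : 'I_m -> R * 'cV[R]_k -> R) : Prop :=
  [/\ forall i, {within strip T, continuous (v i)},
      viscosity_supersolution T b sigma f g h v &
      viscosity_subsolution T b sigma f g h v].

(* phi is continuous on [0, T] x R^k uniformly with respect to the parameter. *)
Definition continuous_unif_on (R : realType) (k : nat) (T : R) (Y : Type)
    (phi : R * 'cV[R]_k -> Y -> R) : Prop :=
  forall tx, strip T tx -> forall eps : R, 0 < eps ->
    \forall tx' \near within (strip T) (nbhs tx),
      forall y, `|phi tx' y - phi tx y| < eps.

Definition borel_on (R : realType) (k : nat) (T : R)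
    (phi : R * 'cV[R]_k -> R) : Prop :=
  @measurable_fun _ _ (g_sigma_algebraType (@open (R * 'cV[R]_k)%type)) R
    (strip T) phi.

(* Main.v *)
(* Discretise time with step [r ^ 2] and replace the diffusion by a random walk
   that moves by [r] along a random signed column of [sigma]; the gradient in [f]
   is read off from these increments, so that one step of the scheme is monotone
   for small [r].  Between two steps the obstacles are enforced by the smallest
   family above the continuation values that is closed under switching.

   The scheme is bounded by a power of [1 + |x| ^ 2].  Its equicontinuity comes
   from doubling the variables and running two walks with the same noise.  The
   obstacle is dealt with by perturbing [v_i] into
   [v_i + mu * ((v_i + B) ^ 2 / 2 - chi_i)]: since no cycle of [g] is free, there
   are potentials [chi_i] for which switching is strictly suboptimal at a maximum
   of the perturbed difference, and the square absorbs the terms that are linear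
   in the gradient.  A limit along an ultrafilter is then continuous, of
   polynomial growth, and a viscosity solution by the Barles-Souganidis argument;
   no comparison principle is needed. *)
Require Import Defs.
From mathcomp Require Import all_boot all_order all_algebra.
From mathcomp Require Import all_classical all_reals all_analysis.
From mathcomp Require Import ring lra.
Set Implicit Arguments.
Unset Strict Implicit.
Unset Printing Implicit Defensive.
Import Order.TTheory GRing.Theory Num.Theory.
Import numFieldNormedType.Exports.
Local Open Scope classical_set_scope.
Local Open Scope ring_scope.

(** * Euclidean norms and ultralimits *)

(** The obstacle is that [g] has a modulus of continuity and nothing more. When two walks from
    nearby points are compared, one step through [b], [sigma] and [f] costs a multiple of [r ^ 2],
    and there are about [T / r ^ 2] steps; a switch costs an oscillation of [g] without the factor
    [r ^ 2], and such costs cannot be summed. Hence no switch may occur at the maximising index: the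
    gain [mu * e] of the perturbation must beat the oscillation of [g], so the scale on which points
    are compared is fixed after [mu]. A perturbation affine in [v_i] would also gain [g] along a
    switch, but one step would change it by [C * |z|] with an uncontrolled slope [z]; the convexity
    of the square pays back a multiple of [z ^ 2]. For a similar reason the potentials come from
    inf-convolutions: the generator has to be bounded above on them, and [g] itself has no
    derivatives. Equicontinuity is needed only up to an additive [eps], for all small [r]. It makes
    the pointwise ultralimit also the limit along every convergent sequence of grid points, and this
    is all that the test with quadratic polynomials uses. *)

Definition dotm (R : realType) (p q : nat) (A B : 'M[R]_(p, q)) : R :=
  \sum_i \sum_j A i j * B i j.

Definition sqn (R : realType) (p q : nat) (A : 'M[R]_(p, q)) : R := dotm A A.

Section euclidean.
Variables (R : realType) (p q : nat).
Implicit Types A B C : 'M[R]_(p, q).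

Lemma dotmC A B : dotm A B = dotm B A.
Proof. by apply: eq_bigr => i _; apply: eq_bigr => j _; rewrite mulrC. Qed.

Lemma dotmDl A B C : dotm (A + B) C = dotm A C + dotm B C.
Proof.
rewrite -big_split; apply: eq_bigr => i _; rewrite -big_split.
by apply: eq_bigr => j _; rewrite mxE mulrDl.
Qed.

Lemma dotmZl a A B : dotm (a *: A) B = a * dotm A B.
Proof.
rewrite mulr_sumr; apply: eq_bigr => i _; rewrite mulr_sumr.
by apply: eq_bigr => j _; rewrite mxE mulrA.
Qed.

Lemma dotmDr A B C : dotm A (B + C) = dotm A B + dotm A C.
Proof. by rewrite !(dotmC A) dotmDl. Qed.

Lemma dotmZr a A B : dotm A (a *: B) = a * dotm A B.
Proof. by rewrite !(dotmC A) dotmZl. Qed.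

Lemma dotmNl A B : dotm (- A) B = - dotm A B.
Proof. by rewrite -scaleN1r dotmZl mulN1r. Qed.

Lemma dotmNr A B : dotm A (- B) = - dotm A B.
Proof. by rewrite !(dotmC A) dotmNl. Qed.

Lemma sqn_ge0 A : 0 <= sqn A.
Proof. by apply: sumr_ge0 => i _; apply: sumr_ge0 => j _; rewrite -expr2 sqr_ge0. Qed.

Lemma enormE A : enorm A = Num.sqrt (sqn A).
Proof.
by congr Num.sqrt; apply: eq_bigr => i _; apply: eq_bigr => j _; rewrite expr2.
Qed.

Lemma enorm_ge0 A : 0 <= enorm A. Proof. exact: sqrtr_ge0. Qed.

Lemma enorm_sq A : enorm A ^+ 2 = sqn A.
Proof. by rewrite enormE sqr_sqrtr // sqn_ge0. Qed.

Lemma sqn0 : sqn (0 : 'M[R]_(p, q)) = 0.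
Proof. by apply: big1 => i _; apply: big1 => j _; rewrite mxE mul0r. Qed.

Lemma enorm0 : enorm (0 : 'M[R]_(p, q)) = 0.
Proof. by rewrite enormE sqn0 sqrtr0. Qed.

Lemma sqnN A : sqn (- A) = sqn A.
Proof. by rewrite /sqn dotmNl dotmNr opprK. Qed.

Lemma enormN A : enorm (- A) = enorm A.
Proof. by rewrite !enormE sqnN. Qed.

Lemma enormB A B : enorm (A - B) = enorm (B - A).
Proof. by rewrite -enormN opprB. Qed.

Lemma sqnZ a A : sqn (a *: A) = a ^+ 2 * sqn A.
Proof. by rewrite /sqn dotmZl dotmZr mulrA. Qed.

Lemma sqnD A B : sqn (A + B) = sqn A + 2 * dotm A B + sqn B.
Proof. rewrite /sqn dotmDl !dotmDr (dotmC B A); ring. Qed.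

Lemma normr_dotm2 A B : 2 * `|dotm A B| <= sqn A + sqn B.
Proof.
have h1 := sqn_ge0 (A + B); have h2 := sqn_ge0 (A - B).
rewrite !sqnD sqnN dotmNr in h1 h2.
by have [? | ?] := ger0P (dotm A B); lra.
Qed.

Lemma sqnD_le A B : sqn (A + B) <= 2 * sqn A + 2 * sqn B.
Proof. by rewrite sqnD; have := normr_dotm2 A B; have := ler_norm (dotm A B); lra. Qed.

Lemma normr_entry A i j : `|A i j| <= enorm A.
Proof.
rewrite -(@ler_pXn2r _ 2) ?nnegrE ?enorm_ge0 // enorm_sq real_normK ?num_real //.
rewrite /sqn /dotm (bigD1 i) //= (bigD1 j) //= -expr2 -addrA lerDl.
by rewrite addr_ge0 ?sumr_ge0 // => *; rewrite ?sumr_ge0 // => *; rewrite -expr2 sqr_ge0.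
Qed.

Lemma enorm_eq0 A : enorm A = 0 -> A = 0.
Proof.
move=> A0; apply/matrixP => i j; rewrite mxE; apply/eqP.
by rewrite -normr_le0 -A0 normr_entry.
Qed.

Lemma cauchy_schwarz A B : `|dotm A B| <= enorm A * enorm B.
Proof.
have dot0 X : dotm (0 : 'M[R]_(p, q)) X = 0.
  by rewrite -(scale0r (0 : 'M[R]_(p, q))) dotmZl mul0r.
have [/eqP|a0] := eqVneq (enorm A * enorm B) 0.
  rewrite mulf_eq0 => /orP[]/eqP/enorm_eq0 ->; last rewrite dotmC.
    by rewrite dot0 normr0 enorm0 mul0r.
  by rewrite dot0 normr0 enorm0 mulr0.
have : 0 < enorm A * enorm B by rewrite lt_neqAle eq_sym a0 mulr_ge0 ?enorm_ge0.
have := enorm_ge0 A; have := enorm_ge0 B.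
have := normr_dotm2 (enorm B *: A) (enorm A *: B).
rewrite dotmZl dotmZr !sqnZ -!enorm_sq !normrM !(ger0_norm (enorm_ge0 _)).
set a := enorm A; set b := enorm B; set c := `|_| => h b0 a0' ab0.
have : b * a * c <= b * a * (a * b) by lra.
by rewrite ler_pM2l // mulrC.
Qed.

Lemma enormD A B : enorm (A + B) <= enorm A + enorm B.
Proof.
rewrite -(@ler_pXn2r _ 2) ?nnegrE ?addr_ge0 ?enorm_ge0 // enorm_sq sqnD -!enorm_sq.
have := cauchy_schwarz A B; have := ler_norm (dotm A B); nra.
Qed.

Lemma normr_entry_mx A i j : `|A i j| <= `|A|.
Proof.
rewrite [leRHS]/Num.norm/= mx_normrE.
exact: (le_bigmax _ (fun ij : 'I_p * 'I_q => `|A ij.1 ij.2|) (i, j)).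
Qed.

Lemma enorm_le_mx_norm A : enorm A <= (p * q)%:R * `|A|.
Proof.
have [n0 | n0] := eqVneq `|A| 0.
  by move/normr0_eq0: n0 => ->; rewrite enorm0 normr0 mulr0.
have np : 0 < `|A| by rewrite lt_neqAle eq_sym n0 /=.
rewrite -(@ler_pXn2r _ 2) ?nnegrE ?enorm_ge0 ?mulr_ge0 // enorm_sq.
have : sqn A <= (p * q)%:R * `|A| ^+ 2.
  have -> : (p * q)%:R * `|A| ^+ 2 = \sum_(i < p) \sum_(j < q) `|A| ^+ 2.
    by rewrite sumr_const card_ord sumr_const card_ord -mulrnA mulnC mulr_natl.
  apply: ler_sum => i _; apply: ler_sum => j _.
  by rewrite -expr2 -(@real_normK _ (A i j)) ?num_real // lerXn2r ?nnegrE ?normr_entry_mx.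
have [-> | n1] := posnP (p * q)%N; first by rewrite mul0r => h; rewrite mul0r expr0n.
move/le_trans; apply; rewrite exprMn ler_wpM2r ?sqr_ge0 //.
by rewrite -natrX ler_nat -[leqLHS]expn1 leq_pexp2l.
Qed.

Lemma mx_norm_le_enorm A : `|A| <= enorm A.
Proof.
rewrite [leLHS]/Num.norm/= mx_normrE; apply: bigmax_le => [|ij _].
  exact: enorm_ge0.
exact: normr_entry.
Qed.
End euclidean.

Section neighbourhoods.
Variables (R : realType) (k : nat).
Implicit Types (P : set (R * 'cV[R]_k)) (tx : R * 'cV[R]_k).

Lemma nbhs_enorm tx P : nbhs tx P <-> exists2 r : R, 0 < r &
  forall ty, `|ty.1 - tx.1| < r -> enorm (ty.2 - tx.2) < r -> P ty.
Proof.
split=> [/nbhs_ballP[r r0 h] | [r r0 h]].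
  exists r => // ty h1 h2; apply: h; split => /=.
    by rewrite -ball_normE /ball_ /= distrC.
  by rewrite -ball_normE /ball_ /= distrC (le_lt_trans (mx_norm_le_enorm _)).
(* The successor keeps the denominator positive even for [k = 0] and leaves room for a strict
   inequality. *)
apply/nbhs_ballP; pose e := r / (k * 1).+1%:R.
have e0 : 0 < e by rewrite divr_gt0.
have er : (k * 1).+1%:R * e = r by rewrite /e mulrC divfK // pnatr_eq0.
exists e => //= -[t x] [/=]; rewrite -!ball_normE /ball_ /= => ht hx; apply: h => /=.
  rewrite distrC (lt_le_trans ht) // -er ler_peMl ?(ltW e0) //.
  by rewrite ler1n.
rewrite enormB (le_lt_trans (enorm_le_mx_norm _)) // -er.
apply: (@le_lt_trans _ _ ((k * 1)%:R * e)).
  by rewrite ler_wpM2l // ltW.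
by rewrite ltr_pM2r // ltr_nat.
Qed.

Lemma nbhs_enorm_col (x : 'cV[R]_k) (P : set 'cV[R]_k) : nbhs x P <-> exists2 r : R, 0 < r &
  forall y, enorm (y - x) < r -> P y.
Proof.
split=> [/nbhs_ballP[r r0 h] | [r r0 h]].
  exists r => // y h2; apply: h => /=.
  by rewrite -ball_normE /ball_ /= distrC (le_lt_trans (mx_norm_le_enorm _)).
have : nbhs ((0 : R), x) [set ty | P ty.2].
  by apply/nbhs_enorm; exists r => //= ty _; exact: h.
move=> /nbhs_ballP[e e0 he]; apply/nbhs_ballP; exists e => // y hy.
by apply: (he (0, y)); split => //=; exact: ballxx.
Qed.
End neighbourhoods.

Section ultralimits.
Variables (R : realType) (U : set_system nat).
Hypotheses (UU : UltraFilter U) (Uoo : forall n, U [set m | (n <= m)%N]).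

Definition ulim_to (a : nat -> R) (l : R) :=
  forall e, 0 < e -> U [set n | `|a n - l| < e].

Lemma ultraP (A : set nat) : ~ U A -> U (~` A).
Proof. by case: (in_ultra_setVsetC A UU). Qed.

Lemma ultra_ex (A : set nat) : U A -> exists n, A n.
Proof. by move=> /filter_ex. Qed.

(** The limit is the supremum of the levels that stay below the sequence on a set of the
    ultrafilter. A level slightly above it does not, so by maximality of the ultrafilter the
    sequence stays below that level on a set of [U]. *)
Lemma ulim_exists (a : nat -> R) M :
  (forall n, `|a n| <= M) -> exists2 l, ulim_to a l & `|l| <= M.
Proof.
move=> aM; pose S := [set x | U [set n | x <= a n]].
have S0 : S (- M) by apply: filterE => n /=; have := aM n; rewrite ler_norml => /andP[].
have SM : ubound S M.
  by move=> x /ultra_ex[n /= /le_trans]; apply; have := aM n; rewrite ler_norml => /andP[].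
have hS : has_sup S by split; [exists (- M) | exists M].
exists (sup S); last first.
  by rewrite ler_norml ge_sup //=; [rewrite andbT; apply: ub_le_sup => //; exists M | exists (- M)].
move=> e e0; have [x Sx xs] := sup_adherent e0 hS.
have NS : ~ S (sup S + e / 2).
  by move=> /(ub_le_sup (ex_intro _ M SM)); lra.
apply: filterS2 Sx (ultraP NS) => n /= h1 /negP; rewrite -ltNge => h2.
by rewrite ltr_norml; apply/andP; split; lra.
Qed.

Lemma ulim_near (a : nat -> R) l : (forall e, 0 < e -> exists N, forall n, (N <= n)%N -> `|a n - l| < e) ->
  ulim_to a l.
Proof. by move=> h e /h[N hN]; apply: filterS (Uoo N) => n; exact: hN. Qed.

Lemma ulim_le (a b : nat -> R) la lb :
  ulim_to a la -> ulim_to b lb -> U [set n | a n <= b n] -> la <= lb.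
Proof.
move=> ha hb hab; apply/ler_addgt0Pr => e e0.
have e2 : 0 < e / 2 by rewrite divr_gt0.
have [n [[/= h1 h2] h3]] := ultra_ex (filterI (filterI (ha _ e2) (hb _ e2)) hab).
move: h1 h2; rewrite !ltr_distl => /andP[? ?] /andP[? ?]; lra.
Qed.

Lemma ulim_uniq (a : nat -> R) l l' : ulim_to a l -> ulim_to a l' -> l = l'.
Proof.
move=> h h'; have aa : U [set n | a n <= a n] by apply: filterE => n /=.
by apply/eqP; rewrite eq_le (ulim_le h h' aa) (ulim_le h' h aa).
Qed.

Lemma ulim_cst (c : R) : ulim_to (fun=> c) c.
Proof. by move=> e e0; apply: filterE => n /=; rewrite subrr normr0. Qed.

Lemma ulimD (a b : nat -> R) la lb :
  ulim_to a la -> ulim_to b lb -> ulim_to (fun n => a n + b n) (la + lb).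
Proof.
move=> ha hb e e0; have e2 : 0 < e / 2 by rewrite divr_gt0.
apply: filterS2 (ha _ e2) (hb _ e2) => n /= h1 h2.
by rewrite opprD addrACA (le_lt_trans (ler_normD _ _)) //; lra.
Qed.

Lemma ulimM (a b : nat -> R) la lb :
  ulim_to a la -> ulim_to b lb -> ulim_to (fun n => a n * b n) (la * lb).
Proof.
move=> ha hb e e0.
pose q := Num.min 1 (e / (1 + `|la| + `|lb|)).
have s0 : 0 < 1 + `|la| + `|lb| by rewrite -addrA ltr_pwDl ?addr_ge0.
have q0 : 0 < q by rewrite lt_min ltr01 divr_gt0.
apply: filterS2 (ha _ q0) (hb _ q0) => n /= h1 h2.
have q1 : q <= 1 by rewrite ge_min lexx.
have q2 : q * (1 + `|la| + `|lb|) <= e.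
  by rewrite -ler_pdivlMr // ge_min lexx orbT.
have -> : a n * b n - la * lb = (a n - la) * (b n - lb) + la * (b n - lb) + lb * (a n - la) by ring.
rewrite (le_lt_trans (ler_normD _ _)) // normrM.
rewrite (le_lt_trans (lerD (ler_normD _ _) (lexx _))) // !normrM.
have := normr_ge0 (a n - la); have := normr_ge0 (b n - lb).
move: `|a n - la| `|b n - lb| h1 h2 => x y h1 h2 y0 x0.
apply: lt_le_trans q2; have := normr_ge0 la; have := normr_ge0 lb.
move: `|la| `|lb| => u v v0 u0; nra.
Qed.

Lemma ulimN (a : nat -> R) la : ulim_to a la -> ulim_to (fun n => - a n) (- la).
Proof. by move=> h e /h; apply: filterS => n /=; rewrite -opprD normrN. Qed.

Lemma ulim_sum (I : Type) (r : seq I) (a : I -> nat -> R) (l : I -> R) :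
  (forall i, ulim_to (a i) (l i)) ->
  ulim_to (fun n => \sum_(i <- r) a i n) (\sum_(i <- r) l i).
Proof.
move=> h; elim: r => [|i r IH].
  by move=> e e0; apply: filterE => n /=; rewrite !big_nil subrr normr0.
by move=> e e0; apply: filterS (ulimD (h i) IH e0) => n /=; rewrite !big_cons.
Qed.

Lemma ulim_eq (a b : nat -> R) l : U [set n | a n = b n] -> ulim_to a l -> ulim_to b l.
Proof. by move=> hab ha e e0; apply: filterS2 hab (ha _ e0) => n /= <-. Qed.

Definition ulimv_to (k : nat) (x : nat -> 'cV[R]_k) (l : 'cV[R]_k) :=
  forall e, 0 < e -> U [set n | enorm (x n - l) < e].

Lemma ulimv_entries k (x : nat -> 'cV[R]_k) (l : 'cV[R]_k) :
  (forall i, ulim_to (fun n => x n i 0) (l i 0)) -> ulimv_to x l.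
Proof.
move=> h e e0.
have : ulim_to (fun n => \sum_i \sum_j ((x n - l) i j * (x n - l) i j))
         (\sum_(i < k) \sum_(j < 1) 0 * 0).
  have h' i : ulim_to (fun n => (x n - l) i 0) 0.
    by move=> s s0; apply: filterS (h i s s0) => n /=; rewrite !mxE subr0.
  apply: ulim_sum => i; apply: ulim_sum => j; rewrite (ord1 j).
  by apply: ulimM; exact: h'.
rewrite big1; last by move=> i _; rewrite big1 // => j _; rewrite mulr0.
have e2 : 0 < e ^+ 2 by rewrite exprn_gt0.
move=> /(_ _ e2); apply: filterS => n /=; rewrite subr0 => h2.
rewrite -(@ltr_pXn2r _ 2) ?nnegrE ?enorm_ge0 ?(ltW e0) // enorm_sq.
exact: le_lt_trans (ler_norm _) h2.
Qed.

Lemma ulimv_exists k (x : nat -> 'cV[R]_k) M :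
  (forall n, enorm (x n) <= M) -> exists l, ulimv_to x l.
Proof.
move=> xM.
have /choice[l hl] : forall i : 'I_k, exists l, ulim_to (fun n => x n i 0) l.
  move=> i; have [n|l ? _] := @ulim_exists (fun n => x n i 0) M; last by exists l.
  exact: le_trans (normr_entry _ _ _) (xM n).
by exists (\col_i l i); apply: ulimv_entries => i; rewrite mxE.
Qed.

Lemma ulimv_entry k (x : nat -> 'cV[R]_k) (l : 'cV[R]_k) i :
  ulimv_to x l -> ulim_to (fun n => x n i 0) (l i 0).
Proof.
move=> h e /h; apply: filterS => n /= hn; apply: le_lt_trans hn.
by have := normr_entry (x n - l) i 0; rewrite !mxE.
Qed.

Lemma ulimv_enorm_le k (x : nat -> 'cV[R]_k) l M :
  ulimv_to x l -> U [set n | enorm (x n) <= M] -> enorm l <= M.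
Proof.
move=> h hM; apply/ler_addgt0Pr => e e0.
have [n [/= h1 h2]] := ultra_ex (filterI (h _ e0) hM).
have -> : l = - (x n - l) + x n by rewrite opprB subrK.
by rewrite (le_trans (enormD _ _)) // enormN; lra.
Qed.
End ultralimits.

Lemma ultra_oo : exists2 U : set_system nat, UltraFilter U &
  forall n, U [set m | (n <= m)%N].
Proof.
have [U [UU hU]] := @ultraFilterLemma nat \oo _.
by exists U => // n; apply: hU; exists n.
Qed.

(** * Random walk and change of weights *)

Section noise.
Variables (R : realType) (d : nat).
Implicit Types (e W : 'I_d -> bool -> R) (r a C ka kb : R).

Definition sg (s : bool) : R := if s then 1 else -1.

(** Expectation over the noise of one step: a column index and a sign, independent and uniform. *)
Definition Ex e : R := d%:R^-1 * \sum_k ((e k true + e k false) / 2).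

(** The walk jumps by [sqrt d * r] along column [k] of [sigma], so this symmetric difference
    quotient approximates the [k]-th entry of [sigma^T Dv]. *)
Definition Zg r e : 'cV[R]_d :=
  \col_k ((e k true - e k false) / (2 * (Num.sqrt d%:R * r))).

(** A discrete Girsanov density: [c] changes the total mass (dependence on the value), [tau] adds a
    drift along the columns (dependence on the slope). In [admissible], the factor [sqrt d] in the
    bound on [tau] undoes the normalisation of [Zg]. *)
Definition weight r c (tau : 'I_d -> R) : 'I_d -> bool -> R :=
  fun k s => 1 + r ^+ 2 * c + sg s * (r * tau k).

Definition admissible r (C0 C1 : R) W := exists c tau,
  [/\ `|c| <= C0, forall k, `|tau k| <= C1 * Num.sqrt d%:R & W = weight r c tau].

Lemma sg_sq s : sg s * sg s = 1.
Proof. by case: s; rewrite /sg ?mulrNN mulr1. Qed.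

Lemma norm_sg s : `|sg s| = 1.
Proof. by case: s; rewrite /sg ?normrN normr1. Qed.

Lemma Ex_le e e' : (forall k s, e k s <= e' k s) -> Ex e <= Ex e'.
Proof.
move=> h; rewrite ler_wpM2l ?invr_ge0 // ler_sum // => k _.
by rewrite ler_wpM2r ?invr_ge0 // lerD.
Qed.

Lemma ExD e e' : Ex (fun k s => e k s + e' k s) = Ex e + Ex e'.
Proof.
rewrite /Ex -mulrDr -big_split /=; congr (_ * _); apply: eq_bigr => k _.
by rewrite -mulrDl addrACA.
Qed.

Lemma ExZ a e : Ex (fun k s => a * e k s) = a * Ex e.
Proof.
rewrite /Ex mulrCA; congr (_ * _); rewrite mulr_sumr; apply: eq_bigr => k _.
by rewrite -mulrDr mulrA.
Qed.

Lemma ExN e : Ex (fun k s => - e k s) = - Ex e.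
Proof. by rewrite -mulN1r -ExZ; congr Ex; apply/funext => k; apply/funext => s; rewrite mulN1r. Qed.

Lemma ExB e e' : Ex (fun k s => e k s - e' k s) = Ex e - Ex e'.
Proof. by rewrite ExD ExN. Qed.

Lemma Ex_odd (a : 'I_d -> R) : Ex (fun k s => sg s * a k) = 0.
Proof.
rewrite /Ex big1 ?mulr0 // => k _; rewrite /sg mul1r mulN1r subrr mul0r //.
Qed.

Lemma ZgB r e e' : Zg r (fun k s => e k s - e' k s) = Zg r e - Zg r e'.
Proof. by apply/matrixP => i j; rewrite !mxE -mulrBl; congr (_ / _); ring. Qed.

Hypothesis d_gt0 : (0 < d)%N.

Lemma d_neq0 : d%:R != 0 :> R. Proof. by rewrite pnatr_eq0 -lt0n. Qed.

Lemma sqrtd_gt0 : 0 < Num.sqrt d%:R :> R. Proof. by rewrite sqrtr_gt0 ltr0n. Qed.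

Lemma sqrtd_sq : Num.sqrt d%:R * Num.sqrt d%:R = d%:R :> R.
Proof. by rewrite -expr2 sqr_sqrtr. Qed.

Lemma Ex_cst a : Ex (fun _ _ => a) = a.
Proof.
rewrite /Ex sumr_const card_ord -[X in _ * X]mulr_natl mulKf ?d_neq0 //; lra.
Qed.

Lemma Ex_norm e : `|Ex e| <= Ex (fun k s => `|e k s|).
Proof.
rewrite ler_norml -ExN; apply/andP; split; apply: Ex_le => k s.
  by rewrite lerNl -normrN ler_norm.
exact: ler_norm.
Qed.

(* The Lipschitz dependence of [f] on the value and on the gradient amounts to a
   change of the weights of the walk. *)
Lemma tilt r (C0 C1 : R) e : 0 < r -> 0 <= C0 -> 0 <= C1 ->
  exists2 W, admissible r C0 C1 W &
    Ex e + r ^+ 2 * C0 * `|Ex e| + r ^+ 2 * C1 * enorm (Zg r e)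
    = Ex (fun k s => W k s * e k s).
Proof.
move=> r0 C00 C10; set z := enorm _.
(* Unit vector in the direction of the slope, whose scalar product with the slope is its norm; the
   value for zero slope is immaterial but must satisfy the bound. *)
pose th k := if z == 0 then 0 else Zg r e k 0 / z.
have th1 k : `|th k| <= 1.
  rewrite /th; case: eqP => [_|/eqP z0]; first by rewrite normr0.
  have zp : 0 < z by rewrite lt_neqAle eq_sym z0 enorm_ge0.
  by rewrite normrM normfV (gtr0_norm zp) ler_pdivrMr // mul1r normr_entry.
have thZ : \sum_k th k * Zg r e k 0 = z.
  rewrite /th; case: eqP => [->|/eqP z0].
    by rewrite big1 // => k _; rewrite mul0r.
  apply: (mulIf z0); rewrite mulr_suml -expr2 enorm_sq; apply: eq_bigr => k _.
  by rewrite big_ord1; field.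
pose tau k := C1 * Num.sqrt d%:R * th k.
exists (weight r (C0 * Num.sg (Ex e)) tau).
  exists (C0 * Num.sg (Ex e)), tau; split => //.
    rewrite normrM ger0_norm // ler_piMr // normr_sg.
    by case: (_ != 0).
  by move=> k; rewrite normrM ger0_norm ?mulr_ge0 ?sqrtr_ge0 // ler_piMr ?mulr_ge0 ?sqrtr_ge0.
rewrite -thZ.
have -> : (fun k s => weight r (C0 * Num.sg (Ex e)) tau k s * e k s) =
   (fun k s => (1 + r ^+ 2 * (C0 * Num.sg (Ex e))) * e k s + sg s * (r * tau k) * e k s).
  by apply/funext => k; apply/funext => s; rewrite -mulrDl.
rewrite ExD ExZ [X in _ = X + _]mulrDl mul1r -!mulrA [`|Ex e|]normrEsg; congr (_ + _).
rewrite /Ex !mulr_sumr; apply: eq_bigr => k _; rewrite mxE /sg /tau.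
have := sqrtd_gt0; rewrite -[d%:R^-1](congr1 GRing.inv sqrtd_sq).
move: (Num.sqrt _) => q q0; field.
by rewrite !gt_eqF.
Qed.

(** Positive weights make a step monotone. The bound [1 / 2], instead of mere positivity, lets half
    of the variance survive a change of weights. *)
Lemma admissible_ge r (C0 C1 : R) W : 0 <= r -> r ^+ 2 * C0 + r * (C1 * Num.sqrt d%:R) <= 1 / 2 ->
  admissible r C0 C1 W -> forall k s, 1 / 2 <= W k s.
Proof.
move=> r0 h [c [tau [hc htau ->]]] k s; rewrite /weight.
have h1 : - (r ^+ 2 * C0) <= r ^+ 2 * c.
  by rewrite -mulrN ler_wpM2l ?sqr_ge0 //; move: hc; rewrite ler_norml => /andP[].
have h2 : `|sg s * (r * tau k)| <= r * (C1 * Num.sqrt d%:R).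
  by rewrite normrM norm_sg mul1r normrM ger0_norm // ler_wpM2l.
by move: h2; rewrite ler_norml => /andP[]; lra.
Qed.

Lemma admissible1 r (C0 C1 : R) : 0 <= C0 -> 0 <= C1 -> admissible r C0 C1 (fun _ _ => 1).
Proof.
move=> ? ?; exists 0, (fun=> 0); split; rewrite ?normr0 //.
  by move=> _; rewrite mulr_ge0 ?sqrtr_ge0.
by apply/funext => k; apply/funext => s; rewrite /weight !mulr0 !addr0.
Qed.

Lemma Ex_weight_mul r c tau e :
  Ex (fun k s => weight r c tau k s * e k s) =
  (1 + r ^+ 2 * c) * Ex e + r * Ex (fun k s => sg s * tau k * e k s).
Proof.
rewrite -!ExZ -ExD; congr Ex; apply/funext => k; apply/funext => s.
by rewrite /weight; ring.
Qed.

Lemma Ex_weight r c tau : Ex (weight r c tau) = 1 + r ^+ 2 * c.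
Proof. by rewrite /weight ExD Ex_cst Ex_odd addr0. Qed.

(* [p] equals [p0] up to an odd term of size [r * p0] and an error of size
   [r ^ 2 * p0]: a property stable under products, hence under powers. *)
Definition nice r ka p0 (p : 'I_d -> bool -> R) := 0 <= p0 /\
  exists2 a, forall k, `|a k| <= ka * r * p0 &
    forall k s, `|p k s - (p0 + sg s * a k)| <= ka * r ^+ 2 * p0.

(** The odd part of [p] has mean zero and meets only the odd part of the weight. Both have a factor
    [r], so their product contributes at order [r ^ 2], like every other error. *)
Lemma Ex_nice r (C0 C1 : R) W ka p0 p : 0 <= r <= 1 -> 0 <= ka -> 0 <= C0 -> 0 <= C1 ->
  r ^+ 2 * C0 + r * (C1 * Num.sqrt d%:R) <= 1 / 2 ->
  admissible r C0 C1 W -> nice r ka p0 p ->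
  Ex (fun k s => W k s * p k s) <= (1 + r ^+ 2 * (C0 + ka + C0 * ka + C1 * Num.sqrt d%:R * ka)) * p0.
Proof.
move=> /andP[r0 r1] ka0 C00 C10 hr hW [p00 [a ha hp]].
have W0 k s : 0 <= W k s by have := admissible_ge r0 hr hW k s; lra.
case: hW => c [tau [hc htau eW]].
have le1 : Ex (fun k s => W k s * p k s) <=
    Ex (fun k s => W k s * (p0 + ka * r ^+ 2 * p0 + sg s * a k)).
  apply: Ex_le => k s; rewrite ler_wpM2l //.
  by have := hp k s; rewrite ler_norml => /andP[]; lra.
apply: le_trans le1 _; rewrite eW Ex_weight_mul ExD Ex_cst Ex_odd addr0.
set E2 := Ex _.
have E2e : E2 <= C1 * Num.sqrt d%:R * (ka * r * p0).
  rewrite -[leRHS]Ex_cst /E2 (_ : (fun k s => _) =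
      (fun k s => sg s * (tau k * (p0 + ka * r ^+ 2 * p0)) + tau k * a k)); last first.
    apply/funext => k; apply/funext => s; rewrite mulrDr; congr (_ + _); first by ring.
    by rewrite mulrACA sg_sq mul1r.
  rewrite ExD Ex_odd add0r; apply: Ex_le => k _.
  rewrite (le_trans (ler_norm _)) // normrM ler_pM //.
have h1 : r * E2 <= r * (C1 * Num.sqrt d%:R * (ka * r * p0)) by rewrite ler_wpM2l.
have cC : c <= C0 by rewrite (le_trans (ler_norm _)).
have rr0 := sqr_ge0 r; have rr1 : r ^+ 2 <= 1 by rewrite expr_le1.
have h2 : r ^+ 2 * c * p0 <= r ^+ 2 * C0 * p0 by rewrite ler_wpM2r // ler_wpM2l.
have h3 : r ^+ 2 * (r ^+ 2 * c * (ka * p0)) <= r ^+ 2 * (1 * C0 * (ka * p0)).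
  rewrite ler_wpM2l // ler_wpM2r ?mulr_ge0 //.
  apply: (@le_trans _ _ (r ^+ 2 * C0)); first by rewrite ler_wpM2l.
  by rewrite ler_wpM2r.
move: h1 h2 h3; rewrite !mul1r; lra.
Qed.

(** The product of the two odd parts is even, since the squared sign is [1], and has size [r ^ 2];
    it joins the error. The constant is crude but chosen so that it iterates well. *)
Lemma nice_mul r ka kb p0 q0 p q : 0 <= r <= 1 -> 0 <= ka -> 0 <= kb ->
  nice r ka p0 p -> nice r kb q0 q ->
  nice r (ka + kb + 4 * ka * kb) (p0 * q0) (fun k s => p k s * q k s).
Proof.
move=> /andP[r0 r1] ka0 kb0 [p00 [a ha hp]] [q00 [b hb hq]].
have rr0 := sqr_ge0 r; have rr1 : r ^+ 2 <= 1 by rewrite expr_le1.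
split; first by rewrite mulr_ge0.
have kk0 : 0 <= ka * kb * r * (p0 * q0) by rewrite !mulr_ge0.
exists (fun k => a k * q0 + b k * p0).
  move=> k; rewrite (le_trans (ler_normD _ _)) // !normrM !(ger0_norm p00) !(ger0_norm q00).
  have : `|a k| * q0 <= ka * r * p0 * q0 by rewrite ler_wpM2r.
  have : `|b k| * p0 <= kb * r * q0 * p0 by rewrite ler_wpM2r.
  by lra.
move=> k s.
have := hp k s; have := hq k s.
set u := p k s - _; set v := q k s - _ => hv hu.
have -> : p k s * q k s - (p0 * q0 + sg s * (a k * q0 + b k * p0)) =
   a k * b k * (sg s * sg s) + u * (q0 + sg s * b k + v) + v * (p0 + sg s * a k).
  by rewrite /u /v; ring.
rewrite sg_sq mulr1.
have A1 : `|a k * b k| <= ka * kb * r ^+ 2 * (p0 * q0).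
  rewrite normrM (_ : ka * kb * _ * _ = (ka * r * p0) * (kb * r * q0)); last by ring.
  by rewrite ler_pM.
have sb : `|sg s * b k| <= kb * q0.
  rewrite normrM norm_sg mul1r (le_trans (hb k)) // ler_wpM2r // ler_piMr //.
have sa : `|sg s * a k| <= ka * p0.
  rewrite normrM norm_sg mul1r (le_trans (ha k)) // ler_wpM2r // ler_piMr //.
have vb : `|v| <= kb * q0.
  by rewrite (le_trans hv) // ler_wpM2r // ler_piMr.
have A2 : `|u * (q0 + sg s * b k + v)| <= (ka * r ^+ 2 * p0) * (q0 + kb * q0 + kb * q0).
  rewrite normrM ler_pM // (le_trans (ler_normD _ _)) // lerD //.
  by rewrite (le_trans (ler_normD _ _)) // lerD // ger0_norm.
have A3 : `|v * (p0 + sg s * a k)| <= (kb * r ^+ 2 * q0) * (p0 + ka * p0).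
  rewrite normrM ler_pM // (le_trans (ler_normD _ _)) // lerD //.
  by rewrite ger0_norm.
rewrite (le_trans (ler_normD _ _)) // (le_trans (lerD (ler_normD _ _) (lexx _))) //.
lra.
Qed.

(** The combination law of [nice_mul] says that [1 + 4 * ka] is multiplicative: [1 + 4 * (ka + kb +
    4 * ka * kb) = (1 + 4 * ka) * (1 + 4 * kb)]. This is the origin of the constant. *)
Lemma nice_exp r ka p0 p n : 0 <= r <= 1 -> 0 <= ka -> nice r ka p0 p ->
  nice r (((1 + 4 * ka) ^+ n - 1) / 4) (p0 ^+ n) (fun k s => p k s ^+ n).
Proof.
move=> r01 ka0 hp; elim: n => [|n IH].
  split => //; exists (fun=> 0) => [k|k s]; rewrite ?normr0 !expr0 subrr !mul0r //.
  by rewrite mulr0 addr0 subrr normr0.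
have e0 : 0 <= (((1 + 4 * ka) ^+ n - 1) / 4).
  by rewrite divr_ge0 // subr_ge0 exprn_ege1 // lerDl mulr_ge0.
have := nice_mul r01 ka0 e0 hp IH.
rewrite (_ : ka + _ + _ = ((1 + 4 * ka) ^+ n.+1 - 1) / 4); last by rewrite exprS; field.
by rewrite -exprS; congr nice; apply/funext => k; apply/funext => s; rewrite exprS.
Qed.

(** The reference value [p0] may exceed [sqn D]. This covers [1 + |x| ^ 2] for one walk,
    [|x - y| ^ 2] for two walks with the same noise, and [1 + |x - z| ^ 2] for a walk seen from a
    fixed point. *)
Lemma nice_quad (k : nat) r ka p0 (D b : 'cV[R]_k) (c : 'I_d -> 'cV[R]_k) :
  0 <= r <= 1 -> 0 <= ka -> sqn D <= p0 -> sqn b <= ka * p0 ->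
  (forall l, sqn (c l) <= ka * p0) ->
  nice r (1 + 5 * ka) p0 (fun l s => p0 - sqn D + sqn (D + r ^+ 2 *: b + (sg s * r) *: c l)).
Proof.
move=> /andP[r0 r1] ka0 hD hb hc.
have p00 : 0 <= p0 by rewrite (le_trans (sqn_ge0 D)).
have kp : 0 <= ka * p0 by rewrite mulr_ge0.
have rr0 := sqr_ge0 r; have rr1 : r ^+ 2 <= 1 by rewrite expr_le1.
split => //; exists (fun l => 2 * r * dotm D (c l)) => [l|l s].
  have h : 2 * `|dotm D (c l)| <= (1 + 5 * ka) * p0.
    by have := normr_dotm2 D (c l); have := hc l; lra.
  rewrite !normrM (ger0_norm r0) (@ger0_norm _ 2) //.
  by have := ler_wpM2l r0 h; lra.
rewrite -[D + _ + _]addrA sqnD dotmDr !dotmZr.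
have -> : p0 - sqn D + (sqn D + 2 * (r ^+ 2 * dotm D b + sg s * r * dotm D (c l)) +
   sqn (r ^+ 2 *: b + (sg s * r) *: c l)) - (p0 + sg s * (2 * r * dotm D (c l))) =
   r ^+ 2 * (2 * dotm D b) + sqn (r ^+ 2 *: b + (sg s * r) *: c l) by ring.
rewrite (le_trans (ler_normD _ _)) // normrM (ger0_norm rr0) normrM (@ger0_norm _ 2) //.
rewrite (ger0_norm (sqn_ge0 _)).
have h1 : r ^+ 2 * (2 * `|dotm D b|) <= r ^+ 2 * ((1 + ka) * p0).
  by rewrite ler_wpM2l //; have := normr_dotm2 D b; lra.
have h2 := sqnD_le (r ^+ 2 *: b) ((sg s * r) *: c l).
have e2 : (sg s * r) ^+ 2 = r ^+ 2 by rewrite exprMn [sg s ^+ 2]expr2 sg_sq mul1r.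
rewrite !sqnZ e2 in h2.
have h3 : (r ^+ 2) ^+ 2 * sqn b <= r ^+ 2 * (ka * p0).
  rewrite ler_pM ?exprn_ge0 ?sqn_ge0 //.
  by rewrite expr2 ler_piMr.
have h4 : r ^+ 2 * sqn (c l) <= r ^+ 2 * (ka * p0) by rewrite ler_wpM2l.
lra.
Qed.

End noise.
Arguments sg {R}.

(** * One step: the convexity gap, comparison of two families, monotone Lipschitz functions *)

Section one_step.
Variables (R : realType) (d : nat).
Hypothesis d_gt0 : (0 < d)%N.
Implicit Types (e W : 'I_d -> bool -> R) (r C : R).

(** For each column, the two values with opposite signs deviate from any constant, in mean square,
    by at least half their difference; that half-difference is [Zg] up to the factor
    [sqrt d * r]. *)
Lemma Ex_variance r e : 0 < r ->
  r ^+ 2 * enorm (Zg r e) ^+ 2 <= Ex (fun k s => (e k s - Ex e) ^+ 2).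
Proof.
move=> r0; rewrite enorm_sq /sqn /dotm /Ex mulr_sumr mulr_sumr; apply: ler_sum => k _.
rewrite big_ord1 mxE -/(Ex e) -[d%:R^-1](congr1 GRing.inv (@sqrtd_sq R d)).
have := @sqrtd_gt0 R d d_gt0; move: (Num.sqrt _) => q q0.
have -> : r ^+ 2 * ((e k true - e k false) / (2 * (q * r)) * ((e k true - e k false) / (2 * (q * r))))
  = (q * q)^-1 * ((e k true - e k false) ^+ 2 / 4).
  by field; rewrite !gt_eqF.
rewrite ler_wpM2l ?invr_ge0 ?mulr_ge0 ?(ltW q0) //.
have := sqr_ge0 (e k true - Ex e + (e k false - Ex e)); lra.
Qed.

(** The even part of the weight is constant and is killed by centring. What remains is the odd part,
    whose pairing with [e] reproduces the entries of [Zg]. *)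
Lemma Ex_weight_centered r (C0 C1 : R) W e : 0 < r -> 0 <= C1 ->
  admissible r C0 C1 W ->
  `|Ex (fun k s => W k s * (e k s - Ex e))| <= r ^+ 2 * (C1 * d%:R * enorm (Zg r e)).
Proof.
move=> r0 C10 [c [tau [hc htau ->]]].
rewrite Ex_weight_mul ExB Ex_cst // subrr mulr0 add0r normrM gtr0_norm // expr2 -mulrA.
rewrite ler_pM2l //.
have -> : Ex (fun k s => sg s * tau k * (e k s - Ex e)) =
   \sum_k (r / Num.sqrt d%:R) * (tau k * Zg r e k 0).
  rewrite /Ex mulr_sumr; apply: eq_bigr => k _; rewrite mxE -/(Ex e) /sg.
  rewrite -[d%:R^-1](congr1 GRing.inv (@sqrtd_sq R d)).
  have := @sqrtd_gt0 R d d_gt0; move: (Num.sqrt _) => q q0.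
  by field; rewrite !gt_eqF.
have q0 := @sqrtd_gt0 R d d_gt0.
have -> : r * (C1 * d%:R * enorm (Zg r e)) = \sum_(k < d) r * (C1 * enorm (Zg r e)).
  by rewrite sumr_const card_ord -[RHS]mulr_natl; ring.
rewrite (le_trans (ler_norm_sum _ _ _)) //; apply: ler_sum => k _.
rewrite normrM normrM normfV (gtr0_norm q0) (gtr0_norm r0) -mulrA ler_pM2l // mulrC ler_pdivrMr //.
by rewrite normrM mulrAC ler_pM // normr_entry.
Qed.

(** The last summand is what completing the square leaves of the terms linear in the slope; the
    others bound the terms free of the slope. *)
Definition qconst (C0 C1 C f0 B : R) : R :=
  B * f0 + f0 ^+ 2 + C0 * B ^+ 2 + 2 * (B * (C + C1 * d%:R)) ^+ 2.

(* The square turns the unbounded slope [Zg r e] into a favourable term: by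
   [Ex_variance] the convexity gap dominates every contribution that is linear
   in the slope. *)
Lemma square_step r (C0 C1 C f0 B B2 phi : R) W e :
  0 < r <= 1 -> 0 <= C0 -> 0 <= C1 -> 0 <= C -> 0 <= f0 ->
  r ^+ 2 * C0 + r * (C1 * Num.sqrt d%:R) <= 1 / 2 -> r ^+ 2 * C ^+ 2 <= 1 / 16 ->
  admissible r C0 C1 W ->
  `|phi| <= f0 + C * enorm (Zg r e) -> `|Ex e + B| <= B2 ->
  (Ex e + r ^+ 2 * phi + B) ^+ 2 / 2 - Ex (fun k s => W k s * ((e k s + B) ^+ 2 / 2))
   <= r ^+ 2 * qconst C0 C1 C f0 B2.
Proof.
move=> /andP[r0 r1] C00 C10 C_0 f00 hr hrC hW hphi hB.
have hcent := Ex_weight_centered e r0 C10 hW.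
have hvar := Ex_variance e r0.
have W12 := admissible_ge (ltW r0) hr hW.
set z := enorm _ in hphi hcent hvar; set A := Ex e + B in hB.
have z0 : 0 <= z by exact: enorm_ge0.
set X := Ex (fun k s => W k s * (e k s - Ex e)) in hcent.
have [c [tau [hc htau eW]]] := hW.
(* Expansion about the unweighted mean: a mass term, the cross term [X] and the weighted variance,
   which is the favourable one. *)
have dec : Ex (fun k s => W k s * ((e k s + B) ^+ 2 / 2)) =
   A ^+ 2 / 2 * (1 + r ^+ 2 * c) + A * X + Ex (fun k s => W k s * (e k s - Ex e) ^+ 2) / 2.
  have <- : Ex W = 1 + r ^+ 2 * c by rewrite eW Ex_weight.
  rewrite -[X in _ + X]mulrC -!ExZ -!ExD; congr Ex.
  by apply/funext => k; apply/funext => s; rewrite /A; field.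
have hW2 : r ^+ 2 * z ^+ 2 / 2 <= Ex (fun k s => W k s * (e k s - Ex e) ^+ 2).
  apply: (@le_trans _ _ (2^-1 * Ex (fun k s => (e k s - Ex e) ^+ 2))); first by lra.
  rewrite -ExZ; apply: Ex_le => k s; rewrite ler_wpM2r ?sqr_ge0 //.
  by have := W12 k s; lra.
have B20 : 0 <= B2 by rewrite (le_trans (normr_ge0 A)).
have rr0 := sqr_ge0 r; have rr1 : r ^+ 2 <= 1 by rewrite expr_le1 // ltW.
have hAX : - (A * X) <= r ^+ 2 * (B2 * (C1 * d%:R * z)).
  rewrite (le_trans (ler_norm _)) // normrN normrM mulrCA ler_pM //.
have hAphi : A * phi <= B2 * (f0 + C * z).
  by rewrite (le_trans (ler_norm _)) // normrM ler_pM.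
have hA2 : A ^+ 2 <= B2 ^+ 2 by rewrite -(@real_normK _ A) ?num_real // lerXn2r ?nnegrE.
have hphi2 : phi ^+ 2 <= 2 * f0 ^+ 2 + 2 * (C ^+ 2 * z ^+ 2).
  have : phi ^+ 2 <= (f0 + C * z) ^+ 2.
    by rewrite -(@real_normK _ phi) ?num_real // lerXn2r ?nnegrE // addr_ge0 ?mulr_ge0.
  by have := sqr_ge0 (f0 - C * z); lra.
have hcA : - (c * A ^+ 2) <= C0 * B2 ^+ 2.
  rewrite (le_trans (ler_norm _)) // normrN normrM ler_pM //.
  by rewrite ger0_norm ?sqr_ge0.
rewrite dec.
have -> : (Ex e + r ^+ 2 * phi + B) ^+ 2 = A ^+ 2 + 2 * r ^+ 2 * (A * phi) + r ^+ 2 * (r ^+ 2 * phi ^+ 2).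
  by rewrite /A; ring.
have h1 : r ^+ 2 * (A * phi) <= r ^+ 2 * (B2 * (f0 + C * z)) by rewrite ler_wpM2l.
have h2 : r ^+ 2 * (- (c * A ^+ 2)) <= r ^+ 2 * (C0 * B2 ^+ 2) by rewrite ler_wpM2l.
have h3 : r ^+ 2 * (r ^+ 2 * phi ^+ 2) <= r ^+ 2 * (2 * f0 ^+ 2 + z ^+ 2 / 8).
  rewrite ler_wpM2l // (le_trans (ler_wpM2l rr0 hphi2)) //.
  have : r ^+ 2 * f0 ^+ 2 <= 1 * f0 ^+ 2 by rewrite ler_wpM2r ?sqr_ge0.
  have : r ^+ 2 * C ^+ 2 * z ^+ 2 <= 1 / 16 * z ^+ 2 by rewrite ler_wpM2r ?sqr_ge0.
  lra.
(* Coefficient of the slope in all the linear terms together. Of the gain from the variance, [3 / 8]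
   is left (for twice the inequality) after [phi ^+ 2] has taken its share, and Young's inequality
   spends it. *)
pose E := B2 * (C + C1 * d%:R).
have h4 : r ^+ 2 * (2 * E * z - 3 / 8 * z ^+ 2) <= r ^+ 2 * (4 * E ^+ 2).
  by rewrite ler_wpM2l //; have := sqr_ge0 (z / 2 - 2 * E); have := sqr_ge0 z; lra.
have h5 : 0 <= r ^+ 2 * (C0 * B2 ^+ 2) by rewrite mulr_ge0 // mulr_ge0 // sqr_ge0.
rewrite /qconst.
move: h4; rewrite /E; lra.
Qed.

(** Tilting the weights absorbs the dependence of [f] on its own value and on the slope. The other
    components enter only through positive parts, which [psi] bounds. The expectation of [q'] is
    kept with its sign, so that it can later be compared with the current value of the
    perturbation. *)
Lemma one_step (m : nat) r C mu (u' a' q' : 'I_m -> 'I_d -> bool -> R)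
    (psi : 'I_d -> bool -> R) i u a phu pha rho :
  0 < r -> 0 <= C -> 0 <= mu ->
  r ^+ 2 * C + r * (C * Num.sqrt d%:R) <= 1 / 2 ->
  (forall l k s, 0 <= q' l k s) -> (forall k s, 0 <= psi k s) ->
  (forall l k s, u' l k s + mu * q' l k s - a' l k s <= psi k s) ->
  u <= Ex (u' i) + r ^+ 2 * phu -> Ex (a' i) + r ^+ 2 * pha <= a ->
  phu - pha <= rho + C * \sum_l Num.max 0 (Ex (u' l) - Ex (a' l))
     + C * `|Ex (u' i) - Ex (a' i)| + C * enorm (Zg r (u' i) - Zg r (a' i)) ->
  exists2 W, admissible r C C W &
    u - a <= Ex (fun k s => W k s * psi k s) - mu * Ex (fun k s => W k s * q' i k s)
             + r ^+ 2 * rho + r ^+ 2 * (C * m%:R * Ex psi).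
Proof.
move=> r0 C0 mu0 hr q0 psi0 hpsi hu ha hphi.
have [W hW tW] := tilt d_gt0 (fun k s => u' i k s - a' i k s) r0 C0 C0.
exists W => //; have W12 := admissible_ge (ltW r0) hr hW.
rewrite ExB ZgB in tW.
have rr0 := sqr_ge0 r.
have Epsi0 : 0 <= Ex psi.
  by rewrite -[X in X <= _](Ex_cst d_gt0); exact: Ex_le.
have h1 : Ex (fun k s => W k s * (u' i k s - a' i k s)) <=
   Ex (fun k s => W k s * psi k s) - mu * Ex (fun k s => W k s * q' i k s).
  rewrite -ExZ -ExB; apply: Ex_le => k s.
  have -> : W k s * psi k s - mu * (W k s * q' i k s) = W k s * (psi k s - mu * q' i k s) by ring.
  by rewrite ler_wpM2l //; [have := W12 k s; lra | have := hpsi i k s; lra].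
have h2 : \sum_l Num.max 0 (Ex (u' l) - Ex (a' l)) <= m%:R * Ex psi.
  have -> : m%:R * Ex psi = \sum_(l < m) Ex psi by rewrite sumr_const card_ord mulr_natl.
  apply: ler_sum => l _; rewrite ge_max Epsi0 -ExB; apply: Ex_le => k s.
  have := hpsi l k s; have : 0 <= mu * q' l k s by rewrite mulr_ge0.
  by lra.
have h3 : r ^+ 2 * (phu - pha) <= r ^+ 2 * (rho + C * (m%:R * Ex psi)
     + C * `|Ex (u' i) - Ex (a' i)| + C * enorm (Zg r (u' i) - Zg r (a' i))).
  rewrite ler_wpM2l // (le_trans hphi) //.
  by have := ler_wpM2l C0 h2; lra.
lra.
Qed.

(** The coordinates other than [i] are raised one at a time to the maximum of the two arguments,
    which only increases [F]. The Lipschitz bound applied afterwards sees positive parts in those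
    coordinates and an absolute value in coordinate [i] alone. *)
Lemma lipschitz_monotone (m : nat) C (F : 'cV[R]_m -> 'cV[R]_d -> R) (i : 'I_m) :
  (forall y y' z z', `|F y z - F y' z'| <=
      C * (\sum_(l < m) `|y l 0 - y' l 0| + enorm (z - z'))) ->
  (forall l, l != i -> forall (y y' : 'cV[R]_m) z,
     (forall j, j != l -> y j 0 = y' j 0) -> y l 0 <= y' l 0 -> F y z <= F y' z) ->
  0 <= C -> forall y y' z z',
  F y z - F y' z' <= C * \sum_l Num.max 0 (y l 0 - y' l 0)
     + C * `|y i 0 - y' i 0| + C * enorm (z - z').
Proof.
move=> hlip hmono C0 y y' z z'.
pose y2 n : 'cV[R]_m :=
  \col_l if (l < n)%N && (l != i) then Num.max (y l 0) (y' l 0) else y l 0.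
have step n : F y z <= F (y2 n) z.
  elim: n => [|n IH].
    by rewrite (_ : y2 0%N = y) //; apply/matrixP => a b; rewrite !mxE (ord1 b).
  apply: le_trans IH _.
  have [nm|nm] := ltnP n m; last first.
    rewrite (_ : y2 n = y2 n.+1) //; apply/matrixP => a b; rewrite !mxE.
    by rewrite (leq_trans (ltn_ord a) nm) ltnS ltnW // (leq_trans (ltn_ord a) nm).
  have [e|ne] := eqVneq (Ordinal nm) i.
    rewrite (_ : y2 n = y2 n.+1) //; apply/matrixP => a b; rewrite !mxE.
    have [->|ai] := eqVneq a i; rewrite /= ?andbF // !andbT ltnS [in RHS]leq_eqVlt.
    suff -> : (a == n :> nat) = false by [].
    by apply/negP => /eqP an; case/negP: ai; rewrite -e; apply/eqP/val_inj.
  apply: (hmono _ ne) => [j jl|]; rewrite !mxE.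
    rewrite ltnS [in RHS]leq_eqVlt.
    suff -> : (j == n :> nat) = false by [].
    by apply/negP => /eqP jn; case/negP: jl; apply/eqP/val_inj.
  by rewrite /= ltnn ltnSn ne /= le_max lexx.
have h := hlip (y2 m) y' z z'; have h2 := ler_norm (F (y2 m) z - F y' z').
have h3 := step m.
have h4 : \sum_(l < m) `|y2 m l 0 - y' l 0| <=
   \sum_l Num.max 0 (y l 0 - y' l 0) + `|y i 0 - y' i 0|.
  rewrite (bigD1 i) //= [in leRHS](bigD1 i) //= mxE ltn_ord eqxx /=.
  rewrite [leLHS]addrC lerD2r //; apply: (@le_trans _ _ (\sum_(l | l != i) Num.max 0 (y l 0 - y' l 0))).
    apply: ler_sum => l li; rewrite mxE ltn_ord li /=.
    case: (leP (y l 0) (y' l 0)) => hl.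
      by rewrite subrr normr0 le_max lexx.
    by rewrite ger0_norm ?subr_ge0 ?(ltW hl) // le_max lexx orbT.
  by rewrite lerDr le_max lexx.
have := ler_wpM2l C0 h4; lra.
Qed.

End one_step.

(** The pointwise infimum of the closed families above [w] is itself closed, and constants above [w]
    are closed because costs are non-negative. If at some [i] neither alternative held, lowering
    that single entry would give a smaller closed family. *)
Lemma switch_closure (R : realType) (m : nat) (w : 'I_m -> R) (c : 'I_m -> 'I_m -> R) :
  (forall i j, i != j -> 0 <= c i j) ->
  exists v : 'I_m -> R, [/\ forall i, w i <= v i,
    forall i j, i != j -> v j - c i j <= v i,
    forall i, v i = w i \/ exists2 j, i != j & v i <= v j - c i j &
    forall M, (forall i, w i <= M) -> forall i, v i <= M].
Proof.
move=> c0.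
pose S := [set z : 'I_m -> R | (forall i, w i <= z i) /\
   (forall i j, i != j -> z j - c i j <= z i)].
have SM M : (forall i, w i <= M) -> S (fun=> M).
  by move=> wM; split => // i j /c0; rewrite gerBl.
pose M0 := \sum_i `|w i|.
have wM0 i : w i <= M0.
  by rewrite (le_trans (ler_norm _)) // /M0 (bigD1 i) //= lerDl sumr_ge0.
pose V i := [set z i | z in S].
pose v i := inf (V i).
have Vlb i : lbound (V i) (w i) by move=> _ [z [hz _] <-].
have hV i : has_inf (V i).
  split; last by exists (w i).
  by exists M0, (fun=> M0) => //; exact: SM.
have vle z i : S z -> v i <= z i.
  by move=> Sz; apply: ge_inf; [exists (w i) | exists z].
have Sv : S v.
  split=> [i|i j ij].
    by apply: lb_le_inf; [case: (hV i) | exact: Vlb].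
  apply: lb_le_inf; first by case: (hV i).
  move=> _ [z Sz <-]; apply: le_trans (_ : z j - c i j <= _); last by case: Sz => _; exact.
  by rewrite lerD2r vle.
exists v; split; [by case: Sv | by case: Sv | | by move=> M /SM Sz i; exact: vle].
move=> i; apply: contrapT => /not_orP[h1 h2].
have wv : w i < v i by rewrite lt_neqAle; case: Sv => -> _; rewrite andbT; apply/eqP => e; apply: h1.
(* The lowest value at [i] that respects both [w] and every switch out of [i]. *)
pose t := \big[Num.max/w i]_(j | i != j) (v j - c i j).
have tv : t < v i.
  apply: bigmax_lt => // j ij; rewrite ltNge; apply/negP => h; apply: h2.
  by exists j.
suff Sz : S (fun l => if l == i then t else v l).
  by have := vle _ i Sz; rewrite eqxx leNgt tv.
case: Sv => S1 S2; split=> [l|l j lj].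
  case: eqP => [->|_]; last exact: S1.
  exact: bigmax_ge_id.
case: (eqVneq l i) => [li|li]; case: (eqVneq j i) => [ji|ji].
- by move: lj; rewrite li ji eqxx.
- rewrite li in lj *; exact: (@le_bigmax_cond _ _ _ (w i) j (fun j => i != j) (fun j => v j - c i j)).
- apply: le_trans (S2 _ _ lj); rewrite lerD2r ji; exact: ltW.
- exact: S2.
Qed.

(** * Shortest paths *)

Section bellman_ford.
Variables (R : realType) (m : nat).
Implicit Types (c : 'I_m -> 'I_m -> R).

(** Least cost of a walk with at most [n] edges that ends at [j] and starts anywhere for free, as if
    a source were joined to every vertex at cost zero. *)
Fixpoint bellman_ford c n (j : 'I_m) : R :=
  if n is n'.+1 then
    \big[Num.min/bellman_ford c n' j]_(i | i != j) (bellman_ford c n' i + c i j)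
  else 0.

Lemma bellman_ford_decr c n j : bellman_ford c n.+1 j <= bellman_ford c n j.
Proof. exact: bigmin_le_id. Qed.

Lemma bellman_ford_edge c n i j : i != j ->
  bellman_ford c n.+1 j <= bellman_ford c n i + c i j.
Proof.
move=> ij; exact: (@bigmin_le_cond _ _ _ _ i (fun i => i != j)
  (fun i => bellman_ford c n i + c i j)).
Qed.

Lemma bellman_ford_case c n j : bellman_ford c n.+1 j = bellman_ford c n j \/
  exists2 i, i != j & bellman_ford c n.+1 j = bellman_ford c n i + c i j.
Proof.
rewrite /=; elim/big_rec: _ => [|i x ij [->|[l lj ->]]]; first by left.
- rewrite minEle; case: ifP => _; [by right; exists i | by left].
- rewrite minEle; case: ifP => _; right; [by exists i | by exists l].
Qed.

Lemma bellman_ford_mono c n p j : (n <= p)%N -> bellman_ford c p j <= bellman_ford c n j.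
Proof.
elim: p => [|p IH]; first by rewrite leqn0 => /eqP ->.
rewrite leq_eqVlt ltnS => /orP[/eqP -> // | /IH].
exact/le_trans/bellman_ford_decr.
Qed.

Lemma bellman_ford_le0 c n j : bellman_ford c n j <= 0.
Proof. exact: (@bellman_ford_mono c 0). Qed.

Lemma bellman_ford_ge c (a : R) n j : 0 <= a -> (forall i j, i != j -> - a <= c i j) ->
  - (n%:R * a) <= bellman_ford c n j.
Proof.
move=> a0 hc; elim: n j => [|n IH] j; first by rewrite mul0r oppr0.
case: (bellman_ford_case c n j) => [->|[i ij ->]].
  by apply: le_trans (IH j); rewrite lerN2 ler_wpM2r // ler_nat.
by have := IH i; have := hc _ _ ij; rewrite -natr1; lra.
Qed.

(** Consecutive indices are required to differ so that a loop only reads costs off the diagonal, the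
    only ones about which anything is assumed. *)
Definition simple_loop (N : nat) (s : nat -> 'I_m) :=
  [/\ (3 <= N)%N, s 1%N = s N, #|[set s n.+1 | n : 'I_N]%SET| = N.-1 &
      forall n, (1 <= n < N)%N -> s n != s n.+1].

Definition loop_cost c N (s : nat -> 'I_m) := \sum_(1 <= n < N) c (s n) (s n.+1).

(** An improvement in round [n + 1] can be traced back: had the predecessor not improved one round
    earlier, the same edge would already have produced the new value. *)
Lemma bellman_ford_chain c n j : bellman_ford c n.+1 j < bellman_ford c n j ->
  exists s : nat -> 'I_m, s n = j /\ forall a, (a < n)%N ->
    s a != s a.+1 /\
    bellman_ford c a.+2 (s a.+1) = bellman_ford c a.+1 (s a) + c (s a) (s a.+1).
Proof.
elim: n j => [|n IH] j; first by exists (fun=> j).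
case: (bellman_ford_case c n.+1 j) => [->|[i ij e] lt]; first by rewrite ltxx.
have {}/IH[s [si hs]] : bellman_ford c n.+1 i < bellman_ford c n i.
  rewrite ltNge; apply/negP => h.
  have : bellman_ford c n.+1 j <= bellman_ford c n i + c i j by exact: bellman_ford_edge.
  by move: lt; rewrite e; lra.
exists (fun a => if (a <= n)%N then s a else j); split; first by rewrite ltnn.
move=> a; rewrite ltnS => an; rewrite an; move: an.
rewrite leq_eqVlt => /orP[/eqP -> | an]; first by rewrite ltnn si.
by rewrite an; exact: hs.
Qed.

(** An improvement in round [m + 1] yields a chain of [m + 1] vertices, hence a repetition. Along
    the chain the costs telescope, and since the values strictly decrease at the end of the
    repetition, the loop would have negative cost. *)
Lemma bellman_ford_stable c :
  (forall N s, simple_loop N s -> 0 <= loop_cost c N s) ->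
  forall i j, i != j -> bellman_ford c m j <= bellman_ford c m i + c i j.
Proof.
move=> hc i j ij; apply: le_trans (bellman_ford_edge c m ij).
rewrite leNgt; apply/negP => /[dup] lt /bellman_ford_chain[s [sm hs]].
have dec a : (a <= m)%N -> bellman_ford c a.+1 (s a) < bellman_ford c a (s a).
  move=> am; move: lt; rewrite -sm -{1 2 3 4}(subnK am).
  have : (m - a + a <= m)%N by rewrite subnK.
  elim: (m - a)%N => [|e IH] em lt' //.
  rewrite addSn in em lt'; apply: IH; first exact: ltnW.
  have [ne eq] := hs _ em.
  rewrite eq in lt'; rewrite ltNge; apply/negP => h.
  by have := bellman_ford_edge c (e + a) ne; lra.
(* A repetition of least length [l] has no repetition inside, so it is a simple loop. *)
pose P l := [exists a : 'I_m.+1, (a + l <= m)%N && (0 < l)%N && (s a == s (a + l)%N)].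
have exP : exists l, P l.
  have /injectivePn[x [y xy sxy]] : ~~ injectiveb (fun a : 'I_m.+1 => s a).
    apply/negP => /injectiveP /leq_card; rewrite !card_ord ltnn //.
  wlog lt' : x y xy sxy / (x < y)%N.
    move=> h; case: (ltngtP x y) => [/h|/h|/val_inj e]; [exact | | ].
      by apply => //; rewrite eq_sym.
    by rewrite e eqxx in xy.
  exists (y - x)%N; apply/existsP; exists x.
  rewrite subnKC ?(ltnW lt') // subn_gt0 lt' sxy eqxx !andbT.
  by rewrite -ltnS ltn_ord.
case: (ex_minnP exP) => l /existsP[a /andP[/andP[alm l0] /eqP sal]] lmin.
have inj (x y : nat) : (x < y < l)%N -> s (a + x)%N <> s (a + y)%N.
  move=> /andP[xy yl] e.
  suff /lmin : P (y - x)%N by rewrite leqNgt (leq_ltn_trans (leq_subr _ _) yl).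
  have axm : (a + x < m.+1)%N.
    by rewrite ltnS (leq_trans _ alm) // leq_add2l ltnW // (ltn_trans xy).
  apply/existsP; exists (Ordinal axm) => /=.
  rewrite -addnA subnKC ?(ltnW xy) // e eqxx andbT subn_gt0 xy andbT.
  by rewrite (leq_trans _ alm) // leq_add2l ltnW.
have l2 : (2 <= l)%N.
  move: l0; rewrite leq_eqVlt => /orP[/eqP l1 | //].
  by have [] := hs a (leq_trans (_ : (a < a + l)%N) alm); rewrite -?l1 ?addn1 // sal -l1 addn1 eqxx.
(* Loops are numbered from [1]; with [l] edges they list [l + 1] vertices, and [l >= 2] gives the
   required length [3]. *)
pose s' n := s (a + n.-1)%N.
have sl : simple_loop l.+1 s'.
  split => //; first by rewrite /s' /= addn0.
  2: case=> [//|n] nl; rewrite /s' /= addnS.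
  2: by have [] := hs (a + n)%N; rewrite // (leq_trans _ alm) // ltn_add2l.
  have -> : [set s' n.+1 | n : 'I_l.+1]%SET = [set s' n.+1 | n : 'I_l]%SET.
    apply/setP => z; apply/imsetP/imsetP => -[n _ ->].
      have := ltn_ord n; rewrite ltnS leq_eqVlt => /orP[/eqP e|nl].
        exists (Ordinal l0) => //; rewrite /s' /= e addn0; exact/esym.
      by exists (Ordinal nl).
    by exists (widen_ord (leqnSn l) n).
  rewrite card_imset ?card_ord // => x y; rewrite /s' /= => e; apply: val_inj => /=.
  case: (ltngtP x y) => // h; exfalso.
    by apply: (inj x y) => //; rewrite h ltn_ord.
  by apply: (inj y x) => //; rewrite h ltn_ord.
have := hc _ _ sl; rewrite leNgt => /negP; apply.
rewrite /loop_cost big_add1 /=.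
have -> : \sum_(0 <= n < l) c (s' n.+1) (s' n.+2) =
   bellman_ford c (a + l).+1 (s (a + l)%N) - bellman_ford c a.+1 (s a).
  have : forall l', (l' <= l)%N -> \sum_(0 <= n < l') c (s' n.+1) (s' n.+2) =
   bellman_ford c (a + l').+1 (s (a + l')%N) - bellman_ford c a.+1 (s a).
    elim=> [|n IH] nl; first by rewrite big_geq // addn0 subrr.
    rewrite big_nat_recr //= IH; last exact: ltnW.
    have [|_] := hs (a + n)%N; first by rewrite (leq_trans _ alm) // ltn_add2l.
    by rewrite /s' /= addnS => ->; lra.
  exact.
have h1 := dec _ alm; have h2 : bellman_ford c (a + l) (s (a + l)%N) <= bellman_ford c a.+1 (s (a + l)%N).
  by apply: bellman_ford_mono; rewrite -addn1 leq_add2l.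
by rewrite -sal in h1 h2 *; lra.
Qed.
End bellman_ford.

(** * Uniform continuity on cylinders *)

Section compactness.
Variables (R : realType) (k : nat) (T : R).
Hypothesis T_gt0 : 0 < T.
Implicit Types (tx ty : R * 'cV[R]_k) (M e : R).

(** The parameter makes one compactness argument serve [f], uniformly in its last arguments, and the
    other data, for which [Y] is [unit]. *)
Definition ucont_on (Y : Type) (phi : R * 'cV[R]_k -> Y -> R) :=
  forall tx, strip T tx -> forall e, 0 < e -> exists2 r : R, 0 < r &
    forall ty, strip T ty -> `|ty.1 - tx.1| < r -> enorm (ty.2 - tx.2) < r ->
    forall y, `|phi ty y - phi tx y| < e.

Lemma continuous_unif_onW Y (phi : R * 'cV[R]_k -> Y -> R) :
  continuous_unif_on T phi -> ucont_on phi.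
Proof.
move=> h tx stx e e0; have /nbhs_enorm[r r0 hr] := h tx stx e e0.
by exists r => // ty sty h1 h2; exact: hr.
Qed.

Lemma within_continuous_ucont (phi : R * 'cV[R]_k -> R) :
  {within strip T, continuous phi} -> ucont_on (fun tx (_ : unit) => phi tx).
Proof.
move=> h tx stx e e0.
have /cvgrPdist_lt /(_ _ e0) := (subspace_continuousP _ _).1 h tx stx.
by move=> /nbhs_enorm[r r0 hr]; exists r => // ty sty h1 h2 _; rewrite distrC; exact: hr.
Qed.

Lemma ucont_within_continuous (phi : R * 'cV[R]_k -> R) :
  ucont_on (fun tx (_ : unit) => phi tx) -> {within strip T, continuous phi}.
Proof.
move=> h; apply/subspace_continuousP => tx stx; apply/cvgrPdist_lt => e e0.
have [r r0 hr] := h tx stx e e0; apply/nbhs_enorm; exists r => // ty h1 h2 sty.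
by rewrite distrC; exact: hr.
Qed.

Definition cyl M : set (R * 'cV[R]_k) := [set tx | strip T tx /\ enorm tx.2 <= M].

Lemma cyl_ultra (U : set_system nat) (p : nat -> R * 'cV[R]_k) M :
  UltraFilter U -> (forall n, cyl M (p n)) -> exists p0, [/\ cyl M p0,
    ulim_to U (fun n => (p n).1) p0.1 & ulimv_to U (fun n => (p n).2) p0.2].
Proof.
move=> UU hp.
have [n|t ht _] := @ulim_exists R U UU (fun n => (p n).1) T.
  by have [/andP[h1 h2] _] := hp n; rewrite ger0_norm.
have [n|x hx] := @ulimv_exists R U UU k (fun n => (p n).2) M; first by case: (hp n).
exists (t, x); split => //; split.
  apply/andP; split => /=.
    apply: (ulim_le UU (@ulim_cst _ _ UU 0) ht).
    by apply: filterE => n /=; have [/andP[]] := hp n.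
  apply: (ulim_le UU ht (@ulim_cst _ _ UU T)).
  by apply: filterE => n /=; have [/andP[]] := hp n.
by apply: (ulimv_enorm_le UU hx); apply: filterE => n; have [] := hp n.
Qed.

(** Pairs violating the claim at scale [1 / (n + 1)] share an ultralimit in the cylinder, and
    continuity at that point fails. *)
Lemma heine_cantor Y (phi : R * 'cV[R]_k -> Y -> R) M e : ucont_on phi -> 0 < e ->
  exists2 r : R, 0 < r & forall tx ty, cyl M tx -> cyl M ty ->
    `|tx.1 - ty.1| < r -> enorm (tx.2 - ty.2) < r ->
    forall y, `|phi tx y - phi ty y| < e.
Proof.
move=> hphi e0; apply: contrapT => no.
have [U UU Uoo] := ultra_oo.
have /choice[z hz] : forall n : nat, exists z : (R * 'cV[R]_k) * (R * 'cV[R]_k) * Y,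
    [/\ cyl M z.1.1, cyl M z.1.2, `|z.1.1.1 - z.1.2.1| < n.+1%:R^-1,
        enorm (z.1.1.2 - z.1.2.2) < n.+1%:R^-1 & ~ `|phi z.1.1 z.2 - phi z.1.2 z.2| < e].
  move=> n; apply: contrapT => nz; apply: no; exists n.+1%:R^-1; first by rewrite invr_gt0.
  move=> tx ty h1 h2 h3 h4 y; apply: contrapT => h5; apply: nz; by exists (tx, ty, y).
have hQ n : cyl M (z n).1.1 by case: (hz n).
have [p0 [[sp0 _] ht hx]] := cyl_ultra UU hQ.
have e2 : 0 < e / 2 by lra.
have [r r0 hr] := hphi p0 sp0 _ e2.
have r2 : 0 < r / 2 by lra.
have [N hN] : exists N : nat, N.+1%:R^-1 < r / 2.
  have [N _ hN] := near_infty_natSinv_lt (PosNum r2); by exists N; apply: hN => /=.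
have [n [[/= h1 h2] h3]] := ultra_ex UU (filterI (filterI (ht _ r2) (hx _ r2)) (Uoo N)).
have [[s1 _] [s2 _] h4 h5] := hz n; apply.
have h6 : n.+1%:R^-1 < r / 2.
  by apply: le_lt_trans hN; rewrite lef_pV2 ?posrE // ler_nat ltnS.
have {}h4 := lt_trans h4 h6; have {}h5 := lt_trans h5 h6.
have c1 : `|phi (z n).1.1 (z n).2 - phi p0 (z n).2| < e / 2 by apply: hr => //; lra.
have c2 : `|phi (z n).1.2 (z n).2 - phi p0 (z n).2| < e / 2.
  apply: hr => //.
    rewrite (_ : _ - _ = - ((z n).1.1.1 - (z n).1.2.1) + ((z n).1.1.1 - p0.1)); last by ring.
    by rewrite (le_lt_trans (ler_normD _ _)) // normrN; lra.
  rewrite (_ : _ - _ = - ((z n).1.1.2 - (z n).1.2.2) + ((z n).1.1.2 - p0.2)); last first.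
    by rewrite opprB addrA subrK.
  by rewrite (le_lt_trans (enormD _ _)) // enormN; lra.
rewrite (_ : _ - _ = (phi (z n).1.1 (z n).2 - phi p0 (z n).2) - (phi (z n).1.2 (z n).2 - phi p0 (z n).2)); last by ring.
by rewrite (le_lt_trans (ler_normB _ _)) //; lra.
Qed.

Lemma bounded_on_cyl (phi : R * 'cV[R]_k -> R) M :
  ucont_on (fun tx (_ : unit) => phi tx) ->
  exists2 B : R, 0 <= B & forall tx, cyl M tx -> `|phi tx| <= B.
Proof.
move=> hphi; apply: contrapT => no; have [U UU Uoo] := ultra_oo.
have /choice[z hz] : forall n : nat, exists z, cyl M z /\ n%:R < `|phi z|.
  move=> n; apply: contrapT => nz; apply: no; exists n%:R => // tx h.
  by rewrite leNgt; apply/negP => h'; apply: nz; exists tx.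
have [p0 [[sp0 _] ht hx]] := cyl_ultra UU (fun n => (hz n).1).
have [r r0 hr] := hphi p0 sp0 1 ltr01.
pose N := (Num.truncn (`|phi p0| + 1)).+1.
have hN : `|phi p0| + 1 < N%:R by exact: truncnS_gt.
have [n [[/= h1 h2] h3]] := ultra_ex UU (filterI (filterI (ht _ r0) (hx _ r0)) (Uoo N)).
have [[s1 _] h4] := hz n; have := hr _ s1 h1 h2 tt.
have : N%:R <= n%:R :> R by rewrite ler_nat.
have := ler_normD (phi (z n) - phi p0) (phi p0); rewrite subrK; lra.
Qed.

Lemma positive_on_cyl (phi : R * 'cV[R]_k -> R) M :
  ucont_on (fun tx (_ : unit) => phi tx) -> (forall tx, strip T tx -> 0 < phi tx) ->
  exists2 e : R, 0 < e & forall tx, cyl M tx -> e <= phi tx.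
Proof.
move=> hphi pos; apply: contrapT => no; have [U UU Uoo] := ultra_oo.
have /choice[z hz] : forall n : nat, exists z, cyl M z /\ phi z < n.+1%:R^-1.
  move=> n; apply: contrapT => nz; apply: no; exists n.+1%:R^-1; first by rewrite invr_gt0.
  by move=> tx h; rewrite leNgt; apply/negP => h'; apply: nz; exists tx.
have [p0 [[sp0 _] ht hx]] := cyl_ultra UU (fun n => (hz n).1).
have e2 : 0 < phi p0 / 2 by have := pos _ sp0; lra.
have [r r0 hr] := hphi p0 sp0 _ e2.
have [N hN] : exists N : nat, N.+1%:R^-1 < phi p0 / 2.
  have [N _ hN] := near_infty_natSinv_lt (PosNum e2); by exists N; apply: hN => /=.
have [n [[/= h1 h2] h3]] := ultra_ex UU (filterI (filterI (ht _ r0) (hx _ r0)) (Uoo N)).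
have [[s1 _] h4] := hz n; have := hr _ s1 h1 h2 tt; rewrite ltr_norml => /andP[h5 _].
have h6 : n.+1%:R^-1 <= N.+1%:R^-1 :> R by rewrite lef_pV2 ?posrE // ler_nat ltnS.
have := lt_trans (lt_le_trans h4 h6) hN; lra.
Qed.

Lemma ucont_sum (I : Type) (s : seq I) (phi : I -> R * 'cV[R]_k -> R) :
  (forall i, ucont_on (fun tx (_ : unit) => phi i tx)) ->
  ucont_on (fun tx (_ : unit) => \sum_(i <- s) phi i tx).
Proof.
move=> h tx stx; elim: s => [|i s IH] e e0.
  by exists 1 => // ty _ _ _ _; rewrite !big_nil subrr normr0.
have e2 : 0 < e / 2 by lra.
have [r1 r10 h1] := IH _ e2; have [r2 r20 h2] := h i _ stx _ e2.
exists (Num.min r1 r2) => [|ty sty]; first by rewrite lt_min r10.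
rewrite !lt_min => /andP[a1 a2] /andP[b1 b2] y; rewrite !big_cons.
have := h1 _ sty a1 b1 y; have := h2 _ sty a2 b2 y.
rewrite opprD addrACA => c1 c2; rewrite (le_lt_trans (ler_normD _ _)) //; lra.
Qed.

(** Moreau regularisation restricted to the cylinder. As an infimum of paraboloids with the same
    opening it is semiconcave, although [phi] is only continuous. *)
Definition inf_convolution (phi : R * 'cV[R]_k -> R) M K tx : R :=
  inf [set phi tz + K * ((tx.1 - tz.1) ^+ 2 + sqn (tx.2 - tz.2)) | tz in cyl M].

Section inf_convolution.
Variables (phi : R * 'cV[R]_k -> R) (M K : R).
Hypotheses (M0 : 0 <= M) (K0 : 0 <= K) (phi0 : forall tx, strip T tx -> 0 <= phi tx).

Let has_inf_conv tx :
  has_inf [set phi tz + K * ((tx.1 - tz.1) ^+ 2 + sqn (tx.2 - tz.2)) | tz in cyl M].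
Proof.
split; last first.
  exists 0 => _ [tz [sz _] <-]; rewrite addr_ge0 ?phi0 // mulr_ge0 // addr_ge0 ?sqr_ge0 //.
  exact: sqn_ge0.
exists (phi (0, 0) + K * ((tx.1 - 0) ^+ 2 + sqn (tx.2 - 0))); exists (0, 0) => //.
by split; rewrite ?enorm0 // /strip /= lexx ltW.
Qed.

Lemma inf_convolution_le tx tz : cyl M tz ->
  inf_convolution phi M K tx <= phi tz + K * ((tx.1 - tz.1) ^+ 2 + sqn (tx.2 - tz.2)).
Proof. by move=> h; apply: ge_inf; [case: (has_inf_conv tx) | exists tz]. Qed.

Lemma le_inf_convolution tx y :
  (forall tz, cyl M tz -> y <= phi tz + K * ((tx.1 - tz.1) ^+ 2 + sqn (tx.2 - tz.2))) ->
  y <= inf_convolution phi M K tx.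
Proof. by move=> h; apply: lb_le_inf; [case: (has_inf_conv tx) | move=> _ [tz /h ? <-]]. Qed.

Lemma inf_convolution_ge0 tx : 0 <= inf_convolution phi M K tx.
Proof.
apply: le_inf_convolution => tz [sz _].
by rewrite addr_ge0 ?phi0 // mulr_ge0 // addr_ge0 ?sqr_ge0 ?sqn_ge0.
Qed.

Lemma inf_convolution_self tx : cyl M tx -> inf_convolution phi M K tx <= phi tx.
Proof. by move=> /(inf_convolution_le tx); rewrite !subrr sqn0 expr0n addr0 mulr0 addr0. Qed.
End inf_convolution.

(** A competitor within the modulus of continuity gains at most [e]; a farther one pays at least
    [K * r ^ 2], which [K = B / r ^ 2] makes as large as [phi] itself. *)
Lemma inf_convolution_close (phi : R * 'cV[R]_k -> R) M e : 0 <= M -> 0 < e ->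
  (forall tx, strip T tx -> 0 <= phi tx) ->
  ucont_on (fun tx (_ : unit) => phi tx) ->
  exists2 K : R, 0 <= K & forall K' tx, K <= K' -> cyl M tx ->
    phi tx - e <= inf_convolution phi M K' tx.
Proof.
move=> M0 e0 phi0 hphi; have [r r0 hr] := heine_cantor M hphi e0.
have [B B0 hB] := bounded_on_cyl M hphi.
have rr0 : 0 < r ^+ 2 by rewrite exprn_gt0.
have K0 : 0 <= B / r ^+ 2 by rewrite divr_ge0 // ltW.
exists (B / r ^+ 2) => // K tx KK Qx; apply: le_inf_convolution => //.
  exact: le_trans KK.
move=> tz Qz.
have Kd0 : 0 <= K * ((tx.1 - tz.1) ^+ 2 + sqn (tx.2 - tz.2)).
  by rewrite mulr_ge0 ?addr_ge0 ?sqr_ge0 ?sqn_ge0 // (le_trans K0).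
have [h|/negP h] := boolP ((`|tx.1 - tz.1| < r) && (enorm (tx.2 - tz.2) < r)).
  have /andP[h1 h2] := h.
  have := hr _ _ Qx Qz h1 h2 tt; rewrite ltr_norml => /andP[_]; lra.
have dr : r ^+ 2 <= (tx.1 - tz.1) ^+ 2 + sqn (tx.2 - tz.2).
  rewrite leNgt; apply/negP => h'; apply: h; apply/andP; split.
    rewrite -(@ltr_pXn2r _ 2) ?nnegrE ?(ltW r0) // real_normK ?num_real //.
    by have := sqn_ge0 (tx.2 - tz.2); lra.
  rewrite -(@ltr_pXn2r _ 2) ?nnegrE ?enorm_ge0 ?(ltW r0) // enorm_sq.
  by have := sqr_ge0 (tx.1 - tz.1); lra.
have hK : B <= K * ((tx.1 - tz.1) ^+ 2 + sqn (tx.2 - tz.2)).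
  apply: (@le_trans _ _ (B / r ^+ 2 * r ^+ 2)); first by rewrite divfK // gt_eqF.
  by rewrite ler_pM // ltW.
have := hB _ Qx; rewrite ler_norml => /andP[_].
have := phi0 _ Qz.1; lra.
Qed.

End compactness.

(** * The random step and the admissible step sizes *)

Section one_step_position.
Variables (R : realType) (k d : nat).
Variables (b : R * 'cV[R]_k -> 'cV[R]_k) (sigma : R * 'cV[R]_k -> 'M[R]_(k, d)).

(** An Euler step. Each column is drawn with probability [1 / d]; the factor [sqrt d] restores the
    covariance [r ^ 2 * sigma * sigma^T]. *)
Definition nxt r tx (l : 'I_d) (s : bool) : R * 'cV[R]_k :=
  (tx.1 + r ^+ 2,
   tx.2 + r ^+ 2 *: b tx + (sg s * r) *: (Num.sqrt d%:R *: col l (sigma tx))).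
End one_step_position.

(** The second condition keeps the weights above [1 / 2]. The third keeps the square of the
    increment due to [f] below the convexity gap. *)
Definition small (R : realType) (d : nat) (C r : R) :=
  [/\ 0 < r <= 1, r ^+ 2 * C + r * (C * Num.sqrt d%:R) <= 1 / 2 &
      r ^+ 2 * C ^+ 2 <= 1 / 16].

Lemma small_exists (R : realType) (d : nat) (C : R) : 0 <= C ->
  exists2 r0 : R, 0 < r0 & forall r, 0 < r <= r0 -> small d C r.
Proof.
move=> C0; have s0 : 0 <= Num.sqrt d%:R :> R by exact: sqrtr_ge0.
pose D := 4 + 4 * C + 4 * C * Num.sqrt d%:R.
have cs : 0 <= C * Num.sqrt d%:R by rewrite mulr_ge0.
have D0 : 0 < D by rewrite /D; lra.
exists D^-1; first by rewrite invr_gt0.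
move=> r /andP[r0 rD].
have rD1 : r * D <= 1 by rewrite -ler_pdivlMr // mul1r.
have rC : 0 <= r * C by rewrite mulr_ge0 // ltW.
have rCs : 0 <= r * (C * Num.sqrt d%:R) by rewrite mulr_ge0 // ltW.
have r1 : r <= 1 by rewrite /D in rD1; lra.
have rr : r ^+ 2 * C <= r * C by rewrite ler_wpM2r // expr2 ler_piMr // ltW.
have rC4 : r * C <= 1 / 4 by rewrite /D in rD1; lra.
split; first by rewrite r0 r1.
  by rewrite /D in rD1; lra.
by rewrite -exprMn; have : (r * C) ^+ 2 <= (1 / 4) ^+ 2 by [rewrite lerXn2r ?nnegrE //; lra]; lra.
Qed.

(** * Strict potentials *)

Section potentials.
Variables (R : realType) (k d m : nat) (T C ka : R).
Variables (b : R * 'cV[R]_k -> 'cV[R]_k) (sigma : R * 'cV[R]_k -> 'M[R]_(k, d)).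
Hypotheses (T_gt0 : 0 < T) (d_gt0 : (0 < d)%N) (C_ge0 : 0 <= C) (ka_ge0 : 0 <= ka).
Hypothesis b_growth : forall tx, strip T tx -> sqn (b tx) <= ka * (1 + sqn tx.2).
Hypothesis sigma_growth : forall tx, strip T tx -> forall l,
  sqn (Num.sqrt d%:R *: col l (sigma tx)) <= ka * (1 + sqn tx.2).

Lemma Ex_admissible r (C0 C1 : R) W : admissible r C0 C1 W ->
  1 - r ^+ 2 * C0 <= @Ex R d W <= 1 + r ^+ 2 * C0.
Proof.
move=> [c [tau [hc _ ->]]]; rewrite Ex_weight //.
move: hc; rewrite ler_norml => /andP[h1 h2].
rewrite !lerD2l ler_wpM2l ?sqr_ge0 // andbT -mulrN.
by rewrite ler_wpM2l ?sqr_ge0.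
Qed.

Lemma Ex_weight_cst (W : 'I_d -> bool -> R) a : Ex (fun l s => W l s * a) = a * Ex W.
Proof. by rewrite -ExZ; congr Ex; apply/funext => l; apply/funext => s; rewrite mulrC. Qed.

(** [K1] is the constant of [nice_quad] on the ball of radius [M]. [K2] is the resulting rate in
    [Ex_nice], with one more [C] because the weights do not have total mass exactly one. *)
Definition K1 M := 1 + 5 * (ka * (1 + M ^+ 2)).
Definition K2 M := 2 * C + K1 M + C * K1 M + C * Num.sqrt d%:R * K1 M.

Lemma K1_ge0 M : 0 <= K1 M.
Proof. by rewrite addr_ge0 // mulr_ge0 // mulr_ge0 // addr_ge0 // sqr_ge0. Qed.

Lemma K2_ge0 M : 0 <= K2 M.
Proof.
move: (K1_ge0 M); rewrite /K2; move: (K1 M) => x x0.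
by rewrite !addr_ge0 ?mulr_ge0 ?sqrtr_ge0.
Qed.

(** The coefficients are bounded in terms of the position, not of its distance to [z]; hence the
    reference value [1 + |x - z| ^ 2]. Removing the [1] again costs the deviation of the total mass
    from one. *)
Lemma sqn_step r W tx (z : 'cV[R]_k) M : small d C r -> admissible r C C W ->
  cyl T M tx ->
  Ex (fun l s => W l s * sqn ((nxt b sigma r tx l s).2 - z)) <=
  sqn (tx.2 - z) + r ^+ 2 * (K2 M * (1 + sqn (tx.2 - z))).
Proof.
move=> [/andP[r0 r1] hr _] hW [stx hM]; pose K := ka * (1 + M ^+ 2); pose K' := K1 M.
have M2 : sqn tx.2 <= M ^+ 2.
  by rewrite -enorm_sq lerXn2r ?nnegrE ?enorm_ge0 // (le_trans (enorm_ge0 tx.2)).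
have K0 : 0 <= K by rewrite mulr_ge0 // addr_ge0 // sqr_ge0.
pose D := tx.2 - z; pose p0 := 1 + sqn D.
have D0 := sqn_ge0 D.
have p01 : 1 <= p0 by rewrite lerDl.
have p00 : 0 <= p0 by rewrite (le_trans _ p01).
have kp : ka * (1 + sqn tx.2) <= K * p0.
  apply: (@le_trans _ _ (K * 1)); last by rewrite ler_wpM2l.
  by rewrite mulr1 ler_wpM2l // lerD2l.
have r01 : 0 <= r <= 1 by rewrite (ltW r0).
have hn := @nice_quad R d k r K p0 D (b tx) (fun l => Num.sqrt d%:R *: col l (sigma tx))
  r01 K0 _ (le_trans (b_growth stx) kp) (fun l => le_trans (sigma_growth stx l) kp).
have {}hn : nice r K' p0 (fun l s => 1 + sqn ((nxt b sigma r tx l s).2 - z)).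
  have := hn (_ : sqn D <= p0); rewrite /p0 lerDr => /(_ ler01).
  congr nice; apply/funext => l; apply/funext => s; rewrite addrK; congr (_ + sqn _).
  by rewrite /= /D -!addrA; congr (_ + _); rewrite addrC !addrA.
have K'0 : 0 <= K' := K1_ge0 M.
have := @Ex_nice R d d_gt0 r C C W K' p0 _ r01 K'0 C_ge0 C_ge0 hr hW hn.
have -> : (fun l s => W l s * (1 + sqn ((nxt b sigma r tx l s).2 - z))) =
   (fun l s => W l s * 1 + W l s * sqn ((nxt b sigma r tx l s).2 - z)).
  by apply/funext => l; apply/funext => s; rewrite mulrDr.
rewrite ExD Ex_weight_cst mul1r.
have /andP[h1 _] := Ex_admissible hW.
have h2 : r ^+ 2 * C <= r ^+ 2 * C * p0 by rewrite ler_peMr // mulr_ge0 // sqr_ge0.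
rewrite -/D /K2 -/K'; move: h1 h2; rewrite /p0; lra.
Qed.

(** A discrete form of an upper bound on the generator applied to [phi], uniform over the admissible
    changes of drift and mass. *)
Definition semiconcave_step (phi : R * 'cV[R]_k -> R) M := exists2 S : R, 0 <= S &
  forall r W tx, small d C r -> admissible r C C W -> cyl T M tx ->
    Ex (fun l s => W l s * phi (nxt b sigma r tx l s)) <= phi tx + r ^+ 2 * S.

Lemma small_W_ge0 r W : small d C r -> admissible r C C W -> forall (l : 'I_d) s, 0 <= W l s.
Proof.
by move=> [/andP[r0 _] hr _] hW l s; have := admissible_ge (ltW r0) hr hW l s; lra.
Qed.

Lemma time_step r (W : 'I_d -> bool -> R) (t s : R) : small d C r -> admissible r C C W ->
  0 <= t <= T -> 0 <= s <= T ->
  Ex (fun l s' => W l s' * (t + r ^+ 2 - s) ^+ 2) <=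
    (t - s) ^+ 2 + r ^+ 2 * ((C + 1) * (2 * T ^+ 2 + 4 * T + 2)).
Proof.
move=> [/andP[r0 r1] hr _] hW /andP[t0 t1] /andP[s0 s1].
have /andP[_ h1] := Ex_admissible hW.
rewrite Ex_weight_cst.
have rr0 := sqr_ge0 r; have rr1 : r ^+ 2 <= 1 by rewrite expr_le1 // ltW.
have a0 := sqr_ge0 (t + r ^+ 2 - s).
have h2 : (t + r ^+ 2 - s) ^+ 2 * Ex W <= (t + r ^+ 2 - s) ^+ 2 * (1 + r ^+ 2 * C).
  by rewrite ler_wpM2l.
apply: le_trans h2 _.
have h3 : (t + r ^+ 2 - s) ^+ 2 <= 2 * T ^+ 2 + 2.
  have h4 : (t - s) ^+ 2 <= T ^+ 2.
    by rewrite -[leLHS]real_normK ?num_real // lerXn2r ?nnegrE ?(ltW T_gt0) // ler_norml; apply/andP; split; lra.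
  have h5 : (r ^+ 2) ^+ 2 <= 1 by rewrite expr_le1.
  by have := sqr_ge0 (t - s - r ^+ 2); lra.
have h4 : r ^+ 2 * (C * (t + r ^+ 2 - s) ^+ 2) <= r ^+ 2 * (C * (2 * T ^+ 2 + 2)).
  by rewrite ler_wpM2l // ler_wpM2l.
have h5 : r ^+ 2 * (2 * (t - s) + r ^+ 2) <= r ^+ 2 * (2 * T + 1) by rewrite ler_wpM2l //; lra.
have h6 : 0 <= r ^+ 2 * (C * T) by rewrite mulr_ge0 // mulr_ge0 // ltW.
have h7 : 0 <= r ^+ 2 * T by rewrite mulr_ge0 // ltW.
have h8 : 0 <= r ^+ 2 * T ^+ 2 by rewrite mulr_ge0 // sqr_ge0.
lra.
Qed.

(** Any competitor for the infimum at [tx] is also one at every next position. With the competitor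
    held fixed only the paraboloid moves, and its increment is explicit. *)
Lemma semiconcave_inf_convolution (phi : R * 'cV[R]_k -> R) M K :
  0 <= M -> 0 <= K -> (forall tx, strip T tx -> 0 <= phi tx) ->
  ucont_on T (fun tx (_ : unit) => phi tx) ->
  semiconcave_step (inf_convolution T phi M K) M.
Proof.
move=> M0 K0 phi0 hphi; have [B B0 hB] := bounded_on_cyl M hphi.
have K20 := K2_ge0 M.
pose S1 := (C + 1) * (2 * T ^+ 2 + 4 * T + 2).
have S10 : 0 <= S1.
  by rewrite mulr_ge0 ?addr_ge0 // ?mulr_ge0 ?sqr_ge0 // ltW.
pose S := C * B + K * (S1 + K2 M * (1 + 4 * M ^+ 2)).
have S0 : 0 <= S.
  rewrite addr_ge0 ?mulr_ge0 // addr_ge0 // mulr_ge0 // addr_ge0 // mulr_ge0 // sqr_ge0 //.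
exists S => // r W tx hr hW Qx; rewrite -lerBlDr; apply: le_inf_convolution => // tz Qz.
rewrite lerBlDr; have W0 := small_W_ge0 hr hW.
have h1 : Ex (fun l s => W l s * inf_convolution T phi M K (nxt b sigma r tx l s)) <=
   Ex (fun l s => W l s * phi tz) + K * (Ex (fun l s => W l s * (tx.1 + r ^+ 2 - tz.1) ^+ 2) +
      Ex (fun l s => W l s * sqn ((nxt b sigma r tx l s).2 - tz.2))).
  rewrite -ExD -ExZ -ExD; apply: Ex_le => l s.
  rewrite -mulrDr mulrCA -mulrDr ler_wpM2l //.
  exact: (inf_convolution_le T_gt0 M0 K0 phi0 (nxt b sigma r tx l s) Qz).
apply: le_trans h1 _; rewrite Ex_weight_cst.
have h2 := time_step hr hW Qx.1 Qz.1.
have h3 := sqn_step tz.2 hr hW Qx.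
have /andP[_ h4] := Ex_admissible hW.
have pz : 0 <= phi tz by exact/phi0/Qz.1.
have pB : phi tz <= B by rewrite (le_trans (ler_norm _)) // hB.
have h5 : phi tz * Ex W <= phi tz * (1 + r ^+ 2 * C) by rewrite ler_wpM2l.
have rr0 := sqr_ge0 r.
have h6 : r ^+ 2 * (C * phi tz) <= r ^+ 2 * (C * B) by rewrite ler_wpM2l // ler_wpM2l.
have h7 : sqn (tx.2 - tz.2) <= 4 * M ^+ 2.
  have aux (y : R * 'cV[R]_k) : cyl T M y -> sqn y.2 <= M ^+ 2.
    by move=> [_ ?]; rewrite -enorm_sq lerXn2r ?nnegrE ?enorm_ge0.
  by have := sqnD_le tx.2 (- tz.2); rewrite sqnN; have := aux _ Qx; have := aux _ Qz; lra.
have h8 : r ^+ 2 * (K2 M * (1 + sqn (tx.2 - tz.2))) <= r ^+ 2 * (K2 M * (1 + 4 * M ^+ 2)).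
  by rewrite ler_wpM2l // ler_wpM2l // lerD2l.
have h9 := ler_wpM2l K0 (lerD h2 (le_trans h3 (lerD (lexx _) h8))).
by rewrite -/S1 in h9; rewrite /S; lra.
Qed.

Variable g : 'I_m -> 'I_m -> R * 'cV[R]_k -> R.
Hypothesis g_ucont : forall i j, i != j -> ucont_on T (fun tx (_ : unit) => g i j tx).
Hypothesis g_ge0 : forall i j, i != j -> forall tx, strip T tx -> 0 <= g i j tx.
Hypothesis g_noloop : forall tx, strip T tx -> forall N s, simple_loop N s ->
  0 < loop_cost (fun i j => g i j tx) N s.

(* Shortest-path potentials for costs slightly below [g]: no cycle of [g] being
   free, they exist, and as minima of sums of inf-convolutions they lose at most
   [O(r ^ 2)] in one step of the scheme. *)
Lemma strict_potentials M : 0 <= M -> exists (chi : 'I_m -> R * 'cV[R]_k -> R) (e c0 : R),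
  [/\ 0 < e, 0 <= c0, forall j tx, - c0 <= chi j tx <= 0,
      forall i j tx, i != j -> cyl T M tx -> chi j tx + e <= chi i tx + g i j tx &
      exists2 S : R, 0 <= S & forall j r W tx, small d C r -> admissible r C C W -> cyl T M tx ->
    Ex (fun l s => W l s * chi j (nxt b sigma r tx l s)) <= chi j tx + r ^+ 2 * S].
Proof.
move=> M0.
have [D D0 hD] : exists2 D : R, 0 < D & forall N s, simple_loop N s -> forall tx, cyl T M tx ->
    D <= loop_cost (fun i j => g i j tx) N s.
  (* A loop is a function on all naturals, of which only the values up to [N] matter, and [N] is at
     most [m + 1]. Coding by finite data leaves finitely many positive bounds, whose minimum is
     positive. *)
  pose code (p : 'I_m.+2 * {ffun 'I_m.+2 -> 'I_m}) N s :=
    p.1 = N :> nat /\ forall n, (n <= N)%N -> s n = p.2 (inord n).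
  have /choice[D hD] : forall p, exists D : R, 0 < D /\ forall N s, simple_loop N s ->
      code p N s -> forall tx, cyl T M tx -> D <= loop_cost (fun i j => g i j tx) N s.
    move=> p; have [[s0 [sl0 cs0]]|no] := pselect (exists s, simple_loop p.1 s /\ code p p.1 s).
      have [||D D0 hD] := @positive_on_cyl R k T (fun tx => loop_cost (fun i j => g i j tx) p.1 s0) M.
      - move=> tx stx e e0.
        pose phi n tx := if (1 <= n < p.1)%N then g (s0 n) (s0 n.+1) tx else 0.
        have phiE tx' : loop_cost (fun i j => g i j tx') p.1 s0 = \sum_(1 <= n < p.1) phi n tx'.
          by apply: eq_big_nat => n hn; rewrite /phi hn.
        have [|r r0 hr] := @ucont_sum R k T nat (index_iota 1 p.1) phi _ tx stx e e0.
          move=> n; rewrite /phi; have [hn|hn] := boolP (1 <= n < p.1)%N.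
            by apply/g_ucont; case: sl0 => _ _ _; apply.
          by move=> ? _ ? ?; exists 1 => // *; rewrite subrr normr0.
        by exists r => // ty h1 h2 h3 []; rewrite !phiE; exact: hr.
      - by move=> tx stx; exact: g_noloop.
      exists D; split=> // N s sl [pN cs] tx Qx; rewrite (le_trans (hD tx Qx)) // le_eqVlt.
      apply/orP; left; apply/eqP; rewrite -pN /loop_cost; apply: eq_big_nat => n /andP[n1 nN].
      by rewrite !cs -?pN ?(ltnW nN) // !(cs0.2 _ _) // ltnW.
    by exists 1; split=> // N s sl cs; case: no; exists s; move: cs; rewrite /code => -[-> cs].
  exists (\big[Num.min/1]_p D p).
    by apply: lt_bigmin => // p _; case: (hD p).
  move=> N s sl tx Qx.
  have Nm : (N < m.+2)%N.
    case: sl => N3 _ hc _; rewrite ltnS -(ltn_predK N3) ltnS -hc.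
    by rewrite (leq_trans (max_card _)) // card_ord.
  pose p : 'I_m.+2 * {ffun 'I_m.+2 -> 'I_m} := (Ordinal Nm, [ffun n : 'I_m.+2 => s n]).
  apply: (@le_trans _ _ (D p)); first exact: bigmin_le_cond.
  apply: ((hD p).2 N s) => //; split=> // n nN.
  by rewrite ffunE inordK // (leq_ltn_trans nN).
(* A simple loop has at most [m] edges, and each loses at most [2 * e]: once by regularisation, once
   by the shift in [c]. Its cost stays non-negative. *)
pose e := D / (2 * m.+1%:R).
have e0 : 0 < e by rewrite divr_gt0 // mulr_gt0.
have em : m%:R * (2 * e) <= D.
  apply: (@le_trans _ _ (m.+1%:R * (2 * e))).
    apply: ler_wpM2r; last by rewrite ler_nat.
    by apply: mulr_ge0 => //; exact: ltW.
  by rewrite le_eqVlt /e; apply/orP; left; apply/eqP; field; rewrite addrC natr1.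
have /choice[K0 hK0] : forall p : 'I_m * 'I_m, exists K : R, 0 <= K /\ (p.1 != p.2 ->
    forall K' tx, K <= K' -> cyl T M tx ->
    g p.1 p.2 tx - e <= inf_convolution T (g p.1 p.2) M K' tx).
  move=> [i j] /=; have [->|ij] := eqVneq i j; first by exists 0.
  have [K K0 hK] := inf_convolution_close T_gt0 M0 e0 (g_ge0 ij) (g_ucont ij).
  by exists K.
pose K := \sum_p K0 p.
have K_ge p : K0 p <= K.
  by rewrite /K (bigD1 p) //= lerDl sumr_ge0 // => q _; case: (hK0 q).
have K_ge0 : 0 <= K by rewrite sumr_ge0 // => q _; case: (hK0 q).
(* The inf-convolution lies below [g]; the subtracted [e] becomes the strict margin of the
   potentials. *)
pose c tx i j := inf_convolution T (g i j) M K tx - e.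
pose chi j tx := bellman_ford (c tx) m j.
have c_ge tx i j : i != j -> - e <= c tx i j.
  move=> ij; rewrite /c lerDr; exact: (inf_convolution_ge0 T_gt0 M0 K_ge0 (g_ge0 ij)).
have /choice[Sg hSg] : forall p : 'I_m * 'I_m, exists S : R, 0 <= S /\ (p.1 != p.2 ->
    forall r W tx, small d C r -> admissible r C C W -> cyl T M tx ->
    Ex (fun l s => W l s * inf_convolution T (g p.1 p.2) M K (nxt b sigma r tx l s))
     <= inf_convolution T (g p.1 p.2) M K tx + r ^+ 2 * S).
  move=> [i j] /=; have [->|ij] := eqVneq i j; first by exists 0.
  have [S S0 hS] := semiconcave_inf_convolution M0 K_ge0 (g_ge0 ij) (g_ucont ij).
  by exists S.
pose S1 := \sum_p Sg p.
have S1_ge p : Sg p <= S1.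
  by rewrite /S1 (bigD1 p) //= lerDl sumr_ge0 // => q _; case: (hSg q).
have S1_ge0 : 0 <= S1 by rewrite sumr_ge0 // => q _; case: (hSg q).
exists chi, e, (m%:R * e); split => //.
- by rewrite mulr_ge0 // ltW.
- move=> j tx; rewrite bellman_ford_le0 andbT.
  by apply: bellman_ford_ge; [exact: ltW | move=> *; exact: c_ge].
- move=> i j tx ij Qx.
  have : chi j tx <= chi i tx + c tx i j.
    apply: bellman_ford_stable => // N s sl; rewrite /loop_cost.
    have : \sum_(1 <= n < N) (g (s n) (s n.+1) tx - 2 * e) <= \sum_(1 <= n < N) c tx (s n) (s n.+1).
      rewrite !big_seq; apply: ler_sum => n; rewrite mem_index_iota => hn.
      have ne : s n != s n.+1 by case: sl => _ _ _; exact.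
      by have := (hK0 (s n, s n.+1)).2 ne K tx (K_ge _) Qx; rewrite /c /=; lra.
    apply: le_trans; rewrite sumrB sumr_const_nat subr_ge0.
    apply: le_trans (hD _ _ sl tx Qx); apply: le_trans em.
    rewrite -[leLHS]mulr_natl; apply: ler_wpM2r; first by apply: mulr_ge0 => //; exact: ltW.
    rewrite ler_nat subn1.
    case: sl => _ _ <- _; by rewrite (leq_trans (max_card _)) // card_ord.
  have := inf_convolution_self T_gt0 M0 K_ge0 (g_ge0 ij) Qx.
  by rewrite /c; lra.
exists (m%:R * (S1 + C * e)); first by rewrite mulr_ge0 // addr_ge0 // mulr_ge0 // ltW.
move=> j r W tx hr hW Qx.
(* A minimum of several terms is bounded, after a step, by the term that is minimal before it. Each
   edge then adds its semiconcavity constant, and [C * e] for the mass multiplying [- e]. *)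
suff H n j' : Ex (fun l s => W l s * bellman_ford (c (nxt b sigma r tx l s)) n j') <=
    bellman_ford (c tx) n j' + r ^+ 2 * (n%:R * (S1 + C * e)) by exact: H.
have W0 := small_W_ge0 hr hW; have /andP[W1 _] := Ex_admissible hW.
elim: n j' => [|n IH] {}j.
  rewrite mul0r mulr0 addr0 /= -[leRHS](mul0r (Ex W)) -Ex_weight_cst.
  by apply: Ex_le => l s; rewrite !mulr0.
have [->|[i ij ->]] := bellman_ford_case (c tx) n j.
  apply: (@le_trans _ _ (bellman_ford (c tx) n j + r ^+ 2 * (n%:R * (S1 + C * e)))).
    apply: le_trans (IH j); apply: Ex_le => l s; rewrite ler_wpM2l //.
    exact: bellman_ford_decr.
  rewrite lerD2l ler_wpM2l ?sqr_ge0 // ler_wpM2r ?ler_nat // addr_ge0 // mulr_ge0 // ltW //.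
have := (hSg (i, j)).2 ij r W tx hr hW Qx; have := IH i; rewrite /=.
set E1 := Ex _; set E2 := Ex _ => h1 h2.
apply: (@le_trans _ _ (E1 + E2 + (- e) * Ex W)).
  rewrite -Ex_weight_cst -!ExD; apply: Ex_le => l s; rewrite -!mulrDr ler_wpM2l //.
  by rewrite -addrA; exact: bellman_ford_edge.
have h3 : r ^+ 2 * Sg (i, j) <= r ^+ 2 * S1 by rewrite ler_wpM2l ?sqr_ge0.
have h4 : e * (1 - r ^+ 2 * C) <= e * Ex W by rewrite ler_wpM2l // ltW.
rewrite /c -[n.+1%:R]natr1; lra.
Qed.
End potentials.

(** * Quadratic test functions *)

Section quadratic.
Variables (R : realType) (k : nat).
Implicit Types (M : 'M[R]_k) (x y z : 'cV[R]_k).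

Definition qform M z : R := dotm z (M *m z).

Lemma dotmE x y : (x^T *m y) 0 0 = dotm x y.
Proof. by rewrite mxE; apply: eq_bigr => i _; rewrite big_ord1 mxE. Qed.

Lemma dotm_mulmx_sym M x y : M^T = M -> dotm x (M *m y) = dotm y (M *m x).
Proof.
move=> Ms; rewrite -!dotmE -[in RHS]Ms.
have -> : x^T *m (M *m y) = (y^T *m (M^T *m x))^T.
  by rewrite trmx_mul trmxK trmx_mul trmxK mulmxA.
by rewrite mxE.
Qed.

Lemma qformD M x y : M^T = M -> qform M (x + y) = qform M x + 2 * dotm y (M *m x) + qform M y.
Proof.
by move=> Ms; rewrite /qform mulmxDr dotmDl !dotmDr (dotm_mulmx_sym x y Ms); ring.
Qed.

Lemma qformZ M a x : qform M (a *: x) = a ^+ 2 * qform M x.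
Proof. by rewrite /qform -scalemxAr dotmZl dotmZr mulrA. Qed.

Lemma qform_bound M z : `|qform M z| <= (\sum_i \sum_j `|M i j|) * sqn z.
Proof.
rewrite /qform /dotm (le_trans (ler_norm_sum _ _ _)) // mulr_suml; apply: ler_sum => i _.
rewrite big_ord1 mxE mulr_sumr (le_trans (ler_norm_sum _ _ _)) // mulr_suml.
apply: ler_sum => j _; rewrite mulrCA normrM ler_wpM2l // normrM -enorm_sq expr2.
by rewrite ler_pM // normr_entry.
Qed.

Lemma qform_addscalar M a z : qform (M + a%:M) z = qform M z + a * sqn z.
Proof. by rewrite /qform mulmxDl dotmDr mul_scalar_mx dotmZr. Qed.

Lemma mxtrace_qform d (s : 'M[R]_(k, d)) M : M^T = M ->
  \tr (s *m s^T *m M) = \sum_l qform M (col l s).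
Proof.
move=> Ms; rewrite -mulmxA mxtrace_mulC /mxtrace; apply: eq_bigr => l _.
rewrite -mulmxA /qform -dotmE mxE [RHS]mxE; apply: eq_bigr => i _; rewrite !mxE; congr (_ * _).
by apply: eq_bigr => j _; rewrite !mxE.
Qed.
End quadratic.

Section ulim_vectors.
Variables (R : realType) (U : set_system nat) (k : nat).
Hypothesis UU : UltraFilter U.
Implicit Types (xs ys : nat -> 'cV[R]_k).

Lemma ulimv_dotm xs ys x y : ulimv_to U xs x -> ulimv_to U ys y ->
  ulim_to U (fun n => dotm (xs n) (ys n)) (dotm x y).
Proof.
move=> hx hy; apply: (ulim_sum UU) => i; apply: (ulim_sum UU) => j; rewrite (ord1 j).
by apply: (ulimM UU); exact: (ulimv_entry UU).
Qed.

Lemma ulimv_mulmx l (M : 'M[R]_(l, k)) xs x :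
  ulimv_to U xs x -> ulimv_to U (fun n => M *m xs n) (M *m x).
Proof.
move=> hx; apply: (ulimv_entries UU) => i; rewrite mxE.
have : ulim_to U (fun n => \sum_j M i j * xs n j 0) (\sum_j M i j * x j 0).
  by apply: (ulim_sum UU) => j; apply: (ulimM UU); [exact: ulim_cst | exact: (ulimv_entry UU)].
by apply: (ulim_eq UU); apply: filterE => n /=; rewrite mxE.
Qed.

Lemma ulimvD xs ys x y : ulimv_to U xs x -> ulimv_to U ys y ->
  ulimv_to U (fun n => xs n + ys n) (x + y).
Proof.
move=> hx hy; apply: (ulimv_entries UU) => i; rewrite mxE.
have := ulimD UU (ulimv_entry UU i hx) (ulimv_entry UU i hy).
by apply: (ulim_eq UU); apply: filterE => n /=; rewrite mxE.
Qed.

Lemma ulimvZ (a : nat -> R) xs la x : ulim_to U a la -> ulimv_to U xs x ->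
  ulimv_to U (fun n => a n *: xs n) (la *: x).
Proof.
move=> ha hx; apply: (ulimv_entries UU) => i; rewrite mxE.
have := ulimM UU ha (ulimv_entry UU i hx).
by apply: (ulim_eq UU); apply: filterE => n /=; rewrite mxE.
Qed.
End ulim_vectors.

(** Takes the place of an attained maximum: no continuity in space is available for the scheme at
    fixed step size. *)
Lemma near_sup (R : realType) (A : Type) (S : set A) (val : A -> R) (B e : R) :
  S !=set0 -> (forall a, S a -> val a <= B) -> 0 < e ->
  exists2 a, S a & forall a', S a' -> val a' <= val a + e.
Proof.
move=> [a0 Sa0] hB e0; pose V := [set val a | a in S].
have hV : has_sup V.
  by split; [exists (val a0), a0 | exists B => _ [a /hB ? <-]].
have [_ [a Sa <-] ha] := sup_adherent e0 hV.
exists a => // a' Sa'.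
have : val a' <= sup V by apply: sup_upper_bound => //; exists a'.
lra.
Qed.

Section test_function.
Variables (R : realType) (k d : nat).
Hypothesis d_gt0 : (0 < d)%N.
Variables (v0 t0 p : R) (x0 q : 'cV[R]_k) (M : 'M[R]_k).
Hypothesis Msym : M^T = M.

Definition test_fun (t : R) (x : 'cV[R]_k) : R :=
  v0 + p * (t - t0) + dotm q (x - x0) + 2^-1 * qform M (x - x0).

Variables (r t : R) (x b0 : 'cV[R]_k) (s : 'M[R]_(k, d)).
Let e l u := test_fun (t + r ^+ 2)
  (x + r ^+ 2 *: b0 + (sg u * r) *: (Num.sqrt d%:R *: col l s)).
Let y := x - x0 + r ^+ 2 *: b0.
Let a l := Num.sqrt d%:R * (dotm q (col l s) + dotm (col l s) (M *m y)).

Let test_fun_stepE l u : e l u = v0 + p * (t + r ^+ 2 - t0) + dotm q y + 2^-1 * qform M y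
   + sg u * (r * a l) + 2^-1 * (r ^+ 2 * (d%:R * qform M (col l s))).
Proof.
rewrite /e /test_fun.
have -> : x + r ^+ 2 *: b0 + (sg u * r) *: (Num.sqrt d%:R *: col l s) - x0 =
   y + (sg u * r * Num.sqrt d%:R) *: col l s.
  by rewrite scalerA /y addrAC [x + _ - x0]addrAC.
rewrite qformD // dotmDr !dotmZr dotmZl qformZ !exprMn [sg u ^+ 2]expr2 sg_sq mul1r.
by rewrite [Num.sqrt _ ^+ 2]expr2 sqrtd_sq /a; field.
Qed.

(** Consistency with no Taylor remainder: on a quadratic polynomial the odd terms cancel, and the
    [d] of the squared jump cancels the probability [1 / d]. *)
Lemma Ex_test_fun : Ex e = test_fun t x + r ^+ 2 * (p + dotm q b0 + dotm b0 (M *m (x - x0))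
   + 2^-1 * (r ^+ 2 * qform M b0) + 2^-1 * \sum_l qform M (col l s)).
Proof.
have -> : e = fun l u => (v0 + p * (t + r ^+ 2 - t0) + dotm q y + 2^-1 * qform M y
   + sg u * (r * a l)) + (2^-1 * r ^+ 2) * (d%:R * qform M (col l s)).
  apply/funext => l; apply/funext => u; rewrite test_fun_stepE; congr (_ + _).
  exact: mulrA.
rewrite ExD ExD Ex_cst // Ex_odd ExZ.
have -> : Ex (fun (l : 'I_d) (_ : bool) => d%:R * qform M (col l s)) = \sum_l qform M (col l s).
  rewrite ExZ /Ex mulrA divff ?mul1r ?pnatr_eq0 -?lt0n //.
  by apply: eq_bigr => l _; lra.
rewrite /test_fun /y qformD // qformZ dotmDr dotmZr dotmZl; lra.
Qed.

Lemma Zg_test_fun : 0 < r -> Zg r e = \col_l (dotm q (col l s) + dotm (col l s) (M *m y)).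
Proof.
move=> r0; apply/matrixP => l j; rewrite !mxE !test_fun_stepE /a /sg.
have := @sqrtd_gt0 R d d_gt0; move: (Num.sqrt _) => z z0; field.
by rewrite !gt_eqF.
Qed.
End test_function.

(** * The scheme *)

(* The absolute value makes the definition total; it is harmless because [g] is
   non-negative. *)
Definition switched (R : realType) (m : nat) (w : 'I_m -> R) (c : 'I_m -> 'I_m -> R) :
    'I_m -> R :=
  sval (cid (@switch_closure R m w (fun i j => `|c i j|) (fun i j _ => normr_ge0 (c i j)))).

Section scheme.
Variables (R : realType) (k d m : nat) (T : R).
Variables (b : R * 'cV[R]_k -> 'cV[R]_k) (sigma : R * 'cV[R]_k -> 'M[R]_(k, d)).
Variable f : 'I_m -> R * 'cV[R]_k -> 'cV[R]_m -> 'cV[R]_d -> R.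
Variable g : 'I_m -> 'I_m -> R * 'cV[R]_k -> R.
Variable h : 'I_m -> 'cV[R]_k -> R.

Definition tau (r : R) j : R := T - j%:R * r ^+ 2.

(** An explicit scheme: [f] reads the expected values and the slope one step later, so nothing has
    to be solved for. *)
Definition continuation r (tx : R * 'cV[R]_k) (v : 'I_m -> 'cV[R]_k -> R) (i : 'I_m) : R :=
  let e l := fun a s => v l (nxt b sigma r tx a s).2 in
  Ex (e i) + r ^+ 2 * f i tx (\col_l Ex (e l)) (Zg r (e i)).

(* [scheme r j] approximates the solution at time [tau r j]: the index [j] counts
   steps backwards from the terminal time. *)
Fixpoint scheme r j : 'I_m -> 'cV[R]_k -> R :=
  if j is j'.+1 then fun i x =>
    switched (fun l => continuation r (tau r j'.+1, x) (scheme r j') l)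
             (fun l n => g l n (tau r j'.+1, x)) i
  else h.

Lemma tauS r j : tau r j.+1 + r ^+ 2 = tau r j.
Proof. by rewrite /tau -natr1; ring. Qed.

Lemma tau_strip r N j (x : 'cV[R]_k) : N%:R * r ^+ 2 = T -> (j <= N)%N -> strip T (tau r j, x).
Proof.
move=> hN jN; apply/andP; split; rewrite /= /tau.
  by rewrite subr_ge0 -hN ler_wpM2r ?sqr_ge0 // ler_nat.
by rewrite gerBl mulr_ge0 // sqr_ge0.
Qed.

Hypothesis g_ge0 : forall i j, i != j -> forall tx, strip T tx -> 0 <= g i j tx.
Hypothesis h_obst : forall i j x, i != j -> h j x - g i j (T, x) <= h i x.

Section bounds.
Variables (r : R) (N : nat).
Hypothesis NrT : N%:R * r ^+ 2 = T.

Lemma scheme_ge j i x : continuation r (tau r j.+1, x) (scheme r j) i <= scheme r j.+1 i x.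
Proof. by rewrite /= /switched; case: cid => v []. Qed.

Lemma scheme_le j x M : (forall i, continuation r (tau r j.+1, x) (scheme r j) i <= M) ->
  forall i, scheme r j.+1 i x <= M.
Proof. by rewrite /= /switched; case: cid => v [] _ _ _ /= h' hM i; exact: h'. Qed.

Lemma scheme_obst j i l x : (j <= N)%N -> i != l ->
  scheme r j l x - g i l (tau r j, x) <= scheme r j i x.
Proof.
case: j => [|j] jN il; first by rewrite /tau mul0r subr0; exact: h_obst.
have := g_ge0 il (tau_strip x NrT jN).
rewrite /= /switched; case: cid => v [] _ /= hv _ _ g0.
by have := hv _ _ il; rewrite ger0_norm.
Qed.

Lemma scheme_case j i x : (j.+1 <= N)%N ->
  scheme r j.+1 i x = continuation r (tau r j.+1, x) (scheme r j) i \/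
  exists2 l, i != l & scheme r j.+1 i x <= scheme r j.+1 l x - g i l (tau r j.+1, x).
Proof.
move=> jN; rewrite /= /switched; case: cid => v [] _ _ /= hv _.
case: (hv i) => [|[l il hl]]; [by left | right; exists l => //].
by have := g_ge0 il (tau_strip x NrT jN) => g0; rewrite ger0_norm in hl.
Qed.
End bounds.

(** * Growth of the scheme and one step of comparison *)

Variables (C ka A0 : R) (p : nat).
Hypotheses (T_gt0 : 0 < T) (d_gt0 : (0 < d)%N) (C_ge0 : 0 <= C) (ka_ge0 : 0 <= ka).
Hypothesis A0_ge0 : 0 <= A0.
Hypothesis b_growth : forall tx, strip T tx -> sqn (b tx) <= ka * (1 + sqn tx.2).
Hypothesis sigma_growth : forall tx, strip T tx -> forall l,
  sqn (Num.sqrt d%:R *: col l (sigma tx)) <= ka * (1 + sqn tx.2).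
Hypothesis f_lip : forall i tx y y' z z', strip T tx ->
  `|f i tx y z - f i tx y' z'| <= C * (\sum_(l < m) `|y l 0 - y' l 0| + enorm (z - z')).
Hypothesis f_mono : forall i l, l != i -> forall tx (y y' : 'cV[R]_m) z, strip T tx ->
  (forall j, j != l -> y j 0 = y' j 0) -> y l 0 <= y' l 0 -> f i tx y z <= f i tx y' z.
Hypothesis f_growth : forall i tx, strip T tx -> `|f i tx 0 0| <= A0 * (1 + sqn tx.2) ^+ p.
Hypothesis h_growth : forall i x, `|h i x| <= A0 * (1 + sqn x) ^+ p.

Lemma f_diff i tx y y' z z' : strip T tx ->
  f i tx y z - f i tx y' z' <= C * (\sum_l Num.max 0 (y l 0 - y' l 0))
     + C * `|y i 0 - y' i 0| + C * enorm (z - z').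
Proof.
move=> stx; apply: (lipschitz_monotone (F := f i tx)) => //.
  by move=> *; exact: f_lip.
by move=> l li y1 y2 z1 h1 h2; exact: (f_mono li).
Qed.

Definition rate ka' := C + ka' + C * ka' + C * Num.sqrt d%:R * ka'.

Lemma rate_ge0 ka' : 0 <= ka' -> 0 <= rate ka'.
Proof. by move=> ?; rewrite !addr_ge0 ?mulr_ge0 ?sqrtr_ge0. Qed.

(** Rate for the [n]-th power of [1 + |x| ^ 2]: the constant [1 + 5 * ka] of [nice_quad],
    transformed by [nice_exp] and fed into [Ex_nice]. *)
Definition rho_rate n := rate (((1 + 4 * (1 + 5 * ka)) ^+ n - 1) / 4).

Lemma nice_rho_ge0 n : 0 <= ((1 + 4 * (1 + 5 * ka)) ^+ n - 1) / 4.
Proof.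
rewrite divr_ge0 // subr_ge0 exprn_ege1 // lerDl mulr_ge0 // addr_ge0 // mulr_ge0 //.
Qed.

Lemma rho_rate_ge0 n : 0 <= rho_rate n.
Proof. exact/rate_ge0/nice_rho_ge0. Qed.

Lemma rho_step n r W tx : small d C r -> admissible r C C W -> strip T tx ->
  Ex (fun l s => W l s * (1 + sqn (nxt b sigma r tx l s).2) ^+ n) <=
  (1 + r ^+ 2 * rho_rate n) * (1 + sqn tx.2) ^+ n.
Proof.
move=> [/andP[r0 r1] hr _] hW stx; have r01 : 0 <= r <= 1 by rewrite (ltW r0).
have r5 : 0 <= 1 + 5 * ka by rewrite addr_ge0 // mulr_ge0.
apply: Ex_nice => //; first exact: nice_rho_ge0.
apply: nice_exp => //.
have := @nice_quad R d k r ka (1 + sqn tx.2) tx.2 (b tx) (fun l => Num.sqrt d%:R *: col l (sigma tx))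
  r01 ka_ge0 _ (b_growth stx) (sigma_growth stx).
rewrite lerDr ler01 => /(_ isT); congr nice; apply/funext => l; apply/funext => s.
by rewrite addrK.
Qed.

(** The weights depend on the families being compared, so the barrier must be controlled under all
    admissible ones; the trivial weight among them controls [Ex psi] in the coupling term. *)
Lemma one_step_bound r mu (u' a' q' : 'I_m -> 'I_d -> bool -> R)
    (psi : 'I_d -> bool -> R) i u a phu pha rho X :
  small d C r -> 0 <= mu ->
  (forall l n s, 0 <= q' l n s) -> (forall n s, 0 <= psi n s) ->
  (forall l n s, u' l n s + mu * q' l n s - a' l n s <= psi n s) ->
  (forall W, admissible r C C W -> Ex (fun n s => W n s * psi n s) <= X) ->
  u <= Ex (u' i) + r ^+ 2 * phu -> Ex (a' i) + r ^+ 2 * pha <= a ->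
  phu - pha <= rho + C * \sum_l Num.max 0 (Ex (u' l) - Ex (a' l))
     + C * `|Ex (u' i) - Ex (a' i)| + C * enorm (Zg r (u' i) - Zg r (a' i)) ->
  exists2 W, admissible r C C W &
    u - a <= (1 + r ^+ 2 * (C * m%:R)) * X - mu * Ex (fun n s => W n s * q' i n s) + r ^+ 2 * rho.
Proof.
move=> [/andP[r0 r1] hr _] mu0 q0 psi0 hpsi hX hu ha hp.
have [W hW hle] := one_step d_gt0 r0 C_ge0 mu0 hr q0 psi0 hpsi hu ha hp.
exists W => //; apply: le_trans hle _.
have h1 := hX _ hW; have h2 := hX _ (@admissible1 R d r C C C_ge0 C_ge0).
have {}h2 : Ex psi <= X.
  apply: le_trans h2; apply: Ex_le => *; by rewrite mul1r.
have : r ^+ 2 * (C * m%:R * Ex psi) <= r ^+ 2 * (C * m%:R * X).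
  by rewrite ler_wpM2l ?sqr_ge0 // ler_wpM2l // mulr_ge0.
lra.
Qed.

Lemma Zg_cst r a : @Zg R d r (fun _ _ => a) = 0.
Proof. by apply/matrixP => i j; rewrite !mxE subrr mul0r. Qed.

(** The summands stand for the source [f(., 0, 0)], the coupling through [f], the spreading of the
    walk, and the product of the last two, where [r <= 1] is used. *)
Definition growth_rate := 1 + C * m%:R + rho_rate p + C * m%:R * rho_rate p.

Lemma growth_rate_ge0 : 0 <= growth_rate.
Proof.
have := rho_rate_ge0 p; rewrite /growth_rate; move: (rho_rate p) => x x0.
by rewrite !addr_ge0 ?mulr_ge0.
Qed.

(** The barrier is compared with zero on both sides. From below it is enough that the scheme
    dominates its continuation; from above, a common bound on all continuations passes through the
    switching closure because the latter is minimal. *)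
Lemma scheme_growth r N j i x : small d C r -> N%:R * r ^+ 2 = T -> (j <= N)%N ->
  `|scheme r j i x| <= A0 * (1 + r ^+ 2 * growth_rate) ^+ j * (1 + sqn x) ^+ p.
Proof.
move=> hr NrT; elim: j i x => [|j IH] i x jN; first by rewrite expr0 mulr1.
have rr0 := sqr_ge0 r.
have {}IH l y := IH l y (ltnW jN).
set G := growth_rate; set La := A0 * (1 + r ^+ 2 * G) ^+ j in IH *.
have G0 : 0 <= G := growth_rate_ge0.
have La0 : 0 <= La by rewrite mulr_ge0 // exprn_ge0 // addr_ge0 // mulr_ge0.
have LaA : A0 <= La.
  by rewrite ler_peMr // exprn_ege1 // lerDl mulr_ge0.
set tx := (tau r j.+1, x).
have stx : strip T tx := tau_strip x NrT jN.
have rho0 (y : 'cV[R]_k) : 1 <= 1 + sqn y by rewrite lerDl sqn_ge0.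
have rp0 (y : 'cV[R]_k) : 0 <= (1 + sqn y) ^+ p by rewrite exprn_ge0 // (le_trans ler01).
pose psi := fun l s => La * (1 + sqn (nxt b sigma r tx l s).2) ^+ p.
have psi0 l s : 0 <= psi l s by rewrite mulr_ge0.
pose X := La * ((1 + r ^+ 2 * rho_rate p) * (1 + sqn x) ^+ p).
have hX W : admissible r C C W -> Ex (fun n s => W n s * psi n s) <= X.
  move=> hW; rewrite /X -[(1 + sqn x)]/(1 + sqn tx.2).
  apply: le_trans (_ : La * Ex (fun l s => W l s * (1 + sqn (nxt b sigma r tx l s).2) ^+ p) <= _).
    by rewrite -ExZ; apply: Ex_le => l s; rewrite mulrCA.
  by rewrite ler_wpM2l // rho_step.
have fin : (1 + r ^+ 2 * (C * m%:R)) * X + r ^+ 2 * (A0 * (1 + sqn x) ^+ p) <=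
   La * (1 + r ^+ 2 * G) * (1 + sqn x) ^+ p.
  have [/andP[r0 r1] _ _] := hr.
  have rr1 : r ^+ 2 <= 1 by rewrite expr_le1 // ltW.
  have Lr0 : 0 <= La * (1 + sqn x) ^+ p by rewrite mulr_ge0.
  have h1 : r ^+ 2 * (A0 * (1 + sqn x) ^+ p) <= r ^+ 2 * (La * (1 + sqn x) ^+ p).
    by rewrite ler_wpM2l // ler_wpM2r.
  have h2 : r ^+ 2 * (r ^+ 2 * (C * m%:R * rho_rate p * (La * (1 + sqn x) ^+ p))) <=
     r ^+ 2 * (1 * (C * m%:R * rho_rate p * (La * (1 + sqn x) ^+ p))).
    rewrite ler_wpM2l // ler_wpM2r // mulr_ge0 // mulr_ge0 ?rho_rate_ge0 // mulr_ge0 //.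
  rewrite /X /G /growth_rate; lra.
have -> : A0 * (1 + r ^+ 2 * G) ^+ j.+1 = La * (1 + r ^+ 2 * G) by rewrite exprSr mulrA.
pose V l n s := scheme r j l (nxt b sigma r tx n s).2.
have f00 := f_growth i stx.
rewrite ler_norml; apply/andP; split.
  rewrite lerNl -sub0r; apply: le_trans fin.
  have [//|//||W _ le] := @one_step_bound r 0 (fun _ _ _ => 0) V (fun _ _ _ => 0) psi i 0
      (scheme r j.+1 i x) 0 (f i tx (\col_l Ex (V l)) (Zg r (V i))) (A0 * (1 + sqn x) ^+ p) X hr
      (lexx 0) (fun _ _ _ => lexx 0) psi0 _ hX _ (scheme_ge r j i x) _.
  - move=> l n s; rewrite mul0r add0r sub0r lerNl.
    by have := IH l (nxt b sigma r tx n s).2; rewrite ler_norml => /andP[].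
  - by rewrite mulr0 addr0 Ex_cst.
  - have := f_diff i 0 (\col_l Ex (V l)) 0 (Zg r (V i)) stx.
    rewrite Zg_cst !mxE Ex_cst // => h1.
    have h2 : f i tx 0 0 <= A0 * (1 + sqn x) ^+ p by rewrite (le_trans (ler_norm _)) .
    have h2' : - f i tx 0 0 <= A0 * (1 + sqn x) ^+ p.
      by rewrite (le_trans (ler_norm _)) // normrN.
    have eq : \sum_l Num.max 0 ((0 : 'cV[R]_m) l 0 - (\col_l Ex (V l)) l 0) =
       \sum_l Num.max 0 (0 - Ex (V l)).
      by apply: eq_bigr => l _; rewrite !mxE.
    rewrite eq in h1; lra.
  by move: le; rewrite mul0r subr0.
apply: scheme_le => l; apply: le_trans fin; rewrite -[leLHS]subr0.
have [//|//||W _ le] := @one_step_bound r 0 V (fun _ _ _ => 0) (fun _ _ _ => 0) psi l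
    (continuation r tx (scheme r j) l) 0 (f l tx (\col_l Ex (V l)) (Zg r (V l))) 0
    (A0 * (1 + sqn x) ^+ p) X hr
    (lexx 0) (fun _ _ _ => lexx 0) psi0 _ hX (lexx _) _ _.
- move=> a n s; rewrite mul0r addr0 subr0.
  by have := IH a (nxt b sigma r tx n s).2; rewrite ler_norml => /andP[].
- by rewrite mulr0 addr0 Ex_cst.
- have := f_diff l (\col_l Ex (V l)) 0 (Zg r (V l)) 0 stx.
  rewrite Zg_cst !mxE Ex_cst // => h1.
  have h2 : f l tx 0 0 <= A0 * (1 + sqn x) ^+ p.
    by rewrite (le_trans (ler_norm _)) // f_growth.
  have eq : \sum_a Num.max 0 ((\col_l Ex (V l)) a 0 - (0 : 'cV[R]_m) a 0) =
     \sum_a Num.max 0 (Ex (V a) - 0).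
    by apply: eq_bigr => a _; rewrite !mxE.
  rewrite eq in h1; lra.
by move: le; rewrite mul0r !subr0.
Qed.

Lemma exp_rate_le r N j (la : R) : 0 <= la -> N%:R * r ^+ 2 = T -> (j <= N)%N ->
  1 <= (1 + r ^+ 2 * la) ^+ j <= expR (la * T).
Proof.
move=> la0 NrT jN; have rr0 : 0 <= r ^+ 2 * la by rewrite mulr_ge0 // sqr_ge0.
rewrite exprn_ege1 ?lerDl //=.
apply: (@le_trans _ _ (expR (r ^+ 2 * la) ^+ j)).
  by rewrite lerXn2r ?nnegrE ?addr_ge0 ?expR_ge0 // expR_ge1Dx.
rewrite -expRM_natl ler_expR mulrA mulrC ler_wpM2l // -NrT ler_wpM2r ?sqr_ge0 //.
by rewrite ler_nat.
Qed.

Let V r tx j (l : 'I_m) := fun n s => scheme r j l (nxt b sigma r tx n s).2.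

Lemma continuationE r j x i : continuation r (tau r j.+1, x) (scheme r j) i =
  Ex (V r (tau r j.+1, x) j i) + r ^+ 2 *
    f i (tau r j.+1, x) (\col_l Ex (V r (tau r j.+1, x) j l)) (Zg r (V r (tau r j.+1, x) j i)).
Proof. by []. Qed.

(* At an index maximising [V i + mu * q i - a i] switching cannot be optimal for
   the scheme: it costs [g], while [mu * q] gains [g] plus the margin [mu * e]. *)
Lemma switch_step r N j x (chi : 'I_m -> R * 'cV[R]_k -> R) (e S M B B2 f0 mu X rho : R)
    (a pha : 'I_m -> R) (a' : 'I_m -> 'I_d -> bool -> R) (psi : 'I_d -> bool -> R) :
  let tx := (tau r j.+1, x) in
  let q j i x := (scheme r j i x + B) ^+ 2 / 2 - chi i (tau r j, x) in
  small d C r -> N%:R * r ^+ 2 = T -> (j.+1 <= N)%N -> enorm x <= M ->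
  0 < e -> 0 < mu -> 0 <= f0 ->
  (forall l ty, chi l ty <= 0) ->
  (forall i l ty, i != l -> cyl T M ty -> chi l ty + e <= chi i ty + g i l ty) ->
  (forall l r W ty, small d C r -> admissible r C C W -> cyl T M ty ->
    Ex (fun n s => W n s * chi l (nxt b sigma r ty n s)) <= chi l ty + r ^+ 2 * S) ->
  (forall i l, i != l -> 1 <= scheme r j.+1 l x - g i l tx / 2 + B) ->
  (forall i, `|Ex (V r tx j i) + B| <= B2) ->
  (forall i, `|f i tx (\col_l Ex (V r tx j l)) 0| <= f0) ->
  (forall i l, i != l -> a l - g i l tx - mu * (e / 2) <= a i) ->
  (forall i, Ex (a' i) + r ^+ 2 * pha i <= a i) ->
  (forall l n s, V r tx j l n s + mu * q j l (nxt b sigma r tx n s).2 - a' l n s <= psi n s) ->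
  (forall n s, 0 <= psi n s) ->
  (forall i, f i tx (\col_l Ex (V r tx j l)) (Zg r (V r tx j i)) - pha i <=
     rho + C * \sum_l Num.max 0 (Ex (V r tx j l) - Ex (a' l))
     + C * `|Ex (V r tx j i) - Ex (a' i)| + C * enorm (Zg r (V r tx j i) - Zg r (a' i))) ->
  (forall W, admissible r C C W -> Ex (fun n s => W n s * psi n s) <= X) ->
  forall i, scheme r j.+1 i x + mu * q j.+1 i x - a i <=
    (1 + r ^+ 2 * (C * m%:R)) * X + r ^+ 2 * rho + mu * (r ^+ 2 * (qconst d C C C f0 B2 + S)).
Proof.
move=> tx q hr NrT jN hxM e0 mu0 f00 chi0 chi_edge chi_step hB hB2 hf0 ha ha' hpsi psi0 hphi hX i.
pose D i := scheme r j.+1 i x + mu * q j.+1 i x - a i.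
suff [i0 Di0 hi0] : exists2 i0, D i <= D i0 & D i0 <= (1 + r ^+ 2 * (C * m%:R)) * X + r ^+ 2 * rho +
    mu * (r ^+ 2 * (qconst d C C C f0 B2 + S)) by exact: le_trans hi0.
have stx : strip T tx := tau_strip x NrT jN.
have Qtx : cyl T M tx by [].
have [i0 i0max] : exists i0, forall l, D l <= D i0.
  by exists [arg max_(l > i) D l]%O => l; case: arg_maxP => // i0 _; exact.
exists i0 => //.
have [eqV|[l il hl]] := scheme_case NrT i0 x jN; last first.
  exfalso; have Dl := i0max l; have := scheme_obst NrT x jN il => hl'.
  have {hl hl'} hl : scheme r j.+1 i0 x = scheme r j.+1 l x - g i0 l tx by apply/le_anti; rewrite hl.
  have gg := g_ge0 il stx.
  (* Along the switch the half-squares differ by [g * (c - g / 2 + B)], which is at least [g]; the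
     potentials then add the margin [e]. *)
  have hq : e <= q j.+1 l x - q j.+1 i0 x.
    rewrite /q hl; have := chi_edge _ _ _ il Qtx; rewrite -/tx; have := hB _ _ il.
    set c := scheme r j.+1 l x; set gil := g i0 l tx in gg *.
    move=> h1 h2; have : gil * 1 <= gil * (c - gil / 2 + B) by rewrite ler_wpM2l.
    by rewrite mulr1; lra.
  have h1 := ler_wpM2l (ltW mu0) hq; have h2 := ha _ _ il.
  have h3 : 0 < mu * (e / 2) by rewrite mulr_gt0 // divr_gt0.
  by move: Dl; rewrite leNgt /D hl => /negP; apply; lra.
pose q' l n s := q j l (nxt b sigma r tx n s).2.
have q'0 l n s : 0 <= q' l n s.
  by rewrite /q' /q subr_ge0 (le_trans (chi0 _ _)) // divr_ge0 // sqr_ge0.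
have [W hW hle] := @one_step_bound r mu (V r tx j) a' q' psi i0 (scheme r j.+1 i0 x) (a i0)
   (f i0 tx (\col_l Ex (V r tx j l)) (Zg r (V r tx j i0))) (pha i0) rho X hr (ltW mu0) q'0 psi0 hpsi hX
   (eq_ind_r (fun z => z <= _) (lexx _) eqV) (ha' i0) (hphi i0).
have hphi2 : `|f i0 tx (\col_l Ex (V r tx j l)) (Zg r (V r tx j i0))| <= f0 + C * enorm (Zg r (V r tx j i0)).
  rewrite -[f i0 tx _ _](subrK (f i0 tx (\col_l Ex (V r tx j l)) 0)) addrC.
  rewrite (le_trans (ler_normD _ _)) // lerD //.
  rewrite (le_trans (f_lip _ _ _ _ _ stx)) // ler_wpM2l // subr0.
  by rewrite big1 ?add0r // => l _; rewrite subrr normr0.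
have [r01 hrC hrC2] := hr.
have sq := square_step d_gt0 r01 C_ge0 C_ge0 C_ge0 f00 hrC hrC2 hW hphi2 (hB2 i0).
have chi1 := chi_step i0 _ _ _ hr hW Qtx.
(* Without a switch the perturbation grows by [O(r ^ 2)] only: the square by [square_step], and
   [- chi] because [chi] is semiconcave. *)
have hq : q j.+1 i0 x - Ex (fun n s => W n s * q' i0 n s) <= r ^+ 2 * (qconst d C C C f0 B2 + S).
  have -> : Ex (fun n s => W n s * q' i0 n s) =
     Ex (fun n s => W n s * ((V r tx j i0 n s + B) ^+ 2 / 2)) -
     Ex (fun n s => W n s * chi i0 (nxt b sigma r tx n s)).
    rewrite -ExB; congr Ex; apply/funext => n; apply/funext => s.
    by rewrite -mulrBr /q' /q /nxt /= tauS.
  rewrite /q eqV continuationE -/tx; lra.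
have := ler_wpM2l (ltW mu0) hq; rewrite /D; lra.
Qed.

(** * Two walks with the same noise, and the constants of the doubling *)

Hypothesis b_lip : forall t x y, 0 <= t <= T -> sqn (b (t, x) - b (t, y)) <= ka * sqn (x - y).
Hypothesis sigma_lip : forall t x y l, 0 <= t <= T ->
  sqn (Num.sqrt d%:R *: col l (sigma (t, x)) - Num.sqrt d%:R *: col l (sigma (t, y)))
    <= ka * sqn (x - y).
Hypothesis f_ucont : forall i,
  ucont_on T (fun tx (yz : 'cV[R]_m * 'cV[R]_d) => f i tx yz.1 yz.2).
Hypothesis g_ucont : forall i j, i != j -> ucont_on T (fun tx (_ : unit) => g i j tx).
Hypothesis h_ucont : forall i, ucont_on T (fun tx (_ : unit) => h i tx.2).
Hypothesis g_noloop : forall tx, strip T tx -> forall N s, simple_loop N s ->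
  0 < loop_cost (fun i j => g i j tx) N s.

(** Both positions move along the same column with the same sign, so the jump of the difference is
    proportional to [|x - y|] and no additive term appears. *)
Lemma diff_step r W t x y : small d C r -> admissible r C C W -> 0 <= t <= T ->
  Ex (fun l s => W l s * sqn ((nxt b sigma r (t, x) l s).2 - (nxt b sigma r (t, y) l s).2)) <=
  (1 + r ^+ 2 * rate (1 + 5 * ka)) * sqn (x - y).
Proof.
move=> [/andP[r0 r1] hr _] hW ht; have r01 : 0 <= r <= 1 by rewrite (ltW r0).
have r5 : 0 <= 1 + 5 * ka by rewrite addr_ge0 // mulr_ge0.
apply: Ex_nice => //.
have := @nice_quad R d k r ka (sqn (x - y)) (x - y) (b (t, x) - b (t, y))
  (fun l => Num.sqrt d%:R *: col l (sigma (t, x)) - Num.sqrt d%:R *: col l (sigma (t, y)))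
  r01 ka_ge0 (lexx _) (b_lip x y ht) (fun l => sigma_lip x y l ht).
congr nice; apply/funext => l; apply/funext => s.
rewrite subrr add0r; congr sqn; apply/matrixP => i j; rewrite !mxE /=; ring.
Qed.

Local Notation rho y := (1 + sqn y).

Definition growth_bound := A0 * expR (growth_rate * T).

Lemma growth_bound_ge0 : 0 <= growth_bound.
Proof. by rewrite mulr_ge0 // expR_ge0. Qed.

Lemma rho_ge1 (y : 'cV[R]_k) n : 1 <= rho y ^+ n.
Proof. by rewrite exprn_ege1 // lerDl sqn_ge0. Qed.

Lemma rho_ge0 (y : 'cV[R]_k) n : 0 <= rho y ^+ n.
Proof. exact: le_trans ler01 (rho_ge1 y n). Qed.

Lemma scheme_bound r N j i x : small d C r -> N%:R * r ^+ 2 = T -> (j <= N)%N ->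
  `|scheme r j i x| <= growth_bound * rho x ^+ p.
Proof.
move=> hr NrT jN; apply: le_trans (scheme_growth i x hr NrT jN) _.
rewrite ler_wpM2r ?rho_ge0 // ler_wpM2l //.
by have /andP[] := exp_rate_le growth_rate_ge0 NrT jN.
Qed.

(** Dominates the rates of both parts of the penalty. The power [2 * p + 1] is one more than the
    growth [2 * p] of the squared solution; the extra factor confines maxima to a ball. *)
Definition kappa := rho_rate (2 * p).+1 + rate (1 + 5 * ka).
Definition lambda := C * m%:R + kappa + C * m%:R * kappa + 1.

Lemma kappa_ge0 : 0 <= kappa.
Proof.
have r5 : 0 <= 1 + 5 * ka by rewrite addr_ge0 // mulr_ge0.
exact: addr_ge0 (rho_rate_ge0 _) (rate_ge0 r5).
Qed.

Lemma C_le_kappa : C <= kappa.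
Proof.
have r5 : 0 <= 1 + 5 * ka by rewrite addr_ge0 // mulr_ge0.
have h1 : 0 <= C * (1 + 5 * ka) by rewrite mulr_ge0.
have h2 : 0 <= C * Num.sqrt d%:R * (1 + 5 * ka) by rewrite !mulr_ge0 ?sqrtr_ge0.
have := rho_rate_ge0 (2 * p).+1; rewrite /kappa /rate; lra.
Qed.

Lemma lambda_ge0 : 0 <= lambda.
Proof.
have := kappa_ge0; rewrite /lambda; move: kappa => x x0.
by rewrite !addr_ge0 ?mulr_ge0.
Qed.

Let perturbation_le (A v w X Y B mu c0 ch : R) : 0 <= A -> 1 <= X -> 1 <= Y ->
  0 <= mu <= 1 -> mu * B ^+ 2 <= 1 -> mu * c0 <= 1 -> - c0 <= ch ->
  `|w| <= A * Y -> `|v| <= A * X ->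
  v + mu * ((v + B) ^+ 2 / 2 - ch) - w <= (A + A ^+ 2 + 2) * (X ^+ 2 + Y ^+ 2) /\
  w - v <= (A + A ^+ 2 + 2) * (X ^+ 2 + Y ^+ 2).
Proof.
move=> A_ge0 X1 Y1 /andP[mu0 mu1] muB muc hc hw hv.
have X0 : 0 <= X by lra. have Y0 : 0 <= Y by lra.
have hXX : X <= X ^+ 2 by rewrite expr2 ler_peMr.
have hYY : Y <= Y ^+ 2 by rewrite expr2 ler_peMr.
have AXX : A * X <= A * X ^+ 2 by rewrite ler_wpM2l.
have AYY : A * Y <= A * Y ^+ 2 by rewrite ler_wpM2l.
have v2 : v ^+ 2 <= A ^+ 2 * X ^+ 2.
  by rewrite -exprMn -(@real_normK _ v) ?num_real // lerXn2r ?nnegrE ?mulr_ge0.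
have AX2 : 0 <= A ^+ 2 * X ^+ 2 by rewrite mulr_ge0 // sqr_ge0.
have AY2 : 0 <= A ^+ 2 * Y ^+ 2 by rewrite mulr_ge0 // sqr_ge0.
have muv : mu * v ^+ 2 <= 1 * v ^+ 2 by rewrite ler_wpM2r ?sqr_ge0.
have muvB : mu * ((v + B) ^+ 2 / 2) <= mu * (v ^+ 2 + B ^+ 2).
  by rewrite ler_wpM2l //; have := sqr_ge0 (v - B); lra.
have much : mu * - ch <= mu * c0 by rewrite ler_wpM2l //; lra.
move: hv hw; rewrite !ler_norml => /andP[hv1 hv2] /andP[hw1 hw2].
split; lra.
Qed.

(** * Equicontinuity *)

Section equicontinuity.
Variables (eps Rad e c0 S B mu rr K L : R) (chi : 'I_m -> R * 'cV[R]_k -> R).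
Let A := growth_bound.
Let A' := A + A ^+ 2 + 2.
Let E := A * (1 + rho_rate p) * Rad ^+ p.
Let B2 := E + B.
Let f0 := A0 * Rad ^+ p + C * (m%:R * E).
Hypotheses (eps0 : 0 < eps) (Rad1 : 1 <= Rad) (hRad : 2 * A' <= eps * Rad).
Hypothesis e0 : 0 < e.
Hypothesis chi_bd : forall j ty, - c0 <= chi j ty <= 0.
Hypothesis chi_edge : forall i l ty, i != l -> cyl T Rad ty ->
  chi l ty + e <= chi i ty + g i l ty.
Hypothesis chi_step : forall l r W ty, small d C r -> admissible r C C W -> cyl T Rad ty ->
  Ex (fun n s => W n s * chi l (nxt b sigma r ty n s)) <= chi l ty + r ^+ 2 * S.
Hypothesis hB : forall i l ty, i != l -> cyl T Rad ty -> A * Rad ^+ p + g i l ty + 1 <= B.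
Hypothesis B0 : 0 <= B.
Hypotheses (mu0 : 0 < mu) (mu1 : mu <= 1) (muB : mu * B ^+ 2 <= 1) (muc : mu * c0 <= 1).
Hypotheses (muq : mu * (B2 ^+ 2 + c0) <= eps)
           (muS : mu * (qconst d C C C f0 B2 + S) <= eps).
Hypothesis rr0 : 0 < rr.
Hypothesis mod_f : forall i ty ty', cyl T Rad ty -> cyl T Rad ty' -> `|ty.1 - ty'.1| < rr ->
  enorm (ty.2 - ty'.2) < rr -> forall y z, `|f i ty y z - f i ty' y z| < eps.
Hypothesis mod_g : forall i l ty ty', i != l -> cyl T Rad ty -> cyl T Rad ty' ->
  `|ty.1 - ty'.1| < rr -> enorm (ty.2 - ty'.2) < rr -> `|g i l ty - g i l ty'| < mu * (e / 2).
Hypothesis mod_h : forall i x y, enorm x <= Rad -> enorm y <= Rad ->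
  enorm (x - y) < rr -> `|h i x - h i y| < eps.
Hypotheses (K0 : 0 <= K) (hK : 2 * A' * Rad ^+ (2 * p) <= K * rr ^+ 2).
Hypotheses (L0 : 0 <= L) (hL : 2 * A' * Rad ^+ (2 * p) <= L * rr).
Hypothesis hL2 : (1 + C * m%:R) * (K * (K2 d C ka Rad * (1 + 4 * Rad ^+ 2))) + f0 + eps <= L.

Implicit Types x y : 'cV[R]_k.

(** [q] is the perturbation, weighted by [mu]; [phi] is the penalty, whose first part confines both
    points and whose second part holds them together. *)
Let q r j i x := (scheme r j i x + B) ^+ 2 / 2 - chi i (tau r j, x).
Let phi x y := eps * (rho x ^+ (2 * p).+1 + rho y ^+ (2 * p).+1) + K * sqn (x - y).

Let A_ge0 : 0 <= A := growth_bound_ge0.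
Let A'_ge0 : 0 <= A'. Proof. by rewrite !addr_ge0 ?sqr_ge0. Qed.
Let Rad0 : 0 <= Rad. Proof. exact: le_trans ler01 Rad1. Qed.
Let E0 : 0 <= E.
Proof.
apply: mulr_ge0; last exact: exprn_ge0.
exact: mulr_ge0 A_ge0 (addr_ge0 ler01 (rho_rate_ge0 p)).
Qed.
Let f00 : 0 <= f0.
Proof.
apply: addr_ge0; apply: mulr_ge0 => //; first exact: exprn_ge0.
exact: mulr_ge0.
Qed.

Let q_ge0 r j i x : 0 <= q r j i x.
Proof.
rewrite /q subr_ge0; have /andP[_ h0] := chi_bd i (tau r j, x).
by apply: le_trans h0 _; rewrite divr_ge0 // sqr_ge0.
Qed.

(** The room of [2 * eps] pays for the modulus of [f] and for the drift of the perturbation in each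
    step, and for the terminal data. *)
Let phi_ge x y : 2 * eps <= phi x y.
Proof.
have h1 : 0 <= eps * (rho x ^+ (2 * p).+1 - 1) by apply: mulr_ge0; [exact: ltW | rewrite subr_ge0 rho_ge1].
have h2 : 0 <= eps * (rho y ^+ (2 * p).+1 - 1) by apply: mulr_ge0; [exact: ltW | rewrite subr_ge0 rho_ge1].
have h3 : 0 <= K * sqn (x - y) by rewrite mulr_ge0 // sqn_ge0.
rewrite /phi; lra.
Qed.

Let phi_ge0 x y : 0 <= phi x y.
Proof. by apply: le_trans (phi_ge x y); rewrite mulr_ge0 // ltW. Qed.

Let phiC x y : phi x y = phi y x.
Proof. by rewrite /phi -(opprB y x) sqnN [rho x ^+ _ + _]addrC. Qed.

Let rho_ball x : rho x <= Rad -> enorm x <= Rad.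
Proof.
move=> hx; rewrite -(@ler_pXn2r _ 2) ?nnegrE ?enorm_ge0 // enorm_sq.
have : Rad * 1 <= Rad * Rad by rewrite ler_wpM2l.
rewrite -expr2; lra.
Qed.

Let rhop_le x n : rho x <= Rad -> rho x ^+ n <= Rad ^+ n.
Proof. by move=> hx; rewrite lerXn2r ?nnegrE // addr_ge0 // sqn_ge0. Qed.

Let crude r N j j' i x y : small d C r -> N%:R * r ^+ 2 = T -> (j <= N)%N -> (j' <= N)%N ->
  scheme r j i x + mu * q r j i x - scheme r j' i y <=
    A' * (rho x ^+ (2 * p) + rho y ^+ (2 * p)) /\
  scheme r j' i y - scheme r j i x <= A' * (rho x ^+ (2 * p) + rho y ^+ (2 * p)).
Proof.
move=> hr NrT jN j'N.
have := scheme_bound i x hr NrT jN; have := scheme_bound i y hr NrT j'N.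
have X1 := rho_ge1 x p; have Y1 := rho_ge1 y p.
have /andP[hc _] := chi_bd i (tau r j, x).
rewrite -/A (mulnC 2%N p) !exprM /q.
move=> hw hv; apply: (perturbation_le (c0 := c0)) => //.
by rewrite (ltW mu0).
Qed.

(** Away from the regime of bounded and close points and times, the a priori growth already gives
    the bound. Large points are covered by the extra power in [phi], distant ones by [K * rr ^ 2],
    distant times by [L * rr]. *)
Let localize D x y tt Lm : 1 <= Lm -> 0 <= tt ->
  D <= A' * (rho x ^+ (2 * p) + rho y ^+ (2 * p)) ->
  (rho x <= Rad -> rho y <= Rad -> enorm (x - y) < rr -> tt < rr ->
     D <= Lm * (phi x y + L * tt)) ->
  D <= Lm * (phi x y + L * tt).
Proof.
move=> Lm1 tt0 hD hnear.
have Ltt : 0 <= L * tt by rewrite mulr_ge0.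
have up : phi x y + L * tt <= Lm * (phi x y + L * tt) by rewrite ler_peMl // addr_ge0.
have eX : 0 <= eps * rho x ^+ (2 * p).+1 by rewrite mulr_ge0 ?rho_ge0 // ltW.
have eY : 0 <= eps * rho y ^+ (2 * p).+1 by rewrite mulr_ge0 ?rho_ge0 // ltW.
have Ks : 0 <= K * sqn (x - y) by rewrite mulr_ge0 // sqn_ge0.
have far (z z' : 'cV[R]_k) : Rad < rho z -> rho z' <= rho z ->
   A' * (rho z ^+ (2 * p) + rho z' ^+ (2 * p)) <= eps * rho z ^+ (2 * p).+1.
  move=> hz hz'.
  have h1 : rho z' ^+ (2 * p) <= rho z ^+ (2 * p) by rewrite lerXn2r ?nnegrE // addr_ge0 // sqn_ge0.
  apply: (@le_trans _ _ (eps * Rad * rho z ^+ (2 * p))).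
    apply: (@le_trans _ _ (2 * A' * rho z ^+ (2 * p))); last by apply: ler_wpM2r; [exact: rho_ge0 | exact: hRad].
    by have := ler_wpM2l A'_ge0 h1; lra.
  rewrite exprS -mulrA; apply: ler_wpM2l; first exact: ltW.
  by apply: ler_wpM2r; [exact: rho_ge0 | exact: ltW].
have [hx|hx] := leP (rho x) Rad; have [hy|hy] := leP (rho y) Rad.
- have cr : A' * (rho x ^+ (2 * p) + rho y ^+ (2 * p)) <= 2 * A' * Rad ^+ (2 * p).
    by have := ler_wpM2l A'_ge0 (lerD (rhop_le (2 * p) hx) (rhop_le (2 * p) hy)); lra.
  have {}cr := le_trans hD cr.
  have [hxy|hxy] := ltP (enorm (x - y)) rr; last first.
    apply: le_trans up; have : K * rr ^+ 2 <= K * sqn (x - y).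
      by rewrite ler_wpM2l // -enorm_sq lerXn2r ?nnegrE ?enorm_ge0 // ltW.
    by have := le_trans cr hK; rewrite /phi; lra.
  have [ht|ht] := ltP tt rr; first exact: hnear.
  apply: le_trans up; have : L * rr <= L * tt by rewrite ler_wpM2l.
  by have := le_trans cr hL; rewrite /phi; lra.
- apply: le_trans up; apply: le_trans hD _; rewrite addrC.
  by have := far y x hy (le_trans hx (ltW hy)); rewrite /phi; lra.
- apply: le_trans up; apply: le_trans hD _.
  by have := far x y hx (le_trans hy (ltW hx)); rewrite /phi; lra.
- apply: le_trans up; apply: le_trans hD _; have [xy|xy] := leP (rho x) (rho y).
    by rewrite addrC; have := far y x hy xy; rewrite /phi; lra.
  by have := far x y hx (ltW xy); rewrite /phi; lra.
Qed.

Let Ex_bound r N j i x : small d C r -> N%:R * r ^+ 2 = T -> (j.+1 <= N)%N -> rho x <= Rad ->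
  `|Ex (V r (tau r j.+1, x) j i)| <= E.
Proof.
move=> hr NrT jN hx; apply: le_trans (Ex_norm _) _.
have [/andP[r0 r1] _ _] := hr.
have step := rho_step p hr (@admissible1 R d r C C C_ge0 C_ge0) (tau_strip x NrT jN).
apply: (@le_trans _ _ (A * ((1 + r ^+ 2 * rho_rate p) * rho x ^+ p))).
  apply: le_trans (_ : _ <= A * Ex (fun l s => 1 * rho (nxt b sigma r (tau r j.+1, x) l s).2 ^+ p)) _.
    rewrite -ExZ; apply: Ex_le => n s; rewrite mul1r.
    exact: scheme_bound hr NrT (ltnW jN).
  by apply: ler_wpM2l => //; exact: step.
rewrite /E -mulrA ler_wpM2l // ler_pM ?rho_ge0 ?rhop_le //.
  by rewrite addr_ge0 // mulr_ge0 ?rho_rate_ge0 // sqr_ge0.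
by rewrite lerD2l ler_piMl ?rho_rate_ge0 // expr_le1 // ltW.
Qed.

Let f_bound i tx (y : 'cV[R]_m) : strip T tx -> rho tx.2 <= Rad -> (forall l, `|y l 0| <= E) ->
  `|f i tx y 0| <= f0.
Proof.
move=> stx hx hy; rewrite -(subrK (f i tx 0 0) (f i tx y 0)) addrC (le_trans (ler_normD _ _)) //.
apply: lerD.
  by rewrite (le_trans (f_growth i stx)) // ler_wpM2l // rhop_le.
rewrite (le_trans (f_lip _ _ _ _ _ stx)) // ler_wpM2l // subr0 enorm0 addr0.
have -> : m%:R * E = \sum_(l < m) E by rewrite sumr_const card_ord mulr_natl.
by apply: ler_sum => l _; rewrite !mxE subr0.
Qed.

Let AE : A * Rad ^+ p <= E.
Proof.
rewrite /E -mulrA ler_wpM2l // ler_peMl ?exprn_ge0 // lerDl.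
exact: rho_rate_ge0.
Qed.

Let phi_step r W t x y : small d C r -> admissible r C C W -> 0 <= t <= T ->
  Ex (fun l s => W l s * phi (nxt b sigma r (t, x) l s).2 (nxt b sigma r (t, y) l s).2) <=
  (1 + r ^+ 2 * kappa) * phi x y.
Proof.
move=> hr hW ht.
have h1 := @rho_step (2 * p).+1 r W (t, x) hr hW ht.
have h2 := @rho_step (2 * p).+1 r W (t, y) hr hW ht.
have h3 := diff_step x y hr hW ht.
have r5 : 0 <= 1 + 5 * ka by rewrite addr_ge0 // mulr_ge0.
have h4 : 0 <= r ^+ 2 * (rate (1 + 5 * ka) * (eps * (rho x ^+ (2 * p).+1 + rho y ^+ (2 * p).+1))).
  apply: mulr_ge0; first exact: sqr_ge0.
  apply: mulr_ge0; first exact: rate_ge0.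
  by apply: mulr_ge0; [exact: ltW | apply: addr_ge0; exact: rho_ge0].
have h5 : 0 <= r ^+ 2 * (rho_rate (2 * p).+1 * (K * sqn (x - y))).
  apply: mulr_ge0; first exact: sqr_ge0.
  apply: mulr_ge0; first exact: rho_rate_ge0.
  by apply: mulr_ge0 => //; exact: sqn_ge0.
have h6 := ler_wpM2l (ltW eps0) (lerD h1 h2); have h7 := ler_wpM2l K0 h3.
apply: le_trans (_ : _ <= eps * (Ex (fun l s => W l s * rho (nxt b sigma r (t, x) l s).2 ^+ (2 * p).+1) +
    Ex (fun l s => W l s * rho (nxt b sigma r (t, y) l s).2 ^+ (2 * p).+1)) +
   K * Ex (fun l s => W l s * sqn ((nxt b sigma r (t, x) l s).2 - (nxt b sigma r (t, y) l s).2))) _.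
  by rewrite -ExD -!ExZ -ExD; apply: Ex_le => l s; rewrite /phi le_eqVlt; apply/orP; left; apply/eqP; ring.
rewrite /phi /kappa /=; move: h6 h7 h4 h5 => /=; lra.
Qed.

(** With [y] fixed the noise no longer cancels, which leaves an additive term of order [r ^ 2] with
    a factor [K]; it will be charged to [L]. *)
Let phi_step_frozen r W t x y : small d C r -> admissible r C C W -> 0 <= t <= T ->
  rho x <= Rad -> rho y <= Rad ->
  Ex (fun l s => W l s * phi (nxt b sigma r (t, x) l s).2 y) <=
  (1 + r ^+ 2 * kappa) * phi x y + r ^+ 2 * (K * (K2 d C ka Rad * (1 + 4 * Rad ^+ 2))).
Proof.
move=> hr hW ht hx hy.
have h1 := @rho_step (2 * p).+1 r W (t, x) hr hW ht.
have /andP[_ h2] := Ex_admissible d_gt0 hW.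
have Qx : cyl T Rad (t, x) by split; [exact: ht | exact: rho_ball].
have h3 := sqn_step d_gt0 C_ge0 ka_ge0 b_growth sigma_growth y hr hW Qx.
have r5 : 0 <= 1 + 5 * ka by rewrite addr_ge0 // mulr_ge0.
have rr00 := sqr_ge0 r.
have yp : 0 <= eps * rho y ^+ (2 * p).+1 by rewrite mulr_ge0 ?rho_ge0 ?(ltW eps0).
have xp : 0 <= eps * rho x ^+ (2 * p).+1 by rewrite mulr_ge0 ?rho_ge0 ?(ltW eps0).
have h4 : 0 <= r ^+ 2 * (rate (1 + 5 * ka) * (eps * rho x ^+ (2 * p).+1)).
  by rewrite mulr_ge0 // mulr_ge0 // rate_ge0.
have h4' : r ^+ 2 * (C * (eps * rho y ^+ (2 * p).+1)) <= r ^+ 2 * (kappa * (eps * rho y ^+ (2 * p).+1)).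
  by rewrite ler_wpM2l // ler_wpM2r // C_le_kappa.
have h5 : 0 <= r ^+ 2 * (kappa * (K * sqn (x - y))).
  apply: mulr_ge0 => //; apply: mulr_ge0; first exact: kappa_ge0.
  by apply: mulr_ge0 => //; exact: sqn_ge0.
have h6 := ler_wpM2l (ltW eps0) h1; have h7 := ler_wpM2l K0 h3.
have h8 := ler_wpM2l yp h2.
have h9 : r ^+ 2 * (K * (K2 d C ka Rad * (1 + sqn (x - y)))) <=
   r ^+ 2 * (K * (K2 d C ka Rad * (1 + 4 * Rad ^+ 2))).
  rewrite ler_wpM2l // ler_wpM2l // ler_wpM2l ?K2_ge0 // lerD2l.
  have aux (z : 'cV[R]_k) : rho z <= Rad -> sqn z <= Rad ^+ 2.
    by move=> /rho_ball hz; rewrite -enorm_sq lerXn2r ?nnegrE ?enorm_ge0.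
  by have := sqnD_le x (- y); rewrite sqnN; have := aux _ hx; have := aux _ hy; lra.
apply: le_trans (_ : _ <= eps * Ex (fun l s => W l s * rho (nxt b sigma r (t, x) l s).2 ^+ (2 * p).+1) +
    eps * rho y ^+ (2 * p).+1 * Ex W +
   K * Ex (fun l s => W l s * sqn ((nxt b sigma r (t, x) l s).2 - y))) _.
  by rewrite -Ex_weight_cst -!ExZ -!ExD; apply: Ex_le => l s; rewrite /phi le_eqVlt; apply/orP; left; apply/eqP; ring.
move: h4; rewrite /phi {1}/kappa; move: h6 h7; rewrite /= /kappa in h5 h4' *; lra.
Qed.

Let Lam r j := (1 + r ^+ 2 * lambda) ^+ j.

Let Lam_ge1 r j : 1 <= Lam r j.
Proof. by rewrite exprn_ege1 // lerDl mulr_ge0 ?lambda_ge0 // sqr_ge0. Qed.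

(* [lambda] is chosen so that the factor [1 + r^2 lambda] gained by [Lam] in one
   step pays for the growth of [phi], the coupling through [f] and the errors. *)
Let absorb r j X0 err add : small d C r -> 0 <= err <= X0 -> 0 <= add -> 0 <= X0 ->
  (1 + r ^+ 2 * (C * m%:R)) * (Lam r j * ((1 + r ^+ 2 * kappa) * X0 + r ^+ 2 * add)) + r ^+ 2 * err
   <= Lam r j.+1 * X0 + Lam r j * (r ^+ 2 * ((1 + C * m%:R) * add)).
Proof.
move=> [/andP[r0 r1] _ _] /andP[err0 err1] add0 X00.
have rr00 := sqr_ge0 r; have rr1 : r ^+ 2 <= 1 by rewrite expr_le1 // ltW.
have La1 := Lam_ge1 r j; have La0 : 0 <= Lam r j by apply: le_trans La1.
have Cm0 : 0 <= C * m%:R by rewrite mulr_ge0.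
have k0 := kappa_ge0.
rewrite [Lam r j.+1]exprSr -/(Lam r j) /lambda.
move: (Lam r j) La1 La0 => La La1 La0; move: (C * m%:R) Cm0 => D D0.
move: kappa k0 => ka' k0.
have h1 : r ^+ 2 * err <= r ^+ 2 * (La * X0).
  by rewrite ler_wpM2l // (le_trans err1) // ler_peMl.
have h2 : r ^+ 2 * (r ^+ 2 * (La * (D * ka' * X0))) <= r ^+ 2 * (1 * (La * (D * ka' * X0))).
  by rewrite ler_wpM2l // ler_wpM2r // !mulr_ge0.
have h3 : r ^+ 2 * (r ^+ 2 * (La * (D * add))) <= r ^+ 2 * (1 * (La * (D * add))).
  by rewrite ler_wpM2l // ler_wpM2r // !mulr_ge0.
lra.
Qed.

Let max_sum (u v : 'I_m -> R) :
  \sum_l Num.max 0 ((\col_l u l : 'cV[R]_m) l 0 - (\col_l v l : 'cV[R]_m) l 0) =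
  \sum_l Num.max 0 (u l - v l).
Proof. by apply: eq_bigr => l _; rewrite !mxE. Qed.

(** [B] is chosen so large that the mean slope of the half-square along a switch is at least one;
    then the switch gains at least [g]. *)
Let q_margin r N j i l x : small d C r -> N%:R * r ^+ 2 = T -> (j <= N)%N -> rho x <= Rad ->
  i != l -> 1 <= scheme r j l x - g i l (tau r j, x) / 2 + B.
Proof.
move=> hr NrT jN hx il.
have stx := tau_strip x NrT jN.
have Qx : cyl T Rad (tau r j, x) by split => //; exact: rho_ball.
have h1 := hB il Qx; have h2 := g_ge0 il stx.
have h3 : growth_bound * rho x ^+ p <= A * Rad ^+ p by rewrite ler_wpM2l // rhop_le.
have := scheme_bound l x hr NrT jN; rewrite ler_norml => /andP[h4 _]; lra.
Qed.

Let ExB_bound r N j i x : small d C r -> N%:R * r ^+ 2 = T -> (j.+1 <= N)%N -> rho x <= Rad ->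
  `|Ex (V r (tau r j.+1, x) j i) + B| <= B2.
Proof.
move=> hr NrT jN hx; rewrite (le_trans (ler_normD _ _)) // (ger0_norm B0) lerD2r.
exact: Ex_bound hr NrT jN hx.
Qed.

(** Induction on the number of steps, at equal times. At the terminal time the modulus of [h] and
    the size of [mu * q] fit into the [2 * eps] contained in [phi]; afterwards [switch_step]
    compares with the scheme at [y]. *)
Lemma doubling r N j i x y : small d C r -> N%:R * r ^+ 2 = T -> (j <= N)%N ->
  scheme r j i x + mu * q r j i x - scheme r j i y <= Lam r j * phi x y.
Proof.
move=> hr NrT; elim: j i x y => [|j IH] i x y jN.
  rewrite -[phi x y]addr0 -(mulr0 L); apply: localize => //.
    by case: (crude i x y hr NrT jN jN).
  move=> hx hy hxy _; rewrite /Lam expr0 mul1r mulr0 addr0; apply: le_trans (phi_ge x y).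
  have := mod_h i (rho_ball hx) (rho_ball hy) hxy; rewrite ltr_norml => /andP[_ h1].
  have h2 : q r 0 i x <= B2 ^+ 2 + c0.
    have := scheme_bound i x hr NrT jN; rewrite /q.
    have /andP[hc _] := chi_bd i (tau r 0, x); move: (chi _ _) hc => ch hc.
    move: (scheme r 0 i x) => v hv.
    have : `|v + B| <= B2.
      rewrite (le_trans (ler_normD _ _)) // (ger0_norm B0) lerD2r (le_trans hv) //.
      by apply: le_trans AE; rewrite ler_wpM2l // rhop_le.
    move=> hv2; have : (v + B) ^+ 2 <= B2 ^+ 2.
      by rewrite -(@real_normK _ (v + B)) ?num_real // lerXn2r ?nnegrE // (le_trans (normr_ge0 _) hv2).
    by have := sqr_ge0 (v + B); lra.
  have := ler_wpM2l (ltW mu0) h2; move: muq h1 => /=; lra.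
have {}IH l x' y' := IH l x' y' (ltnW jN).
rewrite -[phi x y]addr0 -(mulr0 L); apply: localize => //.
  by case: (crude i x y hr NrT jN jN).
move=> hx hy hxy _; rewrite mulr0 addr0.
pose tx := (tau r j.+1, x); pose ty := (tau r j.+1, y).
have stx : strip T tx := tau_strip x NrT jN.
have sty : strip T ty := tau_strip y NrT jN.
have Qx : cyl T Rad tx by split => //; exact: rho_ball.
have Qy : cyl T Rad ty by split => //; exact: rho_ball.
have txy : `|tx.1 - ty.1| < rr by rewrite /tx /ty /= subrr normr0.
pose psi n s := Lam r j * phi (nxt b sigma r tx n s).2 (nxt b sigma r ty n s).2.
have La0 : 0 <= Lam r j by apply: le_trans (Lam_ge1 r j).
have psi0 n s : 0 <= psi n s by rewrite mulr_ge0.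
have hX W : admissible r C C W ->
    Ex (fun n s => W n s * psi n s) <= Lam r j * ((1 + r ^+ 2 * kappa) * phi x y + r ^+ 2 * 0).
  move=> hW; rewrite mulr0 addr0.
  apply: le_trans (ler_wpM2l La0 (@phi_step r W (tau r j.+1) x y hr hW stx)).
  by rewrite -ExZ; apply: Ex_le => n s; rewrite mulrCA.
have res := @switch_step r N j x chi e S Rad B B2 f0 mu _ eps
  (fun l => scheme r j.+1 l y)
  (fun l => f l ty (\col_l Ex (V r ty j l)) (Zg r (V r ty j l))) (V r ty j) psi
  hr NrT jN (rho_ball hx) e0 mu0 f00 (fun l tz => proj2 (andP (chi_bd l tz))) chi_edge chi_step
  (fun i l il => q_margin hr NrT jN hx il) (fun i => ExB_bound i hr NrT jN hx) _ _ _ _ psi0 _ hX i.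
apply: le_trans (res _ _ _ _ _) _.
- by move=> l; apply: f_bound => // l'; rewrite mxE; exact: Ex_bound hr NrT jN hx.
(* The obstacle condition at [y], transported to [x], fails by less than [mu * (e / 2)], half of
   what the perturbation gains. *)
- move=> l l' ll'; have := scheme_obst NrT y jN ll'.
  have := mod_g ll' Qx Qy txy hxy; rewrite -/tx -/ty ltr_norml => /andP[]; lra.
- by move=> l; exact: scheme_ge.
- by move=> l n s; rewrite /psi /V; exact: IH.
- move=> l; have := f_diff l (\col_l Ex (V r tx j l)) (\col_l Ex (V r ty j l))
    (Zg r (V r tx j l)) (Zg r (V r ty j l)) stx; rewrite max_sum !mxE.
  have := mod_f l Qx Qy txy hxy (\col_l Ex (V r ty j l)) (Zg r (V r ty j l)).
  by rewrite ltr_norml => /andP[_]; lra.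
have err : 0 <= eps + eps <= phi x y by rewrite addr_ge0 ?(ltW eps0) //= (le_trans _ (phi_ge x y)) //; lra.
have := absorb j hr err (lexx 0) (phi_ge0 x y).
have : r ^+ 2 * (mu * (qconst d C C C f0 B2 + S)) <= r ^+ 2 * eps by rewrite ler_wpM2l // sqr_ge0.
by rewrite !(mulr0, addr0); lra.
Qed.

(** For comparing the scheme with its value frozen at time [tau r j0] and point [y]: the term in [L]
    grows by [L * r ^ 2] per step. *)
Let frozen_bound := fun r j0 j x y => Lam r j * (phi x y + L * (tau r j0 - tau r j)).

Let tau_diff r j0 n : tau r j0 - tau r (j0 + n) = n%:R * r ^+ 2.
Proof. by rewrite /tau natrD; ring. Qed.

Let tau_diffS r j0 n : tau r j0 - tau r (j0 + n.+1) = (tau r j0 - tau r (j0 + n)) + r ^+ 2.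
Proof. by rewrite !tau_diff -natr1; ring. Qed.

Let frozen_step r j0 n x y W : small d C r -> admissible r C C W ->
  strip T (tau r (j0 + n).+1, x) -> rho x <= Rad -> rho y <= Rad ->
  Ex (fun l s => W l s * frozen_bound r j0 (j0 + n) (nxt b sigma r (tau r (j0 + n).+1, x) l s).2 y) <=
  Lam r (j0 + n) * ((1 + r ^+ 2 * kappa) * (phi x y + L * (tau r j0 - tau r (j0 + n))) +
    r ^+ 2 * (K * (K2 d C ka Rad * (1 + 4 * Rad ^+ 2)))).
Proof.
move=> hr hW stx hx hy.
have La0 : 0 <= Lam r (j0 + n) by apply: le_trans (Lam_ge1 _ _).
have h1 := phi_step_frozen hr hW stx hx hy.
have /andP[_ h2] := Ex_admissible d_gt0 hW.
have t0 : 0 <= L * (tau r j0 - tau r (j0 + n)).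
  by rewrite mulr_ge0 // tau_diff mulr_ge0 // sqr_ge0.
apply: le_trans (_ : _ <= Lam r (j0 + n) *
  (Ex (fun l s => W l s * phi (nxt b sigma r (tau r (j0 + n).+1, x) l s).2 y) +
   (L * (tau r j0 - tau r (j0 + n))) * Ex W)) _.
  rewrite -Ex_weight_cst -ExD -ExZ; apply: Ex_le => l s.
  by rewrite /frozen_bound le_eqVlt; apply/orP; left; apply/eqP; ring.
rewrite ler_wpM2l //.
have h3 := ler_wpM2l t0 h2.
have h4 : r ^+ 2 * (C * (L * (tau r j0 - tau r (j0 + n)))) <=
    r ^+ 2 * (kappa * (L * (tau r j0 - tau r (j0 + n)))).
  by rewrite ler_wpM2l ?sqr_ge0 // ler_wpM2r // C_le_kappa.
move: (phi x y) (Ex _) h1 => ph Eph h1; lra.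
Qed.

Let frozen_absorb r j0 n x y err : small d C r -> 0 <= err <= f0 + eps ->
  (1 + r ^+ 2 * (C * m%:R)) *
    (Lam r (j0 + n) * ((1 + r ^+ 2 * kappa) * (phi x y + L * (tau r j0 - tau r (j0 + n))) +
    r ^+ 2 * (K * (K2 d C ka Rad * (1 + 4 * Rad ^+ 2))))) + r ^+ 2 * err <=
  Lam r (j0 + n).+1 * (phi x y + L * (tau r j0 - tau r (j0 + n.+1))).
Proof.
move=> hr /andP[err0 err1].
have t0 : 0 <= L * (tau r j0 - tau r (j0 + n)).
  by rewrite mulr_ge0 // tau_diff mulr_ge0 // sqr_ge0.
have X00 : 0 <= phi x y + L * (tau r j0 - tau r (j0 + n)) by rewrite addr_ge0.
have add0 : 0 <= K * (K2 d C ka Rad * (1 + 4 * Rad ^+ 2)).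
  apply: mulr_ge0 => //; apply: mulr_ge0; first exact: K2_ge0.
  by rewrite addr_ge0 // mulr_ge0 // sqr_ge0.
have a := @absorb r (j0 + n) _ 0 _ hr _ add0 X00.
rewrite tau_diffS.
have {}a := a (introT andP (conj (lexx 0) X00)).
rewrite mulr0 addr0 in a.
have La1 := Lam_ge1 r (j0 + n).
have La2 : Lam r (j0 + n) <= Lam r (j0 + n).+1.
  rewrite [Lam r (j0 + n).+1]exprSr ler_peMr ?(le_trans ler01 La1) // lerDl.
  by rewrite mulr_ge0 ?lambda_ge0 // sqr_ge0.
have rr00 := sqr_ge0 r.
have hL3 := hL2; set k2 := K * _ in add0 hL3 a *.
have h1 : Lam r (j0 + n) * (r ^+ 2 * ((1 + C * m%:R) * k2)) <=
   Lam r (j0 + n).+1 * (r ^+ 2 * ((1 + C * m%:R) * k2)).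
  by rewrite ler_wpM2r // mulr_ge0 // mulr_ge0 // addr_ge0 // mulr_ge0.
have h2 : r ^+ 2 * err <= Lam r (j0 + n).+1 * (r ^+ 2 * (f0 + eps)).
  apply: (@le_trans _ _ (1 * (r ^+ 2 * (f0 + eps)))); first by rewrite mul1r ler_wpM2l.
  by rewrite ler_wpM2r ?(le_trans La1) // mulr_ge0 // addr_ge0 // ltW.
have h3 : Lam r (j0 + n).+1 * (r ^+ 2 * ((1 + C * m%:R) * k2 + f0 + eps)) <=
   Lam r (j0 + n).+1 * (r ^+ 2 * L).
  rewrite ler_wpM2l ?(le_trans ler01 (Lam_ge1 _ _)) // ler_wpM2l //.
lra.
Qed.

Lemma frozen_upper r N j0 n i x y : small d C r -> N%:R * r ^+ 2 = T -> (j0 + n <= N)%N ->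
  rho y <= Rad ->
  scheme r (j0 + n) i x + mu * q r (j0 + n) i x - scheme r j0 i y <= frozen_bound r j0 (j0 + n) x y.
Proof.
move=> hr NrT jN hy; elim: n i x jN => [|n IH] i x.
  rewrite /frozen_bound addn0 subrr mulr0 addr0 => j0N.
  exact: doubling i x y hr NrT j0N.
rewrite addnS => jN; have j0N : (j0 <= N)%N by rewrite (leq_trans _ (ltnW jN)) // leq_addr.
have {}IH l x' := IH l x' (ltnW jN).
rewrite /frozen_bound; apply: localize => //.
- by rewrite -addnS tau_diff mulr_ge0 // sqr_ge0.
- by case: (crude i x y hr NrT jN j0N).
move=> hx _ hxy ht; rewrite -addnS in ht *; rewrite addnS.
pose tx := (tau r (j0 + n).+1, x); pose ty := (tau r j0, y).
have stx : strip T tx := tau_strip x NrT jN.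
have sty : strip T ty := tau_strip y NrT j0N.
have Qx : cyl T Rad tx by split => //; exact: rho_ball.
have Qy : cyl T Rad ty by split => //; exact: rho_ball.
have txy : `|tx.1 - ty.1| < rr.
  rewrite distrC ger0_norm /tx /ty /= -?addnS //.
  by rewrite tau_diff mulr_ge0 // sqr_ge0.
pose psi l s := frozen_bound r j0 (j0 + n) (nxt b sigma r tx l s).2 y.
have psi0 l s : 0 <= psi l s.
  rewrite mulr_ge0 ?(le_trans ler01 (Lam_ge1 _ _)) // addr_ge0 // mulr_ge0 //.
  by rewrite tau_diff mulr_ge0 // sqr_ge0.
have res := @switch_step r N (j0 + n) x chi e S Rad B B2 f0 mu _ f0
  (fun l => scheme r j0 l y) (fun _ => 0) (fun l _ _ => scheme r j0 l y) psi
  hr NrT jN (rho_ball hx) e0 mu0 f00 (fun l tz => proj2 (andP (chi_bd l tz))) chi_edge chi_step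
  (fun i l il => q_margin hr NrT jN hx il) (fun i => ExB_bound i hr NrT jN hx) _ _ _ _ psi0 _
  (fun W hW => frozen_step hr hW stx hx hy) i.
have yE l : `|scheme r j0 l y| <= E.
  rewrite (le_trans (scheme_bound l y hr NrT j0N)) // (le_trans _ AE) //.
  by rewrite ler_wpM2l // rhop_le.
apply: le_trans (res _ _ _ _ _) _.
- by move=> l; apply: f_bound => // l'; rewrite mxE; exact: Ex_bound hr NrT jN hx.
- move=> l l' ll'; have := scheme_obst NrT y j0N ll'.
  have := mod_g ll' Qx Qy txy hxy; rewrite -/tx -/ty ltr_norml => /andP[]; lra.
- by move=> l; rewrite mulr0 addr0 Ex_cst.
- by move=> l n' s; rewrite /psi /V; exact: IH.
- move=> l; have := f_diff l (\col_l Ex (V r tx (j0 + n) l)) (\col_l scheme r j0 l y)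
    (Zg r (V r tx (j0 + n) l)) 0 stx; rewrite max_sum !mxE Zg_cst Ex_cst //.
  have -> : \sum_l0 Num.max 0 (Ex (V r tx (j0 + n) l0) - Ex (fun (_ : 'I_d) _ => scheme r j0 l0 y)) =
    \sum_l0 Num.max 0 (Ex (V r tx (j0 + n) l0) - scheme r j0 l0 y).
    by apply: eq_bigr => l' _; rewrite Ex_cst.
  have : `|f l tx (\col_l0 scheme r j0 l0 y) 0| <= f0.
    by apply: f_bound => // l'; rewrite mxE.
  by rewrite ler_norml => /andP[_]; lra.
have err : 0 <= f0 + eps <= f0 + eps by rewrite addr_ge0 ?(ltW eps0) /=.
have fa := frozen_absorb j0 n x y hr err; rewrite addnS in fa; apply: le_trans fa.
have aux (u v w z : R) : v + w <= z -> u + v + w <= u + z by lra.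
by apply: aux; rewrite (mulrDr (r ^+ 2) f0) lerD2l mulrCA ler_wpM2l // sqr_ge0.
Qed.

(** From below the scheme dominates its continuation, so switching does no harm and the unperturbed
    comparison, with [mu = 0], suffices. *)
Lemma frozen_lower r N j0 n i x y : small d C r -> N%:R * r ^+ 2 = T -> (j0 + n <= N)%N ->
  rho y <= Rad ->
  scheme r j0 i y - scheme r (j0 + n) i x <= frozen_bound r j0 (j0 + n) x y.
Proof.
move=> hr NrT jN hy; elim: n i x jN => [|n IH] i x.
  rewrite /frozen_bound addn0 subrr mulr0 addr0 phiC => j0N.
  apply: le_trans (doubling i y x hr NrT j0N); rewrite lerD2r lerDl.
  by rewrite mulr_ge0 // ltW.
rewrite addnS => jN; have j0N : (j0 <= N)%N by rewrite (leq_trans _ (ltnW jN)) // leq_addr.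
have {}IH l x' := IH l x' (ltnW jN).
rewrite /frozen_bound; apply: localize => //.
- by rewrite -addnS tau_diff mulr_ge0 // sqr_ge0.
- by case: (crude i x y hr NrT jN j0N).
move=> hx _ hxy ht; rewrite -addnS in ht *; rewrite addnS.
pose tx := (tau r (j0 + n).+1, x).
have stx : strip T tx := tau_strip x NrT jN.
pose psi l s := frozen_bound r j0 (j0 + n) (nxt b sigma r tx l s).2 y.
have psi0 l s : 0 <= psi l s.
  rewrite mulr_ge0 ?(le_trans ler01 (Lam_ge1 _ _)) // addr_ge0 // mulr_ge0 //.
  by rewrite tau_diff mulr_ge0 // sqr_ge0.
have yE l : `|scheme r j0 l y| <= E.
  rewrite (le_trans (scheme_bound l y hr NrT j0N)) // (le_trans _ AE) //.
  by rewrite ler_wpM2l // rhop_le.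
have [|||W _ le] := @one_step_bound r 0 (fun l _ _ => scheme r j0 l y) (V r tx (j0 + n))
  (fun _ _ _ => 0) psi i (scheme r j0 i y) (scheme r (j0 + n).+1 i x) 0
  (f i tx (\col_l Ex (V r tx (j0 + n) l)) (Zg r (V r tx (j0 + n) i))) f0 _ hr (lexx 0)
  (fun _ _ _ => lexx 0) psi0 _ (fun W hW => frozen_step hr hW stx hx hy) _ (scheme_ge r (j0 + n) i x) _.
- by move=> l n' s; rewrite mulr0 addr0; exact: IH.
- by rewrite mulr0 addr0 Ex_cst.
- have := f_diff i (\col_l scheme r j0 l y) (\col_l Ex (V r tx (j0 + n) l)) 0
    (Zg r (V r tx (j0 + n) i)) stx; rewrite max_sum !mxE Zg_cst Ex_cst //.
  have -> : \sum_l0 Num.max 0 (Ex (fun (_ : 'I_d) _ => scheme r j0 l0 y) - Ex (V r tx (j0 + n) l0)) =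
    \sum_l0 Num.max 0 (scheme r j0 l0 y - Ex (V r tx (j0 + n) l0)).
    by apply: eq_bigr => l' _; rewrite Ex_cst.
  have : `|f i tx (\col_l0 scheme r j0 l0 y) 0| <= f0.
    by apply: f_bound => // l'; rewrite mxE.
  by rewrite ler_norml => /andP[]; lra.
apply: le_trans le _; rewrite mul0r subr0.
have err : 0 <= f0 <= f0 + eps by rewrite f00 lerDl ltW.
by have fa := frozen_absorb j0 n x y hr err; rewrite addnS in fa.
Qed.
End equicontinuity.

Lemma finite_positive (I : finType) (P : I -> R -> Prop) :
  (forall i, exists2 r, 0 < r & P i r) ->
  (forall i r r', 0 < r' <= r -> P i r -> P i r') ->
  exists2 r, 0 < r & forall i, P i r.
Proof.
move=> hP mono; have /choice[r hr] : forall i, exists r, 0 < r /\ P i r.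
  by move=> i; have [r r0 Pr] := hP i; exists r.
have m0 : 0 < \big[Num.min/1]_i r i by apply: lt_bigmin => // i _; case: (hr i).
exists (\big[Num.min/1]_i r i) => // i.
by case: (hr i) => _; apply: mono; rewrite m0 /=; exact: bigmin_le_cond.
Qed.

(** The constants are fixed in the order [Rad]; then [chi] with its [e], [c0], [S]; then [B], [mu],
    [rr], [K], [L]. Each depends only on earlier ones, and [rr] follows [mu] because the modulus of
    [g] has to beat [mu * e]. *)
Lemma scheme_equicontinuous M eps : 0 < eps -> exists K L r0, [/\ 0 <= K, 0 <= L, 0 < r0 &
  forall r N j j' i x y, 0 < r <= r0 -> N%:R * r ^+ 2 = T -> (j <= N)%N -> (j' <= N)%N ->
    enorm x <= M -> enorm y <= M ->
    `|scheme r j i x - scheme r j' i y| <=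
      eps + K * sqn (x - y) + L * `|tau r j - tau r j'| ].
Proof.
move=> eps0.
pose A := growth_bound; have A_ge0 : 0 <= A := growth_bound_ge0.
pose A' := A + A ^+ 2 + 2; have A'_ge0 : 0 <= A' by rewrite !addr_ge0 ?sqr_ge0.
pose lT := expR (lambda * T).
have lT0 : 0 < lT by exact: expR_gt0.
pose RM := 1 + M ^+ 2; have RM1 : 1 <= RM by rewrite lerDl sqr_ge0.
have RM0 : 0 < RM by apply: lt_le_trans RM1.
pose Q := RM ^+ (2 * p).+1; have Q0 : 0 < Q by rewrite exprn_gt0.
(* Compensates the growth [lT] accumulated over time and the weights, at most [Q] each, of two
   points in the ball of radius [M]. *)
pose eps1 := eps / (2 * (lT * Q)).
have eps10 : 0 < eps1 by rewrite divr_gt0 // !mulr_gt0.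
have eps1E : lT * (eps1 * (Q + Q)) = eps.
  have aux (u v w : R) : 0 < u -> 0 < v -> u * (w / (2 * (u * v)) * (v + v)) = w.
    by move=> u0 v0; field; rewrite !gt_eqF.
  exact: aux.
have A'e : 0 <= 2 * A' / eps1 by apply: divr_ge0; [exact: mulr_ge0 | exact: ltW].
pose Rad := RM + 2 * A' / eps1.
have Rad1 : 1 <= Rad by rewrite (le_trans RM1) // lerDl.
have Rad0 : 0 <= Rad by rewrite (le_trans ler01).
have hRad : 2 * A' <= eps1 * Rad.
  by rewrite -ler_pdivrMl // mulrC lerDr ltW.
have [chi [e [c0 [e0 c00 chi_bd chi_edge [S S0 chi_step]]]]] :=
  strict_potentials T_gt0 d_gt0 C_ge0 ka_ge0 b_growth sigma_growth g_ucont g_ge0 g_noloop Rad0.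
have /choice[G hG] : forall il : 'I_m * 'I_m, exists G : R, 0 <= G /\
    (il.1 != il.2 -> forall ty, cyl T Rad ty -> g il.1 il.2 ty <= G).
  move=> [i l] /=; have [->|il] := eqVneq i l; first by exists 0.
  have [G G0 hG] := bounded_on_cyl Rad (g_ucont il); exists G; split=> // _ ty Qy.
  by rewrite (le_trans (ler_norm _)) // hG.
pose B := A * Rad ^+ p + \sum_il G il + 1.
have GS il : G il <= \sum_il G il.
  by rewrite (bigD1 il) //= lerDl sumr_ge0 // => q _; case: (hG q).
have GS0 : 0 <= \sum_il G il by rewrite sumr_ge0 // => q _; case: (hG q).
have B0 : 0 <= B by rewrite /B addr_ge0 // addr_ge0 // mulr_ge0 // exprn_ge0.
have hB i l ty : i != l -> cyl T Rad ty -> A * Rad ^+ p + g i l ty + 1 <= B.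
  move=> il Qy; rewrite /B lerD2r lerD2l (le_trans _ (GS (i, l))) //.
  exact: (hG (i, l)).2.
pose E := A * (1 + rho_rate p) * Rad ^+ p.
pose B2 := E + B.
pose f0 := A0 * Rad ^+ p + C * (m%:R * E).
have E0 : 0 <= E.
  apply: mulr_ge0; last exact: exprn_ge0.
  exact: mulr_ge0 A_ge0 (addr_ge0 ler01 (rho_rate_ge0 p)).
have f00 : 0 <= f0.
  apply: addr_ge0; apply: mulr_ge0 => //; first exact: exprn_ge0.
  exact: mulr_ge0.
pose q1 := (B2 ^+ 2 + c0) / eps1; pose q2 := `|qconst d C C C f0 B2 + S| / eps1.
have q10 : 0 <= q1 by rewrite divr_ge0 ?addr_ge0 ?sqr_ge0 // ltW.
have q20 : 0 <= q2 by rewrite divr_ge0 // ltW.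
(* Sum of all the quantities that [mu] has to bring below one. *)
pose D := 1 + B ^+ 2 + c0 + q1 + q2.
have B20 := sqr_ge0 B.
have D0 : 0 < D by rewrite /D; lra.
pose mu := D^-1; have mu0 : 0 < mu by rewrite invr_gt0.
have muD z : z <= D -> mu * z <= 1 by rewrite ler_pdivrMl // mulr1.
have mu1 : mu <= 1 by rewrite -[mu]mulr1; apply: muD; rewrite /D; lra.
have muB : mu * B ^+ 2 <= 1 by apply: muD; rewrite /D; lra.
have muc : mu * c0 <= 1 by apply: muD; rewrite /D; lra.
have muq : mu * (B2 ^+ 2 + c0) <= eps1.
  have : mu * q1 <= 1 by apply: muD; rewrite /D; lra.
  by rewrite /q1 mulrA ler_pdivrMr // mul1r.
have muS : mu * (qconst d C C C f0 B2 + S) <= eps1.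
  have : mu * q2 <= 1 by apply: muD; rewrite /D; lra.
  rewrite /q2 mulrA ler_pdivrMr // mul1r; apply: le_trans.
  by rewrite ler_wpM2l ?(ltW mu0) // ler_norm.
have me0 : 0 < mu * (e / 2) by rewrite mulr_gt0 // divr_gt0.
have [rf rf0 mod_f] := @finite_positive 'I_m (fun i r => forall ty ty', cyl T Rad ty ->
    cyl T Rad ty' -> `|ty.1 - ty'.1| < r -> enorm (ty.2 - ty'.2) < r ->
    forall y z, `|f i ty y z - f i ty' y z| < eps1)
  (fun i => let: ex_intro2 r r0 h := heine_cantor Rad (f_ucont i) eps10 in
     ex_intro2 _ _ r r0 (fun ty ty' h1 h2 h3 h4 y z => h ty ty' h1 h2 h3 h4 (y, z)))
  (fun i r r' hr h ty ty' h1 h2 h3 h4 => h ty ty' h1 h2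
     (lt_le_trans h3 (proj2 (andP hr))) (lt_le_trans h4 (proj2 (andP hr)))).
have [rh rh0 mod_h] := @finite_positive 'I_m (fun i r => forall x y, enorm x <= Rad ->
    enorm y <= Rad -> enorm (x - y) < r -> `|h i x - h i y| < eps1)
  (fun i => let: ex_intro2 r r0 h' := heine_cantor Rad (h_ucont i) eps10 in
     ex_intro2 _ _ r r0 (fun x y h1 h2 h3 => h' (T, x) (T, y)
       (conj (introT andP (conj (ltW T_gt0) (lexx T))) h1)
       (conj (introT andP (conj (ltW T_gt0) (lexx T))) h2)
       (eq_ind_r (fun z => `|z| < r) (eq_ind_r (fun z => z < r) r0 (normr0 _)) (subrr T)) h3 tt))
  (fun i r r' hr h' x y h1 h2 h3 => h' x y h1 h2 (lt_le_trans h3 (proj2 (andP hr)))).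
have [rg rg0 mod_g] := @finite_positive ('I_m * 'I_m)%type (fun il r => il.1 != il.2 ->
    forall ty ty', cyl T Rad ty -> cyl T Rad ty' -> `|ty.1 - ty'.1| < r ->
    enorm (ty.2 - ty'.2) < r -> `|g il.1 il.2 ty - g il.1 il.2 ty'| < mu * (e / 2))
  (fun il => match boolP (il.1 != il.2) with
     | AltTrue hil => let: ex_intro2 r r0 h' := heine_cantor Rad (g_ucont hil) me0 in
        ex_intro2 _ _ r r0 (fun _ ty ty' h1 h2 h3 h4 => h' ty ty' h1 h2 h3 h4 tt)
     | AltFalse hil => ex_intro2 _ _ 1 ltr01 (fun hil' => False_ind _ (negP hil hil'))
     end)
  (fun il r r' hr h' hil ty ty' h1 h2 h3 h4 => h' hil ty ty' h1 h2
     (lt_le_trans h3 (proj2 (andP hr))) (lt_le_trans h4 (proj2 (andP hr)))).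
pose rr := Num.min rf (Num.min rh rg).
have rr0 : 0 < rr by rewrite !lt_min rf0 rh0 rg0.
have rrf : rr <= rf by rewrite ge_min lexx.
have rrh : rr <= rh by rewrite !ge_min lexx orbT.
have rrg : rr <= rg by rewrite !ge_min lexx !orbT.
have Cr0 : 0 <= 2 * A' * Rad ^+ (2 * p) by rewrite !mulr_ge0 // exprn_ge0.
pose K := 2 * A' * Rad ^+ (2 * p) / rr ^+ 2.
have K0 : 0 <= K by rewrite divr_ge0 // sqr_ge0.
have hK : 2 * A' * Rad ^+ (2 * p) <= K * rr ^+ 2 by rewrite divfK // gt_eqF // exprn_gt0.
pose L1 := (1 + C * m%:R) * (K * (K2 d C ka Rad * (1 + 4 * Rad ^+ 2))) + f0 + eps1.
have L10 : 0 <= L1.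
  apply: addr_ge0; last exact: ltW.
  apply: addr_ge0 => //; apply: mulr_ge0; first by rewrite addr_ge0 // mulr_ge0.
  apply: mulr_ge0 => //; apply: mulr_ge0; first exact: K2_ge0.
  by rewrite addr_ge0 // mulr_ge0 // sqr_ge0.
have CrL : 0 <= 2 * A' * Rad ^+ (2 * p) / rr by rewrite divr_ge0 // ltW.
pose L := 2 * A' * Rad ^+ (2 * p) / rr + L1.
have L0 : 0 <= L by rewrite addr_ge0.
have hL : 2 * A' * Rad ^+ (2 * p) <= L * rr.
  have -> : L * rr = 2 * A' * Rad ^+ (2 * p) / rr * rr + L1 * rr by exact: mulrDl.
  by rewrite divfK ?gt_eqF // lerDl mulr_ge0 // ltW.
have hL2 : L1 <= L by rewrite lerDr.
have [r0 r00 hr0] := small_exists d C_ge0.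
have mod_f' i ty ty' h1 h2 h3 h4 := mod_f i ty ty' h1 h2 (lt_le_trans h3 rrf) (lt_le_trans h4 rrf).
have mod_h' i x y h1 h2 h3 := mod_h i x y h1 h2 (lt_le_trans h3 rrh).
have mod_g' i l ty ty' hil h1 h2 h3 h4 := mod_g (i, l) hil ty ty' h1 h2 (lt_le_trans h3 rrg) (lt_le_trans h4 rrg).
have FU := @frozen_upper eps1 Rad e c0 S B mu rr K L chi eps10 Rad1 hRad e0 chi_bd chi_edge
  chi_step hB B0 mu0 mu1 muB muc muq muS rr0 mod_f' mod_g' mod_h' K0 hK L0 hL hL2.
have FL := @frozen_lower eps1 Rad e c0 S B mu rr K L chi eps10 Rad1 hRad e0 chi_bd chi_edge
  chi_step hB B0 mu0 mu1 muB muc muq muS rr0 mod_f' mod_g' mod_h' K0 hK L0 hL hL2.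
exists (lT * K), (lT * L), r0; split=> //; [by rewrite mulr_ge0 // ltW| by rewrite mulr_ge0 // ltW|].
have rhoM (x : 'cV[R]_k) : enorm x <= M -> rho x <= RM.
  by move=> hx; rewrite lerD2l -enorm_sq lerXn2r ?nnegrE ?enorm_ge0 // (le_trans (enorm_ge0 x)).
have one_side r N j j' i x y : 0 < r <= r0 -> N%:R * r ^+ 2 = T -> (j <= j')%N -> (j' <= N)%N ->
    enorm x <= M -> enorm y <= M ->
    `|scheme r j' i x - scheme r j i y| <=
      eps + lT * K * sqn (x - y) + lT * L * `|tau r j' - tau r j|.
  move=> hr NrT jj' j'N hx hy; have hs := hr0 _ hr.
  rewrite -(subnKC jj') in j'N *; move: (j' - j)%N j'N => n jN {jj' j'}.
  have hyR : rho y <= Rad by rewrite (le_trans (rhoM _ hy)) // lerDl.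
  have h1 := FU _ _ _ _ i x y hs NrT jN hyR; have h2 := FL _ _ _ _ i x y hs NrT jN hyR.
  have /andP[La1 La2] := exp_rate_le lambda_ge0 NrT jN.
  set t := tau r j - tau r (j + n) in h1 h2.
  have tE : t = n%:R * r ^+ 2 by rewrite /t /tau natrD; ring.
  have t0 : 0 <= t by rewrite tE mulr_ge0 // sqr_ge0.
  rewrite distrC [`|tau _ _ - _|]distrC -/t (ger0_norm t0).
  set X := _ + L * t in h1 h2.
  have X0 : 0 <= X.
    apply: addr_ge0; last exact: mulr_ge0.
    apply: addr_ge0; last by apply: mulr_ge0 => //; exact: sqn_ge0.
    by apply: mulr_ge0; [exact: ltW | apply: addr_ge0; exact: rho_ge0].
  have hX : (1 + r ^+ 2 * lambda) ^+ (j + n) * X <= eps + lT * K * sqn (x - y) + lT * L * t.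
    apply: (@le_trans _ _ (lT * X)); first by rewrite ler_wpM2r.
    have hQ (z : 'cV[R]_k) : enorm z <= M -> rho z ^+ (2 * p).+1 <= Q.
      by move=> /rhoM hz; rewrite lerXn2r ?nnegrE ?(ltW RM0) // addr_ge0 // sqn_ge0.
    have h3 : lT * (eps1 * (rho x ^+ (2 * p).+1 + rho y ^+ (2 * p).+1)) <= eps.
      by rewrite -eps1E ler_pM2l // ler_pM2l // lerD ?hQ.
    by rewrite /X; move: h3; lra.
  have q0 : 0 <= mu * ((scheme r (j + n) i x + B) ^+ 2 / 2 - chi i (tau r (j + n), x)).
    rewrite mulr_ge0 ?(ltW mu0) // subr_ge0; have /andP[_ hc] := chi_bd i (tau r (j + n), x).
    by rewrite (le_trans hc) // divr_ge0 // sqr_ge0.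
  by rewrite ler_norml; apply/andP; split; lra.
move=> r N j j' i x y hr NrT jN j'N hx hy; have [jj'|jj'] := leqP j' j.
  exact: one_side hr NrT jj' jN hx hy.
rewrite distrC [`|tau _ _ - _|]distrC -(opprB y x) sqnN.
exact: one_side hr NrT (ltnW jj') j'N hy hx.
Qed.

(** * The limit is a viscosity solution *)

Section limit.
Variables (U : set_system nat) (n0 : nat).
Hypotheses (UU : UltraFilter U) (Uoo : forall n, U [set l | (n <= l)%N]).

(** The successor avoids division by zero, and the shift [n0] makes the step size small for every
    [n], not just eventually. *)
Definition steps (n : nat) := (n + n0).+1.
Definition rn n := Num.sqrt (T / (steps n)%:R).
(** Rounding the number of backward steps down gives a grid time at or just after [t], and index [0]
    exactly when [t = T]. *)
Definition jn n t := Num.truncn ((T - t) / rn n ^+ 2).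

Hypothesis rn_small : forall n, small d C (rn n).

Lemma rn_gt0 n : 0 < rn n. Proof. by rewrite sqrtr_gt0 divr_gt0. Qed.

Lemma rn_sq n : rn n ^+ 2 = T / (steps n)%:R.
Proof. by rewrite sqr_sqrtr // divr_ge0 // ltW. Qed.

Lemma steps_rn n : (steps n)%:R * rn n ^+ 2 = T.
Proof. by rewrite rn_sq mulrCA divff ?mulr1 // pnatr_eq0. Qed.

Lemma rn_lim : ulim_to U rn 0.
Proof.
apply: (ulim_near UU Uoo) => e e0.
have e20 : 0 < e ^+ 2 by rewrite exprn_gt0.
exists (Num.truncn (T / e ^+ 2)) => n hn; rewrite subr0 gtr0_norm ?rn_gt0 //.
rewrite -(@ltr_pXn2r _ 2) ?nnegrE ?(ltW (rn_gt0 _)) ?(ltW e0) // rn_sq.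
rewrite ltr_pdivrMr // mulrC -ltr_pdivrMr //.
apply: lt_le_trans (truncnS_gt _) _; rewrite ler_nat ltnS.
by rewrite (leq_trans hn) // leq_addr.
Qed.

Lemma jn_le n t : 0 <= t <= T -> (jn n t <= steps n)%N.
Proof.
move=> /andP[t0 tT]; rewrite -(ler_nat R).
have x0 : 0 <= (T - t) / rn n ^+ 2 by rewrite divr_ge0 ?subr_ge0 // sqr_ge0.
apply: (@le_trans _ _ ((T - t) / rn n ^+ 2)); first by rewrite truncn_le.
by rewrite ler_pdivrMr ?exprn_gt0 ?rn_gt0 // steps_rn; lra.
Qed.

Lemma jn_tau n t : 0 <= t <= T -> t <= tau (rn n) (jn n t) < t + rn n ^+ 2.
Proof.
move=> /andP[t0 tT]; have r0 : 0 < rn n ^+ 2 by rewrite exprn_gt0 // rn_gt0.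
have x0 : 0 <= (T - t) / rn n ^+ 2 by rewrite divr_ge0 ?subr_ge0 // ltW.
have /andP[h1 h2] := truncn_itv x0.
rewrite -/(jn n t) ler_pdivlMr // in h1; rewrite -/(jn n t) ltr_pdivrMr // -natr1 in h2.
by rewrite /tau; apply/andP; split; lra.
Qed.

Lemma jn_tau_lim t : 0 <= t <= T -> ulim_to U (fun n => tau (rn n) (jn n t)) t.
Proof.
move=> ht e e0; have e1 : 0 < Num.min 1 e by rewrite lt_min ltr01.
apply: filterS (rn_lim e1) => n /=; rewrite subr0 (gtr0_norm (rn_gt0 n)) lt_min => /andP[r1 re].
have /andP[h1 h2] := jn_tau n ht.
have := rn_gt0 n => r0; have rr : rn n ^+ 2 <= rn n by rewrite expr2 ler_piMr // ltW.
rewrite ger0_norm ?subr_ge0 //; lra.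
Qed.

Lemma jnT n : jn n T = 0%N.
Proof. by rewrite /jn subrr mul0r truncn0. Qed.

Lemma tau_strip_n n j (x : 'cV[R]_k) : (j <= steps n)%N -> strip T (tau (rn n) j, x).
Proof. exact: tau_strip x (steps_rn n). Qed.

(** On the strip the growth bound guarantees a limit, so the default [0] can occur only outside
    it. *)
Definition vlim i (tx : R * 'cV[R]_k) : R :=
  xget 0 [set l | ulim_to U (fun n => scheme (rn n) (jn n tx.1) i tx.2) l].

Lemma vlim_spec i tx : strip T tx ->
  ulim_to U (fun n => scheme (rn n) (jn n tx.1) i tx.2) (vlim i tx) /\
  `|vlim i tx| <= growth_bound * rho tx.2 ^+ p.
Proof.
move=> stx.
have [n|l hl lM] := @ulim_exists R U UU (fun n => scheme (rn n) (jn n tx.1) i tx.2) (growth_bound * rho tx.2 ^+ p).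
  exact: scheme_bound (rn_small n) (steps_rn n) (jn_le n stx).
have e := @xgetPex _ 0 [set l | ulim_to U (fun n => scheme (rn n) (jn n tx.1) i tx.2) l] (ex_intro _ l hl).
by split => //; rewrite /vlim (ulim_uniq UU e hl).
Qed.

Lemma small_modulus K L e : 0 <= K -> 0 <= L -> 0 < e -> exists2 a : R, 0 < a <= 1 &
  forall s t : R, 0 <= s -> s < a -> `|t| < a -> K * s ^+ 2 + L * `|t| < e.
Proof.
move=> K0 L0 e0; pose D := 1 + K + L + e.
have D0 : 0 < D by rewrite /D; lra.
exists (e / D); first by rewrite divr_gt0 //= ler_pdivrMr // mul1r /D; lra.
move=> s t s0; rewrite !ltr_pdivlMr // => hs ht.
have t0 := normr_ge0 t.
have s1 : s <= 1.
  rewrite leNgt; apply/negP => s1; have : 1 * D <= s * D by rewrite ler_wpM2r // ltW.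
  by rewrite /D in hs *; lra.
have s2 : K * s ^+ 2 <= K * s by rewrite ler_wpM2l // expr2 ler_piMr.
have m0 : s * D <= e by exact: ltW.
rewrite -(@ltr_pM2r _ D) //.
have h1 : K * (s * D) <= K * e by rewrite ler_wpM2l // ltW.
have h2 : L * (`|t| * D) <= L * e by rewrite ler_wpM2l // ltW.
have h3 : K * s ^+ 2 * D <= K * s * D by rewrite ler_wpM2r // ltW.
have h4 : 0 < e * (1 + e) by rewrite mulr_gt0 //; lra.
have DE : e * D = e * (1 + K + L + e) by [].
by rewrite DE; lra.
Qed.

(** Equicontinuity turns the pointwise ultralimit into convergence along arbitrary grid sequences;
    half-relaxed limits are thereby avoided. *)
Lemma vlim_conv i (js : nat -> nat) (xs : nat -> 'cV[R]_k) tx : strip T tx ->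
  (forall n, (js n <= steps n)%N) -> ulim_to U (fun n => tau (rn n) (js n)) tx.1 ->
  ulimv_to U xs tx.2 -> ulim_to U (fun n => scheme (rn n) (js n) i (xs n)) (vlim i tx).
Proof.
move=> stx hjs ht hx e e0; have [hv _] := vlim_spec i stx.
have e4 : 0 < e / 4 by rewrite divr_gt0.
have [K [L [r0 [K0 L0 r00 eqc]]]] := scheme_equicontinuous (enorm tx.2 + 1) e4.
have [a /andP[a0 a1] ha] := small_modulus K0 L0 e4.
have a2 : 0 < a / 2 by rewrite divr_gt0.
apply: filterS2 (filterI (filterI (hv _ e4) (hx _ a0)) (filterI (ht _ a2) (jn_tau_lim stx a2)))
  (rn_lim r00) => n [[/= h1 h2] [/= h3 h4]] /=.
rewrite subr0 (gtr0_norm (rn_gt0 n)) => h5.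
have hr : 0 < rn n <= r0 by rewrite rn_gt0 ltW.
have xM : enorm (xs n) <= enorm tx.2 + 1.
  by rewrite -(subrK tx.2 (xs n)) (le_trans (enormD _ _)) //; lra.
have xM' : enorm tx.2 <= enorm tx.2 + 1 by rewrite lerDl.
have := eqc _ _ _ _ i _ _ hr (steps_rn n) (hjs n) (jn_le n stx) xM xM'.
have := ha (enorm (xs n - tx.2)) (tau (rn n) (js n) - tau (rn n) (jn n tx.1)) (enorm_ge0 _) h2.
rewrite enorm_sq.
have -> : `|tau (rn n) (js n) - tau (rn n) (jn n tx.1)| < a.
  rewrite (_ : _ - _ = (tau (rn n) (js n) - tx.1) - (tau (rn n) (jn n tx.1) - tx.1)); last by ring.
  by rewrite (le_lt_trans (ler_normB _ _)) //; lra.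
move=> /(_ isT) h6 h7.
rewrite (_ : _ - _ = (scheme (rn n) (js n) i (xs n) - scheme (rn n) (jn n tx.1) i tx.2) +
   (scheme (rn n) (jn n tx.1) i tx.2 - vlim i tx)); last by ring.
by rewrite (le_lt_trans (ler_normD _ _)) //; lra.
Qed.

Lemma vlim_ucont i : ucont_on T (fun tx (_ : unit) => vlim i tx).
Proof.
move=> tx stx e e0.
have e4 : 0 < e / 4 by rewrite divr_gt0.
have [K [L [r0 [K0 L0 r00 eqc]]]] := scheme_equicontinuous (enorm tx.2 + 1) e4.
have [a /andP[a0 a1] ha] := small_modulus K0 L0 e4.
have a2 : 0 < a / 2 by rewrite divr_gt0.
have a4 : 0 < a / 4 by rewrite divr_gt0.
exists (a / 2) => // ty sty h1 h2 _.
have [hx _] := vlim_spec i stx; have [hy _] := vlim_spec i sty.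
have [|n] := ultra_ex UU (A := [set n | [/\ rn n < r0,
    `|scheme (rn n) (jn n tx.1) i tx.2 - vlim i tx| < e / 4,
    `|scheme (rn n) (jn n ty.1) i ty.2 - vlim i ty| < e / 4,
    `|tau (rn n) (jn n tx.1) - tx.1| < a / 4 & `|tau (rn n) (jn n ty.1) - ty.1| < a / 4 ]]) _.
  apply: filterS2 (filterI (filterI (hx _ e4) (hy _ e4))
    (filterI (jn_tau_lim stx a4) (jn_tau_lim sty a4))) (rn_lim r00) => n [[/= ? ?] [/= ? ?]] /=.
  by rewrite subr0 (gtr0_norm (rn_gt0 n)) => ?; split.
move=> [hr hx' hy' tx' ty'].
have hr' : 0 < rn n <= r0 by rewrite rn_gt0 ltW.
have yM : enorm ty.2 <= enorm tx.2 + 1.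
  by rewrite -(subrK tx.2 ty.2) (le_trans (enormD _ _)) //; lra.
have xM : enorm tx.2 <= enorm tx.2 + 1 by rewrite lerDl.
have := eqc _ _ _ _ i _ _ hr' (steps_rn n) (jn_le n sty) (jn_le n stx) yM xM.
have := ha (enorm (ty.2 - tx.2)) (tau (rn n) (jn n ty.1) - tau (rn n) (jn n tx.1)) (enorm_ge0 _).
rewrite enorm_sq; have -> : enorm (ty.2 - tx.2) < a by lra.
have -> : `|tau (rn n) (jn n ty.1) - tau (rn n) (jn n tx.1)| < a.
  rewrite (_ : _ - _ = (tau (rn n) (jn n ty.1) - ty.1) - (tau (rn n) (jn n tx.1) - tx.1) + (ty.1 - tx.1)); last by ring.
  by rewrite (le_lt_trans (ler_normD _ _)) // (le_lt_trans (lerD (ler_normB _ _) (lexx _))) //; lra.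
move=> /(_ isT isT) h6 h7.
rewrite (_ : vlim i ty - vlim i tx =
   (scheme (rn n) (jn n ty.1) i ty.2 - scheme (rn n) (jn n tx.1) i tx.2) +
   (scheme (rn n) (jn n tx.1) i tx.2 - vlim i tx) - (scheme (rn n) (jn n ty.1) i ty.2 - vlim i ty)); last by ring.
by rewrite (le_lt_trans (ler_normB _ _)) // (le_lt_trans (lerD (ler_normD _ _) (lexx _))) //; lra.
Qed.

Lemma ucont_ulim (phi : R * 'cV[R]_k -> R) (txs : nat -> R * 'cV[R]_k) tx :
  ucont_on T (fun tx (_ : unit) => phi tx) -> strip T tx -> (forall n, strip T (txs n)) ->
  ulim_to U (fun n => (txs n).1) tx.1 -> ulimv_to U (fun n => (txs n).2) tx.2 ->
  ulim_to U (fun n => phi (txs n)) (phi tx).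
Proof.
move=> hphi stx stxs h1 h2 e e0; have [a a0 ha] := hphi tx stx e e0.
by apply: filterS2 (h1 _ a0) (h2 _ a0) => n /= ? ?; exact: ha.
Qed.

Lemma ulimv_cst (x : 'cV[R]_k) : ulimv_to U (fun=> x) x.
Proof. by move=> e e0; apply: filterE => n /=; rewrite subrr enorm0. Qed.

Lemma vlim_obst i l tx : strip T tx -> i != l -> vlim l tx - g i l tx <= vlim i tx.
Proof.
move=> stx il; have [hi _] := vlim_spec i stx; have [hl _] := vlim_spec l stx.
have hg := ucont_ulim (g_ucont il) stx (fun n => tau_strip_n tx.2 (jn_le n stx)) (jn_tau_lim stx) (ulimv_cst tx.2).
apply: (ulim_le UU (ulimD UU hl (ulimN UU hg)) hi).
apply: filterE => n /=; exact: (scheme_obst (steps_rn n) tx.2 (jn_le n stx) il).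
Qed.

Lemma vlimT i x : vlim i (T, x) = h i x.
Proof.
have sT : strip T ((T, x) : R * 'cV[R]_k) by rewrite /strip /= lexx ltW.
have [hv _] := vlim_spec i sT; apply: (ulim_uniq UU hv) => e e0.
by apply: filterE => n /=; rewrite jnT subrr normr0.
Qed.

Hypothesis b_ucont : forall i, ucont_on T (fun tx (_ : unit) => b tx i 0).
Hypothesis sigma_ucont : forall i l, ucont_on T (fun tx (_ : unit) => sigma tx i l).

Lemma nxt_close r tx l s : 0 < r <= 1 -> strip T tx ->
  sqn ((nxt b sigma r tx l s).2 - tx.2) <= r ^+ 2 * (4 * ka * (1 + sqn tx.2)).
Proof.
move=> /andP[r0 r1] stx; have rr1 : r ^+ 2 <= 1 by rewrite expr_le1 // ltW.
have rr00 := sqr_ge0 r.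
have -> : (nxt b sigma r tx l s).2 - tx.2 =
    r ^+ 2 *: b tx + (sg s * r) *: (Num.sqrt d%:R *: col l (sigma tx)).
  by rewrite /= addrAC [tx.2 + _ - _]addrAC subrr add0r.
apply: le_trans (sqnD_le _ _) _; rewrite (sqnZ (r ^+ 2)) (sqnZ (sg s * r)).
have -> : (sg s * r) ^+ 2 = r ^+ 2 by rewrite exprMn [sg s ^+ 2]expr2 sg_sq mul1r.
have h1 : r ^+ 2 * (r ^+ 2 * sqn (b tx)) <= r ^+ 2 * (1 * (ka * (1 + sqn tx.2))).
  by rewrite ler_wpM2l // ler_pM ?sqn_ge0 // b_growth.
have h2 := ler_wpM2l rr00 (sigma_growth stx l); rewrite [(r ^+ 2) ^+ 2]expr2; move: h1 h2.
lra.
Qed.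

(** * Testing the limit of a one-sided scheme with quadratic polynomials *)

Section test.
Variables (w : nat -> nat -> 'cV[R]_k -> R) (vv : R * 'cV[R]_k -> R).
Variables (F : nat -> nat -> 'cV[R]_k -> 'cV[R]_d -> R) (F0 : 'cV[R]_d -> R).
Variable tx0 : R * 'cV[R]_k.
Hypothesis tx0_in : 0 <= tx0.1 < T.
Hypothesis w_conv : forall js xs tx, strip T tx -> (forall n, (js n <= steps n)%N) ->
  ulim_to U (fun n => tau (rn n) (js n)) tx.1 -> ulimv_to U xs tx.2 ->
  ulim_to U (fun n => w n (js n) (xs n)) (vv tx).
Hypothesis w_bd : forall n j x, (j <= steps n)%N -> `|w n j x| <= growth_bound * rho x ^+ p.
Hypothesis F_lip : forall n j x z z', (j < steps n)%N -> `|F n j x z - F n j x z'| <= C * enorm (z - z').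
Hypothesis w_step : forall js xs, (forall n, (js n < steps n)%N) ->
  ulim_to U (fun n => tau (rn n) (js n).+1) tx0.1 -> ulimv_to U xs tx0.2 ->
  U [set n | let e := fun l s => w n (js n) (nxt b sigma (rn n) (tau (rn n) (js n).+1, xs n) l s).2 in
    w n (js n).+1 (xs n) <= Ex e + rn n ^+ 2 * F n (js n) (xs n) (Zg (rn n) e)].
Hypothesis F_conv : forall js xs zs z, (forall n, (js n < steps n)%N) ->
  ulim_to U (fun n => tau (rn n) (js n).+1) tx0.1 -> ulimv_to U xs tx0.2 -> ulimv_to U zs z ->
  ulim_to U (fun n => F n (js n) (xs n) (zs n)) (F0 z).

(* Barles and Souganidis: near-maximisers of [w - test_fun] over a small forward
   cylinder converge to [tx0]; there the scheme is compared with its value on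
   the test function, using [tilt] for the dependence on the slope. *)
Lemma viscosity_test pt q M eta r1 : M^T = M -> 0 < eta -> 0 < r1 ->
  (forall ty, strip T ty -> tx0.1 <= ty.1 -> ty.1 - tx0.1 < r1 -> enorm (ty.2 - tx0.2) < r1 ->
    vv ty <= test_fun (vv tx0) tx0.1 pt tx0.2 q M ty.1 ty.2
             - eta * ((ty.1 - tx0.1) + sqn (ty.2 - tx0.2))) ->
  0 <= pt + dotm q (b tx0) + 2^-1 * \sum_l qform M (col l (sigma tx0))
       + F0 ((sigma tx0)^T *m q).
Proof.
move=> Ms eta0 r10 hvv; have [t0 tT] := andP tx0_in.
have stx0 : strip T tx0 by rewrite /strip /= t0 ltW.
pose a := r1 / 2; have a0 : 0 < a by rewrite divr_gt0.
have ar : a < r1 by rewrite /a; lra.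
pose ph := test_fun (vv tx0) tx0.1 pt tx0.2 q M.
pose D n := [set jx : nat * 'cV[R]_k | [/\ (jx.1 <= steps n)%N,
  tx0.1 <= tau (rn n) jx.1 <= tx0.1 + a & enorm (jx.2 - tx0.2) <= a]].
pose val n (jx : nat * 'cV[R]_k) := w n jx.1 jx.2 - ph (tau (rn n) jx.1) jx.2.
(* The implication allows a dummy choice for those [n] whose cylinder misses the grid point next to
   [tx0]; they lie outside a set of the ultrafilter. *)
pose good n jx := [/\ (jx.1 <= steps n)%N, enorm (jx.2 - tx0.2) <= a &
  D n (jn n tx0.1, tx0.2) -> D n jx /\
    forall jx', D n jx' -> val n jx' <= val n jx + rn n ^+ 3].
have /choice[jx hjx] : forall n, exists jx, good n jx.
  move=> n; have [Dn|nDn] := pselect (D n (jn n tx0.1, tx0.2)); last first.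
    by exists (0%N, tx0.2); split; rewrite //= subrr enorm0 ltW.
  (* The tolerance is of smaller order than the [r ^ 2] of one step and disappears after
     division. *)
  have r30 : 0 < rn n ^+ 3 by rewrite exprn_gt0 // rn_gt0.
  pose Xa := 1 + (enorm tx0.2 + a) ^+ 2.
  pose Bd := growth_bound * Xa ^+ p + `|vv tx0| + `|pt| * a + enorm q * a +
     (\sum_i \sum_j `|M i j|) * a ^+ 2.
  have [|jx jxB|z Dz hz] := @near_sup R _ (D n) (val n) Bd (rn n ^+ 3) _ _ r30.
  - by exists (jn n tx0.1, tx0.2).
  - move: jxB => [jN /andP[h1 h2] h3]; rewrite /val /ph /test_fun.
    have xa : rho jx.2 <= Xa.
      rewrite lerD2l -enorm_sq lerXn2r ?nnegrE ?enorm_ge0 ?addr_ge0 ?enorm_ge0 ?(ltW a0) //.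
      by rewrite -(subrK tx0.2 jx.2) (le_trans (enormD _ _)) // addrC lerD2l.
    have b1 : w n jx.1 jx.2 <= growth_bound * Xa ^+ p.
      rewrite (le_trans (ler_norm _)) // (le_trans (w_bd _ jN)) // ler_wpM2l ?growth_bound_ge0 //.
      by rewrite lerXn2r ?nnegrE ?addr_ge0 ?sqn_ge0 ?sqr_ge0.
    have b2 : - vv tx0 <= `|vv tx0| by rewrite -normrN ler_norm.
    have b3 : - (pt * (tau (rn n) jx.1 - tx0.1)) <= `|pt| * a.
      rewrite (le_trans (ler_norm _)) // normrN normrM ler_wpM2l //.
      by rewrite ger0_norm; lra.
    have b4 : - dotm q (jx.2 - tx0.2) <= enorm q * a.
      rewrite (le_trans (ler_norm _)) // normrN (le_trans (cauchy_schwarz _ _)) //.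
      by rewrite ler_wpM2l // enorm_ge0.
    have b5 : - qform M (jx.2 - tx0.2) <= (\sum_i \sum_j `|M i j|) * a ^+ 2.
      rewrite (le_trans (ler_norm _)) // normrN (le_trans (qform_bound _ _)) //.
      rewrite ler_wpM2l ?sumr_ge0 // => [i _|]; first by rewrite sumr_ge0.
      by rewrite -enorm_sq lerXn2r ?nnegrE ?enorm_ge0 // ltW.
    have b6 : 0 <= (\sum_i \sum_j `|M i j|) * a ^+ 2.
      by rewrite mulr_ge0 ?sqr_ge0 // sumr_ge0 // => i _; rewrite sumr_ge0.
    rewrite /Bd; lra.
  by exists z; split; case: (Dz).
pose js n := (jx n).1; pose xs n := (jx n).2.
have js_le n : (js n <= steps n)%N by case: (hjx n).
have evD : U [set n | D n (jn n tx0.1, tx0.2)].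
  apply: filterS (rn_lim (_ : 0 < Num.min 1 a)) => [n /=|]; last by rewrite lt_min ltr01.
  rewrite subr0 (gtr0_norm (rn_gt0 n)) lt_min => /andP[h1 h2].
  have /andP[h3 h4] := jn_tau n stx0.
  have r0 := rn_gt0 n.
  have rr : rn n ^+ 2 <= rn n by rewrite expr2 ler_piMr // ltW.
  split => /=; [exact: jn_le| by rewrite h3 /=; lra | by rewrite subrr enorm0 ltW].
have [ts hts _] : exists2 ts, ulim_to U (fun n => tau (rn n) (js n)) ts & `|ts| <= T.
  apply: (ulim_exists UU) => n; have /andP[/= h1 h2] := tau_strip_n tx0.2 (js_le n).
  by rewrite ger0_norm.
have [zs hzs] : exists zs, ulimv_to U xs zs.
  apply: (ulimv_exists UU (M := enorm tx0.2 + a)) => n; have [_ ? _] := hjx n.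
  by rewrite -(subrK tx0.2 (xs n)) (le_trans (enormD _ _)) // addrC lerD2l.
have ts1 : tx0.1 <= ts.
  apply: (ulim_le UU (ulim_cst UU tx0.1) hts); apply: filterS evD => n Dn.
  by have [_ _ /(_ Dn)[[_ /andP[]]]] := hjx n.
have ts2 : ts <= tx0.1 + a.
  apply: (ulim_le UU hts (ulim_cst UU _)); apply: filterS evD => n Dn.
  by have [_ _ /(_ Dn)[[_ /andP[]]]] := hjx n.
have tsT : ts <= T.
  apply: (ulim_le UU hts (ulim_cst UU T)); apply: filterE => n /=.
  by have /andP[] := tau_strip_n tx0.2 (js_le n).
have sts : strip T (ts, zs) by rewrite /strip /= tsT (le_trans t0).
have zs1 : enorm (zs - tx0.2) <= a.
  have hd : ulimv_to U (fun n => xs n + - tx0.2) (zs - tx0.2).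
    by apply: (ulimvD UU hzs); exact: ulimv_cst.
  by apply: (ulimv_enorm_le UU hd); apply: filterE => n; case: (hjx n).
have ph_lim s ys s0 y0 : ulim_to U s s0 -> ulimv_to U ys y0 ->
    ulim_to U (fun n => ph (s n) (ys n)) (ph s0 y0).
  move=> hs hy; rewrite /ph /test_fun.
  have hyd : ulimv_to U (fun n => ys n + - tx0.2) (y0 - tx0.2).
    by apply: (ulimvD UU hy); exact: ulimv_cst.
  apply: (ulimD UU).
    apply: (ulimD UU); last by apply: (ulimv_dotm UU) => //; exact: ulimv_cst.
    apply: (ulimD UU); first exact: ulim_cst.
    by apply: (ulimM UU); [exact: ulim_cst | apply: (ulimD UU hs); exact: ulim_cst].
  apply: (ulimM UU); first exact: ulim_cst.
  by apply: (ulimv_dotm UU) => //; exact: ulimv_mulmx.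
have r3_lim : ulim_to U (fun n => rn n ^+ 3) 0.
  have := ulimM UU rn_lim (ulimM UU rn_lim rn_lim); rewrite mul0r.
  by apply: (ulim_eq UU); apply: filterE => n /=; rewrite -expr2 -exprS.
have key : 0 <= vv (ts, zs) - ph ts zs.
  have l1 := ulimD UU (w_conv stx0 (fun n => jn_le n stx0) (jn_tau_lim stx0) (ulimv_cst tx0.2))
    (ulimN UU (ph_lim _ _ _ _ (jn_tau_lim stx0) (ulimv_cst tx0.2))).
  have l2 := ulimD UU (ulimD UU (w_conv sts js_le hts hzs) (ulimN UU (ph_lim _ _ _ _ hts hzs))) r3_lim.
  have := ulim_le UU l1 l2.
  have -> : ph tx0.1 tx0.2 = vv tx0.
    by rewrite /ph /test_fun !subrr mulr0 /qform -(scale0r tx0.2) dotmZr dotmZl !mul0r mulr0 !addr0.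
  rewrite subrr addr0; apply; apply: filterS evD => n Dn.
  by have [_ _ /(_ Dn)[_ /(_ _ Dn)]] := hjx n.
(* The strict term with [eta] leaves [tx0] as the only possible limit of the near-maximisers. *)
have [tsE zsE] : ts = tx0.1 /\ zs = tx0.2.
  have ts3 : ts - tx0.1 < r1 by lra.
  have := hvv (ts, zs) sts ts1 ts3 (le_lt_trans zs1 ar); rewrite /= -/ph => hle.
  have h2 : eta * ((ts - tx0.1) + sqn (zs - tx0.2)) <= 0 by move: hle key; rewrite -/ph; lra.
  rewrite pmulr_rle0 // in h2; have h3 := sqn_ge0 (zs - tx0.2).
  split; first by apply/le_anti; rewrite ts1 andbT; lra.
  apply/eqP; rewrite -subr_eq0; apply/eqP/enorm_eq0; rewrite enormE.
  by apply/eqP; rewrite sqrtr_eq0; lra.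
rewrite {}tsE {}zsE in hts hzs key.
(* Since [tx0.1 < T], the index is positive on a set of the ultrafilter, so a step towards [T]
   exists. *)
pose j' n := (js n).-1.
have j'_lt n : (j' n < steps n)%N.
  by have := js_le n; rewrite /j'; case: (js n).
have evj : U [set n | (j' n).+1 = js n].
  have Tt : 0 < T - tx0.1 by lra.
  apply: filterS (hts _ Tt) => n /=; rewrite /j' ltr_norml => /andP[_].
  by case: (js n) => //; rewrite /tau mul0r subr0 ltxx.
have hts' : ulim_to U (fun n => tau (rn n) (j' n).+1) tx0.1.
  by apply: (ulim_eq UU _ hts); apply: filterS evj => n /= ->.
pose txn n := (tau (rn n) (j' n).+1, xs n).
have stxn n : strip T (txn n) := tau_strip_n (xs n) (j'_lt n).
pose bn n := b (txn n); pose sn n := sigma (txn n).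
have bn_lim : ulimv_to U bn (b tx0).
  apply: (ulimv_entries UU) => i.
  exact: (ucont_ulim (b_ucont i) stx0 stxn hts' hzs).
have sn_lim l : ulimv_to U (fun n => col l (sn n)) (col l (sigma tx0)).
  apply: (ulimv_entries UU) => i; rewrite mxE.
  have := ucont_ulim (sigma_ucont i l) stx0 stxn hts' hzs.
  by apply: (ulim_eq UU); apply: filterE => n; rewrite /= mxE.
have yn_lim : ulimv_to U (fun n => xs n + - tx0.2) 0.
  by rewrite -(subrr tx0.2); apply: (ulimvD UU hzs); exact: ulimv_cst.
have r2_lim : ulim_to U (fun n => rn n ^+ 2) 0.
  by have := ulimM UU rn_lim rn_lim; rewrite mul0r.
pose ep n l s := ph (tau (rn n) (j' n)) (nxt b sigma (rn n) (txn n) l s).2.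
pose zn n := Zg (rn n) (ep n).
have epE n : ep n = fun l s => ph (tau (rn n) (j' n).+1 + rn n ^+ 2)
    (xs n + rn n ^+ 2 *: bn n + (sg s * rn n) *: (Num.sqrt d%:R *: col l (sn n))).
  by apply/funext => l; apply/funext => s; rewrite /ep tauS.
have zn_lim : ulimv_to U zn ((sigma tx0)^T *m q).
  apply: (ulimv_entries UU) => l.
  have znE n : zn n l 0 = dotm q (col l (sn n)) +
      dotm (col l (sn n)) (M *m (xs n - tx0.2 + rn n ^+ 2 *: bn n)).
    by rewrite /zn epE /ph Zg_test_fun ?rn_gt0 // mxE.
  have -> : ((sigma tx0)^T *m q) l 0 = dotm q (col l (sigma tx0)) +
      dotm (col l (sigma tx0)) (M *m (0 + 0 *: b tx0)).
    rewrite scale0r addr0 mulmx0 -(scale0r (0 : 'cV[R]_k)) dotmZr mul0r addr0 dotmC mxE.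
    by apply: eq_bigr => i _; rewrite big_ord1 !mxE.
  have : ulim_to U (fun n => dotm q (col l (sn n)) +
      dotm (col l (sn n)) (M *m (xs n - tx0.2 + rn n ^+ 2 *: bn n)))
     (dotm q (col l (sigma tx0)) + dotm (col l (sigma tx0)) (M *m (0 + 0 *: b tx0))).
    apply: (ulimD UU); apply: (ulimv_dotm UU) => //; first exact: ulimv_cst.
    by apply: (ulimv_mulmx UU); apply: (ulimvD UU yn_lim); exact: (ulimvZ UU).
  by apply: (ulim_eq UU); apply: filterE => n; rewrite /= znE.
have F_lim := F_conv j'_lt hts' hzs zn_lim.
pose gen n := pt + dotm q (bn n) + dotm (bn n) (M *m (xs n - tx0.2))
   + 2^-1 * (rn n ^+ 2 * qform M (bn n)) + 2^-1 * \sum_l qform M (col l (sn n)).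
have gen_lim : ulim_to U gen (pt + dotm q (b tx0) + dotm (b tx0) (M *m 0)
   + 2^-1 * (0 * qform M (b tx0)) + 2^-1 * \sum_l qform M (col l (sigma tx0))).
  apply: (ulimD UU); last first.
    apply: (ulimM UU); first exact: ulim_cst.
    by apply: (ulim_sum UU) => l; apply: (ulimv_dotm UU) => //; exact: ulimv_mulmx.
  apply: (ulimD UU); last first.
    apply: (ulimM UU); first exact: ulim_cst.
    by apply: (ulimM UU) => //; apply: (ulimv_dotm UU) => //; exact: ulimv_mulmx.
  apply: (ulimD UU); last by apply: (ulimv_dotm UU) => //; exact: ulimv_mulmx.
  apply: (ulimD UU); first exact: ulim_cst.
  by apply: (ulimv_dotm UU) => //; exact: ulimv_cst.
have -> : pt + dotm q (b tx0) + 2^-1 * \sum_l qform M (col l (sigma tx0)) =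
  pt + dotm q (b tx0) + dotm (b tx0) (M *m 0)
   + 2^-1 * (0 * qform M (b tx0)) + 2^-1 * \sum_l qform M (col l (sigma tx0)).
  by rewrite mulmx0 -(scale0r (0 : 'cV[R]_k)) dotmZr !mul0r mulr0 !addr0.
have tot_lim := ulimD UU (ulimD UU gen_lim F_lim) rn_lim; rewrite addr0 in tot_lim.
apply: (ulim_le UU (ulim_cst UU 0) tot_lim).
pose cst := 4 * ka * (1 + (enorm tx0.2 + a) ^+ 2).
have cst0 : 0 <= cst by rewrite mulr_ge0 ?mulr_ge0 // addr_ge0 // sqr_ge0.
have a2 : 0 < a / 2 by rewrite divr_gt0.
have a22 : 0 < (a / 2) ^+ 2 by rewrite exprn_gt0.
have [c /andP[cc0 cc1] hc] := small_modulus cst0 (lexx 0) a22.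
have ev1 : U [set n | [/\ rn n < c, rn n ^+ 2 < a / 2, tau (rn n) (j' n).+1 < tx0.1 + a / 2
     & enorm (xs n - tx0.2) < a / 2]].
  apply: filterS2 (filterI (rn_lim cc0) (r2_lim _ a2)) (filterI (hts' _ a2) (hzs _ a2)).
  move=> n [/= h1 h2] [/= h3 h4]; rewrite !subr0 in h1 h2.
  move: h1 h2 h3; rewrite (gtr0_norm (rn_gt0 n)) !ltr_norml => h1 /andP[_ h2] /andP[_ h3].
  by split => //; lra.
apply: filterS2 (filterI evD evj) (filterI ev1 (w_step j'_lt hts' hzs)).
move=> n [/= Dn ej] [[hc1 hr2 ht1 hx1] /=].
have r0 := rn_gt0 n.
have [_ _ /(_ Dn)[Djx hmax]] := hjx n.
set ew := fun l s => w n (j' n) _.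
move=> hw.
have r1' : rn n <= 1 by rewrite (le_trans (ltW hc1)).
(* All next positions are still in the cylinder, which extends forward in time, so near-maximality
   applies to them. *)
have near l s : ew l s - ep n l s <= val n (jx n) + rn n ^+ 3.
  apply: (hmax (j' n, (nxt b sigma (rn n) (txn n) l s).2)).
  have [_ /andP[d1 _] _] := Djx.
  split => /=; first exact: ltnW.
    rewrite -tauS; rewrite -[(jx n).1]/(js n) -ej in d1.
    by rewrite (le_trans d1) ?lerDl ?sqr_ge0 //=; lra.
  have xb : rho (xs n) <= 1 + (enorm tx0.2 + a) ^+ 2.
    rewrite lerD2l -enorm_sq lerXn2r ?nnegrE ?enorm_ge0 ?addr_ge0 ?enorm_ge0 ?(ltW a0) //.
    by rewrite -(subrK tx0.2 (xs n)) (le_trans (enormD _ _)) // addrC lerD2l; lra.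
  have r01 : 0 < rn n <= 1 by rewrite r0.
  have h1 := nxt_close l s r01 (stxn n).
  have h2 : rn n ^+ 2 * (4 * ka * (1 + sqn (txn n).2)) <= cst * rn n ^+ 2.
    by rewrite mulrC ler_wpM2r ?sqr_ge0 // ler_wpM2l // mulr_ge0.
  have h3 := hc (rn n) 0 (ltW r0) hc1; rewrite normr0 mul0r addr0 in h3.
  have h4 : enorm ((nxt b sigma (rn n) (txn n) l s).2 - (txn n).2) < a / 2.
    rewrite -(@ltr_pXn2r _ 2) ?nnegrE ?enorm_ge0 ?(ltW a2) // enorm_sq.
    by apply: le_lt_trans h1 (le_lt_trans h2 (h3 cc0)).
  have -> : (nxt b sigma (rn n) (txn n) l s).2 - tx0.2 =
     ((nxt b sigma (rn n) (txn n) l s).2 - (txn n).2) + (xs n - tx0.2) by rewrite addrA subrK.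
  by rewrite (le_trans (enormD _ _)) //; lra.
(* The values inside [F] are already fixed, so only the slope is tilted. With [C0 = 0] the total
   weight is exactly one, and the near-maximal value is averaged without change. *)
have [W hW tW] := tilt d_gt0 (fun l s => ew l s - ep n l s) r0 (lexx 0) C_ge0.
rewrite mulr0 mul0r addr0 ExB ZgB in tW.
have [_ hsm _] := rn_small n.
have hsm' : rn n ^+ 2 * 0 + rn n * (C * Num.sqrt d%:R) <= 1 / 2.
  by rewrite mulr0 add0r; have : 0 <= rn n ^+ 2 * C by [rewrite mulr_ge0 ?sqr_ge0]; lra.
have W12 := admissible_ge (ltW r0) hsm' hW.
have /andP[W1 W1'] := Ex_admissible d_gt0 hW; rewrite mulr0 ?subr0 addr0 in W1 W1'.
have EW : Ex W = 1 by apply/le_anti; rewrite W1 W1'.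
have hWe : Ex (fun l s => W l s * (ew l s - ep n l s)) <= val n (jx n) + rn n ^+ 3.
  rewrite -[leRHS]mulr1 -EW -Ex_weight_cst; apply: Ex_le => l s.
  by rewrite ler_wpM2l //; have := W12 l s; lra.
have valE : val n (jx n) = w n (j' n).+1 (xs n) - ph (tau (rn n) (j' n).+1) (xs n).
  by rewrite ej.
have hF := F_lip (xs n) (Zg (rn n) ew) (zn n) (j'_lt n).
have hF2 : rn n ^+ 2 * F n (j' n) (xs n) (Zg (rn n) ew) <=
   rn n ^+ 2 * (F n (j' n) (xs n) (zn n) + C * enorm (Zg (rn n) ew - zn n)).
  by rewrite ler_wpM2l ?sqr_ge0 //; have := ler_norm (F n (j' n) (xs n) (Zg (rn n) ew) - F n (j' n) (xs n) (zn n)); lra.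
have Eep : Ex (ep n) = ph (tau (rn n) (j' n).+1) (xs n) + rn n ^+ 2 * gen n.
  by rewrite epE /ph Ex_test_fun.
have fin : 0 <= rn n ^+ 2 * (gen n + F n (j' n) (xs n) (zn n) + rn n).
  have -> : rn n ^+ 2 * (gen n + F n (j' n) (xs n) (zn n) + rn n) =
    rn n ^+ 2 * gen n + rn n ^+ 2 * F n (j' n) (xs n) (zn n) + rn n ^+ 3 by rewrite !exprS expr0; ring.
  rewrite -/(zn n) in tW; lra.
by rewrite pmulr_rge0 // exprn_gt0 in fin.
Qed.

(** Adding [2 * eta] to the time slope and [4 * eta] to the Hessian contributes [2 * eta] times the
    parabolic distance: one half covers the remainder of the jet, the other makes the maximum
    strict. The cost [eta * (2 + 2 * Sg)] is arbitrary. *)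
Lemma viscosity_superjet p' q M : superjet T vv tx0 (p', q, M) ->
  0 <= p' + dotm q (b tx0) + 2^-1 * \sum_l qform M (col l (sigma tx0)) + F0 ((sigma tx0)^T *m q).
Proof.
move=> [Ms hJ]; pose Sg := \sum_l sqn (col l (sigma tx0)).
have Sg0 : 0 <= Sg by rewrite sumr_ge0 // => l _; exact: sqn_ge0.
apply/ler_addgt0Pr => e e0; pose D := 2 + 2 * Sg.
have D0 : 0 < D by rewrite /D; lra.
pose eta := e / D; have eta0 : 0 < eta by rewrite divr_gt0.
have /nbhs_enorm[r1 r10 hr1] := hJ _ eta0.
have Ms' : (M + (4 * eta)%:M)^T = M + (4 * eta)%:M by rewrite linearD /= Ms tr_scalar_mx.
have hv ty : strip T ty -> tx0.1 <= ty.1 -> ty.1 - tx0.1 < r1 -> enorm (ty.2 - tx0.2) < r1 ->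
    vv ty <= test_fun (vv tx0) tx0.1 (p' + 2 * eta) tx0.2 q (M + (4 * eta)%:M) ty.1 ty.2
             - eta * ((ty.1 - tx0.1) + sqn (ty.2 - tx0.2)).
  move=> sty h0 h1 h2.
  have := hr1 ty _ h2 sty; rewrite ger0_norm ?subr_ge0 // => /(_ h1).
  by rewrite /jet_poly !dotmE -/(qform M _) enorm_sq /test_fun qform_addscalar; lra.
have := viscosity_test Ms' eta0 r10 hv.
have -> : \sum_l qform (M + (4 * eta)%:M) (col l (sigma tx0)) =
    \sum_l qform M (col l (sigma tx0)) + 4 * eta * Sg.
  by rewrite mulr_sumr -big_split; apply: eq_bigr => l _; rewrite qform_addscalar.
have -> : e = eta * D by rewrite divfK // gt_eqF.
rewrite /D; lra.
Qed.

End test.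

(** * Jets and limiting jets of the limit *)

Lemma Ex_ulim (a : nat -> 'I_d -> bool -> R) l :
  (forall i s, ulim_to U (fun n => a n i s) l) -> ulim_to U (fun n => Ex (a n)) l.
Proof.
move=> ha; rewrite -[l](Ex_cst d_gt0); apply: (ulimM UU); first exact: ulim_cst.
apply: (ulim_sum UU) => i; apply: (ulimM UU); last exact: ulim_cst.
exact: ulimD.
Qed.

Lemma nxt_ulim (js : nat -> nat) (xs : nat -> 'cV[R]_k) x l s :
  (forall n, (js n < steps n)%N) -> ulimv_to U xs x ->
  ulimv_to U (fun n => (nxt b sigma (rn n) (tau (rn n) (js n).+1, xs n) l s).2) x.
Proof.
move=> hjs hx e e0.
pose cst := 4 * ka * (1 + (enorm x + 1) ^+ 2).
have cst0 : 0 <= cst by rewrite mulr_ge0 ?mulr_ge0 // addr_ge0 // sqr_ge0.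
have e2 : 0 < e / 2 by rewrite divr_gt0.
have e22 : 0 < (e / 2) ^+ 2 by rewrite exprn_gt0.
have [c /andP[cc0 cc1] hc] := small_modulus cst0 (lexx 0) e22.
apply: filterS2 (filterI (hx _ ltr01) (hx _ e2)) (rn_lim cc0) => n [/= h1 h2] /=.
have r0 := rn_gt0 n; rewrite subr0 (gtr0_norm r0) => h3.
have r01 : 0 < rn n <= 1 by rewrite r0 (le_trans (ltW h3)).
have h4 := nxt_close l s r01 (tau_strip_n (xs n) (hjs n)).
have xb : 1 + sqn (xs n) <= 1 + (enorm x + 1) ^+ 2.
  rewrite lerD2l -enorm_sq lerXn2r ?nnegrE ?enorm_ge0 ?addr_ge0 ?enorm_ge0 //.
  by rewrite -(subrK x (xs n)) (le_trans (enormD _ _)) // addrC lerD2l ltW.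
have h5 : rn n ^+ 2 * (4 * ka * (1 + sqn (xs n))) <= cst * rn n ^+ 2.
  by rewrite mulrC ler_wpM2r ?sqr_ge0 // ler_wpM2l // mulr_ge0.
have h6 := hc (rn n) 0 (ltW r0) h3; rewrite normr0 mul0r addr0 in h6.
have h7 : enorm ((nxt b sigma (rn n) (tau (rn n) (js n).+1, xs n) l s).2 - xs n) < e / 2.
  rewrite -(@ltr_pXn2r _ 2) ?nnegrE ?enorm_ge0 ?(ltW e2) // enorm_sq.
  exact: le_lt_trans h4 (le_lt_trans h5 (h6 cc0)).
have -> : (nxt b sigma (rn n) (tau (rn n) (js n).+1, xs n) l s).2 - x =
    ((nxt b sigma (rn n) (tau (rn n) (js n).+1, xs n) l s).2 - xs n) + (xs n - x).
  by rewrite addrA subrK.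
by rewrite (le_lt_trans (enormD _ _)) //; lra.
Qed.

Lemma tau_pred_ulim (js : nat -> nat) t :
  ulim_to U (fun n => tau (rn n) (js n).+1) t -> ulim_to U (fun n => tau (rn n) (js n)) t.
Proof.
move=> ht; have r2_lim : ulim_to U (fun n => rn n ^+ 2) 0.
  by have := ulimM UU rn_lim rn_lim; rewrite mul0r.
have := ulimD UU ht r2_lim; rewrite addr0; apply: (ulim_eq UU).
by apply: filterE => n; rewrite /= tauS.
Qed.

Lemma scheme_step_ulim i (js : nat -> nat) (xs : nat -> 'cV[R]_k) tx : strip T tx ->
  (forall n, (js n < steps n)%N) -> ulim_to U (fun n => tau (rn n) (js n).+1) tx.1 ->
  ulimv_to U xs tx.2 ->
  ulim_to U (fun n => Ex (V (rn n) (tau (rn n) (js n).+1, xs n) (js n) i)) (vlim i tx).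
Proof.
move=> stx hjs ht hx; apply: Ex_ulim => l s; apply: vlim_conv => //.
- by move=> n; exact: ltnW.
- exact: tau_pred_ulim.
- exact: nxt_ulim.
Qed.

Lemma f_ulim i (txs : nat -> R * 'cV[R]_k) (ys : nat -> 'cV[R]_m) (zs : nat -> 'cV[R]_d) tx (y : 'cV[R]_m) (z : 'cV[R]_d) :
  strip T tx -> (forall n, strip T (txs n)) ->
  ulim_to U (fun n => (txs n).1) tx.1 -> ulimv_to U (fun n => (txs n).2) tx.2 ->
  (forall l, ulim_to U (fun n => ys n l 0) (y l 0)) -> ulimv_to U zs z ->
  ulim_to U (fun n => f i (txs n) (ys n) (zs n)) (f i tx y z).
Proof.
move=> stx stxs ht hx hy hz e e0.
have e2 : 0 < e / 2 by rewrite divr_gt0.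
have [a a0 ha] := f_ucont i stx e2.
have lim : ulim_to U (fun n => \sum_(l < m) `|ys n l 0 - y l 0| + enorm (zs n - z)) (\sum_(l < m) 0 + 0).
  apply: (ulimD UU).
    apply: (ulim_sum UU) => l s s0; apply: filterS (hy l s s0) => n /=.
    by rewrite subr0 normr_id.
  by move=> s s0; apply: filterS (hz s s0) => n /=; rewrite subr0 ger0_norm ?enorm_ge0.
rewrite big1_eq addr0 in lim.
have e3 : 0 < e / 2 / (1 + C) by rewrite divr_gt0 // ltr_pwDl.
apply: filterS2 (filterI (ht _ a0) (hx _ a0)) (lim _ e3) => n [/= h1 h2] /=.
rewrite subr0 => h3.
have := ha (txs n) (stxs n) h1 h2 (y, z) => /= h4.
have := f_lip i (ys n) y (zs n) z (stxs n) => h5.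
have C1 : 0 < 1 + C by rewrite ltr_pwDl.
move: h3 h5; set Sn := \sum_(l < m) _ + _ => h3 h5.
have Sn0 : 0 <= Sn by rewrite addr_ge0 ?enorm_ge0 // sumr_ge0.
rewrite ger0_norm // ltr_pdivlMr // in h3.
rewrite (_ : _ - _ = (f i (txs n) (ys n) (zs n) - f i (txs n) y z) + (f i (txs n) y z - f i tx y z)); last by ring.
by rewrite (le_lt_trans (ler_normD _ _)) //; lra.
Qed.

Let vcol tx : 'cV[R]_m := \col_l vlim l tx.

(** Strictness of the obstacle inequality at the limit passes to nearby grid points on a set of the
    ultrafilter. There the scheme cannot switch out of [i] and equals its continuation, as the test
    demands. *)
Lemma vlim_superjet i tx p' q M : 0 <= tx.1 < T -> superjet T (vlim i) tx (p', q, M) ->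
  (forall l, i != l -> vlim l tx - g i l tx < vlim i tx) ->
  0 <= p' + dotm q (b tx) + 2^-1 * \sum_l qform M (col l (sigma tx))
    + f i tx (vcol tx) ((sigma tx)^T *m q).
Proof.
move=> tx_in hJ hobs; have [t0 tT] := andP tx_in.
have stx : strip T tx by rewrite /strip /= t0 ltW.
pose Fn n j x z := f i (tau (rn n) j.+1, x)
  (\col_l Ex (V (rn n) (tau (rn n) j.+1, x) j l)) z.
apply: (@viscosity_superjet (fun n j x => scheme (rn n) j i x) (vlim i) Fn
  (fun z => f i tx (vcol tx) z) tx tx_in _ _ _ _ _ p' q M hJ).
- by move=> js xs ty sty hjs ht hx; exact: vlim_conv.
- by move=> n j x jN; exact: scheme_bound (rn_small n) (steps_rn n) jN.
- move=> n j x z z' jN; apply: le_trans (f_lip _ _ _ _ _ (tau_strip_n x jN)) _.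
  by rewrite big1 ?add0r // => l _; rewrite subrr normr0.
- move=> js xs hjs ht hx.
  have hsw l : U [set n | i != l ->
      scheme (rn n) (js n).+1 l (xs n) - g i l (tau (rn n) (js n).+1, xs n) <
      scheme (rn n) (js n).+1 i (xs n)].
    have [->|il] := eqVneq i l; first by apply: filterE.
    have li := vlim_conv i stx hjs ht hx; have ll := vlim_conv l stx hjs ht hx.
    have lg := ucont_ulim (g_ucont il) stx (fun n => tau_strip_n (xs n) (hjs n)) ht hx.
    have pos : 0 < (vlim i tx - (vlim l tx - g i l tx)) by rewrite subr_gt0; exact: hobs.
    have lim := ulimD UU li (ulimN UU (ulimD UU ll (ulimN UU lg))).
    apply: filterS (lim _ pos) => n /= + _; rewrite ltr_norml => /andP[h1 _].
    by move: h1; rewrite opprB; lra.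
  have FU : Filter U by typeclasses eauto.
  have hall := @filter_forall nat _ _ U FU hsw.
  apply: filterS hall => n hn.
  have [e|[l il hl]] := scheme_case (steps_rn n) i (xs n) (hjs n); last first.
    by have := hn l il; rewrite ltNge hl.
  by rewrite continuationE in e; exact: (eq_ind_r (fun z => z <= _) (lexx _) e).
- move=> js xs zs z hjs ht hx hz; apply: f_ulim => //.
    by move=> n; exact: tau_strip_n.
  move=> l; rewrite mxE; have := scheme_step_ulim l stx hjs ht hx.
  by apply: (ulim_eq UU); apply: filterE => n; rewrite /= mxE.
Qed.

Lemma subjet_opp (u : R * 'cV[R]_k -> R) tx p' q M : subjet T u tx (p', q, M) ->
  superjet T (fun ty => - u ty) tx (- p', - q, - M).
Proof.
move=> [Ms hJ]; split; first by rewrite linearN /= Ms.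
move=> e e0; apply: filterS (hJ e e0) => ty; rewrite /jet_poly !dotmE -!/(qform _ _).
have -> : qform (- M) (ty.2 - tx.2) = - qform M (ty.2 - tx.2) by rewrite /qform mulNmx dotmNr.
rewrite dotmNl => h1; lra.
Qed.

(** The same test applied to the negated scheme, with the driver reflected in value and slope. The
    scheme dominates its continuation everywhere, so the obstacle does not interfere. *)
Lemma vlim_subjet i tx p' q M : 0 <= tx.1 < T -> subjet T (vlim i) tx (p', q, M) ->
  p' + dotm q (b tx) + 2^-1 * \sum_l qform M (col l (sigma tx))
    + f i tx (vcol tx) ((sigma tx)^T *m q) <= 0.
Proof.
move=> tx_in /subjet_opp hJ; have [t0 tT] := andP tx_in.
have stx : strip T tx by rewrite /strip /= t0 ltW.
pose Fn n j x z := - f i (tau (rn n) j.+1, x)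
  (\col_l Ex (V (rn n) (tau (rn n) j.+1, x) j l)) (- z).
have := @viscosity_superjet (fun n j x => - scheme (rn n) j i x) (fun ty => - vlim i ty) Fn
  (fun z => - f i tx (vcol tx) (- z)) tx tx_in _ _ _ _ _ (- p') (- q) (- M) hJ.
rewrite mulmxN opprK dotmNl.
have -> : \sum_l qform (- M) (col l (sigma tx)) = - \sum_l qform M (col l (sigma tx)).
  by rewrite -sumrN; apply: eq_bigr => l _; rewrite /qform mulNmx dotmNr.
move=> res; have {}res : (0 <= - p' - dotm q (b tx) + 2^-1 * - \sum_l qform M (col l (sigma tx)) -
    f i tx (vcol tx) ((sigma tx)^T *m q)); last by lra.
apply: res.
- by move=> js xs ty sty hjs ht hx; apply: (ulimN UU); exact: vlim_conv.
- by move=> n j x jN; rewrite normrN; exact: scheme_bound (rn_small n) (steps_rn n) jN.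
- move=> n j x z z' jN; rewrite -opprD normrN.
  apply: le_trans (f_lip _ _ _ _ _ (tau_strip_n x jN)) _.
  by rewrite big1 ?add0r ?opprK 1?addrC ?(enormB z) // => l _; rewrite subrr normr0.
- move=> js xs hjs ht hx; apply: filterE => n.
  pose Vn := V (rn n) (tau (rn n) (js n).+1, xs n) (js n) i.
  have hge := scheme_ge (rn n) (js n) i (xs n); rewrite continuationE in hge.
  suff : - scheme (rn n) (js n).+1 i (xs n) <= Ex (fun l s => - Vn l s) +
      rn n ^+ 2 * Fn n (js n) (xs n) (Zg (rn n) (fun l s => - Vn l s)) by [].
  have -> : Zg (rn n) (fun l s => - Vn l s) = - Zg (rn n) Vn.
    by apply/matrixP => l j; rewrite !mxE -mulNr; congr (_ / _); ring.
  by rewrite ExN /Fn opprK; lra.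
- move=> js xs zs z hjs ht hx hz; apply: (ulimN UU); apply: f_ulim => //.
  + by move=> n; exact: tau_strip_n.
  + move=> l; rewrite mxE; have := scheme_step_ulim l stx hjs ht hx.
    by apply: (ulim_eq UU); apply: filterE => n; rewrite /= mxE.
  + by move=> e /hz; apply: filterS => n /=; rewrite -opprD enormN.
Qed.

Lemma cvg_ultra (X : topologicalType) (x : nat -> X) (l : X) (A : set X) :
  x n @[n --> \oo] --> l -> nbhs l A -> U [set n | A (x n)].
Proof.
move=> hx /hx[N _ hN]; apply: filterS (Uoo N) => n /= Nn; exact: hN.
Qed.

Lemma cvg_ulim (x : nat -> R) (l : R) : x n @[n --> \oo] --> l -> ulim_to U x l.
Proof.
move=> hx e e0; apply: (cvg_ultra hx (A := [set y : R | `|y - l| < e])).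
by apply/nbhs_ballP; exists e => // y; rewrite /ball /= distrC.
Qed.

Lemma cvg_ulim_mx (a c : nat) (x : nat -> 'M[R]_(a, c)) (l : 'M[R]_(a, c)) i j : x n @[n --> \oo] --> l ->
  ulim_to U (fun n => x n i j) (l i j).
Proof.
move=> hx e e0; apply: (cvg_ultra hx (A := [set y : 'M[R]_(a, c) | `|y i j - l i j| < e])).
apply/nbhs_ballP; exists e => // y; rewrite -ball_normE /ball_ /= distrC => h1.
have := normr_entry_mx (y - l) i j; rewrite !mxE => h2; exact: le_lt_trans h1.
Qed.

Lemma cvg_ulim_pair (txs : nat -> R * 'cV[R]_k) tx : txs n @[n --> \oo] --> tx ->
  ulim_to U (fun n => (txs n).1) tx.1 /\ ulimv_to U (fun n => (txs n).2) tx.2.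
Proof.
move=> hx; split => e e0.
  apply: (cvg_ultra hx (A := [set y : R * 'cV[R]_k | `|y.1 - tx.1| < e])).
  by apply/nbhs_enorm; exists e.
apply: (cvg_ultra hx (A := [set y : R * 'cV[R]_k | enorm (y.2 - tx.2) < e])).
by apply/nbhs_enorm; exists e.
Qed.

Lemma ulim_mulmx (a c l : nat) (x : nat -> 'M[R]_(a, c)) (y : nat -> 'M[R]_(c, l))
    (x' : 'M[R]_(a, c)) (y' : 'M[R]_(c, l)) :
  (forall i j, ulim_to U (fun n => x n i j) (x' i j)) ->
  (forall i j, ulim_to U (fun n => y n i j) (y' i j)) ->
  forall i j, ulim_to U (fun n => (x n *m y n) i j) ((x' *m y') i j).
Proof.
move=> hx hy i j; rewrite mxE.
have : ulim_to U (fun n => \sum_z x n i z * y n z j) (\sum_z x' i z * y' z j).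
  by apply: (ulim_sum UU) => z; exact: (ulimM UU).
by apply: (ulim_eq UU); apply: filterE => n; rewrite /= mxE.
Qed.

Lemma ulim_trmx (a c : nat) (x : nat -> 'M[R]_(a, c)) (x' : 'M[R]_(a, c)) :
  (forall i j, ulim_to U (fun n => x n i j) (x' i j)) ->
  forall i j, ulim_to U (fun n => (x n)^T i j) (x'^T i j).
Proof.
move=> hx i j; rewrite mxE; have := hx j i.
by apply: (ulim_eq UU); apply: filterE => n; rewrite /= mxE.
Qed.

(** Minus the second entry of [system_operator]. It depends continuously on the point and on the
    jet, which carries the inequality from jets to limiting jets. *)
Definition generator i tx p' (q : 'cV[R]_k) (M : 'M[R]_k) : R :=
  p' + ((b tx)^T *m q) 0 0 + 2^-1 * \tr (sigma tx *m (sigma tx)^T *m M)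
  + f i tx (\col_j vlim j tx) ((sigma tx)^T *m q).

Lemma generatorE i tx p' q M : M^T = M -> generator i tx p' q M =
  p' + dotm q (b tx) + 2^-1 * \sum_l qform M (col l (sigma tx))
    + f i tx (vcol tx) ((sigma tx)^T *m q).
Proof. by move=> Ms; rewrite /generator dotmE dotmC mxtrace_qform. Qed.

Lemma generator_ulim i (txs : nat -> R * 'cV[R]_k) (ps : nat -> R) (qs : nat -> 'cV[R]_k)
    (Ms : nat -> 'M[R]_k) tx p' q M : strip T tx -> (forall n, strip T (txs n)) ->
  txs n @[n --> \oo] --> tx -> ps n @[n --> \oo] --> p' -> qs n @[n --> \oo] --> q ->
  Ms n @[n --> \oo] --> M ->
  ulim_to U (fun n => generator i (txs n) (ps n) (qs n) (Ms n)) (generator i tx p' q M).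
Proof.
move=> stx stxs /cvg_ulim_pair[ht hx] /cvg_ulim hp hq hM.
have {}hq r s := cvg_ulim_mx r s hq; have {}hM r s := cvg_ulim_mx r s hM.
have hb r s : ulim_to U (fun n => b (txs n) r s) (b tx r s).
  by rewrite (ord1 s); exact: (ucont_ulim (b_ucont r) stx stxs ht hx).
have hs r s : ulim_to U (fun n => sigma (txs n) r s) (sigma tx r s).
  exact: (ucont_ulim (sigma_ucont r s) stx stxs ht hx).
have hsq := ulim_mulmx (ulim_trmx hs) hq.
apply: (ulimD UU); last first.
  apply: f_ulim => //.
    move=> l; rewrite mxE; have := ucont_ulim (vlim_ucont l) stx stxs ht hx.
    by apply: (ulim_eq UU); apply: filterE => n; rewrite /= mxE.
  by apply: (ulimv_entries UU) => l; exact: hsq.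
apply: (ulimD UU); last first.
  apply: (ulimM UU); first exact: ulim_cst.
  apply: (ulim_sum UU) => r.
  exact: (ulim_mulmx (ulim_mulmx hs (ulim_trmx hs)) hM).
by apply: (ulimD UU hp); exact: (ulim_mulmx (ulim_trmx hb) hq).
Qed.

Lemma cvg_pair_l (X Y : topologicalType) (z : nat -> X * Y) (l : X) (l' : Y) :
  z n @[n --> \oo] --> (l, l') -> (z n).1 @[n --> \oo] --> l.
Proof.
move=> hz A hA; apply: (hz (fst @^-1` A)); exists (A, setT) => /=; last by move=> [u v] [].
by split => //; exact: filterT.
Qed.

Lemma cvg_pair_r (X Y : topologicalType) (z : nat -> X * Y) (l : X) (l' : Y) :
  z n @[n --> \oo] --> (l, l') -> (z n).2 @[n --> \oo] --> l'.
Proof.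
move=> hz A hA; apply: (hz (snd @^-1` A)); exists (setT, A) => /=; last by move=> [u v] [].
by split => //; exact: filterT.
Qed.

Lemma limiting_jet_components (J : R * 'cV[R]_k -> set (R * 'cV[R]_k * 'M[R]_k)) u tx p' q M :
  limiting_jet T J u tx (p', q, M) -> exists txs ps qs Ms,
  [/\ forall n, strip T (txs n) /\ J (txs n) (ps n, qs n, Ms n),
      txs n @[n --> \oo] --> tx, ps n @[n --> \oo] --> p', qs n @[n --> \oo] --> q &
      Ms n @[n --> \oo] --> M].
Proof.
move=> [txs [pqMs [hJ htx _ hpqM]]].
exists txs, (fun n => (pqMs n).1.1), (fun n => (pqMs n).1.2), (fun n => (pqMs n).2); split => //.
- by move=> n; have := hJ n; case: (pqMs n) => -[].
- exact: cvg_pair_l (cvg_pair_l hpqM).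
- exact: cvg_pair_r (cvg_pair_l hpqM).
- exact: cvg_pair_r hpqM.
Qed.

Lemma vlim_continuous i : {within strip T, continuous (vlim i)}.
Proof. exact/ucont_within_continuous/vlim_ucont. Qed.

Lemma continuous_lsc_on (u : R * 'cV[R]_k -> R) : {within strip T, continuous u} -> lsc_on T u.
Proof.
move=> hu tx a; rewrite lte_fin => au; have := cvgr_gt _ (hu tx) _ au => h1.
exists [set ty | a < u ty]; first exact: h1.
by move=> ty; rewrite lte_fin.
Qed.

(** The points approximating a limiting jet may lie at the terminal time, where no inequality is
    available; they do so only outside a set of the ultrafilter. *)
Lemma before_T (txs : nat -> R * 'cV[R]_k) (tx : R * 'cV[R]_k) : 0 <= tx.1 < T -> (forall n, strip T (txs n)) ->
  txs n @[n --> \oo] --> tx -> U [set n | 0 <= (txs n).1 < T].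
Proof.
move=> /andP[t0 tT] stxs /cvg_ulim_pair[ht _].
have e0 : 0 < T - tx.1 by rewrite subr_gt0.
apply: filterS (ht _ e0) => n /=; rewrite ltr_norml => /andP[_ h1].
by have /andP[-> _] := stxs n => /=; lra.
Qed.

Lemma vlim_supersolution : viscosity_supersolution T b sigma f g h vlim.
Proof.
split=> [i|i tx tx_in p' q M|i x]; last by rewrite vlimT.
  exact/continuous_lsc_on/vlim_continuous.
move=> /limiting_jet_components[txs [ps [qs [Ms [hJ htx hp hq hM]]]]].
have [t0 tT] := andP tx_in.
have stx : strip T tx by rewrite /strip /= t0 ltW.
have stxs n : strip T (txs n) by case: (hJ n).
have lim := generator_ulim i stx stxs htx hp hq hM.
have le0 : generator i tx p' q M <= 0.
  apply: (ulim_le UU lim (ulim_cst UU 0)); apply: filterS (before_T tx_in stxs htx) => n tn.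
  have [_ Jn] := hJ n; have [Msn _] := Jn.
  by have := vlim_subjet tn Jn; rewrite -generatorE.
rewrite /system_operator le_min; apply/andP; split.
  rewrite sube_ge0 ?orbT // /obstacle; elim/big_rec: _ => [|l y li hy]; first exact: leNye.
  by rewrite ge_max hy andbT lee_fin; apply: vlim_obst => //; rewrite eq_sym.
rewrite lee_fin; move: le0; rewrite /generator; lra.
Qed.

Lemma vlim_subsolution : viscosity_subsolution T b sigma f g h vlim.
Proof.
split=> [i|i tx tx_in p' q M|i x]; last by rewrite vlimT.
  apply: continuous_lsc_on => tx; apply: cvgN; exact: vlim_continuous.
move=> /limiting_jet_components[txs [ps [qs [Ms [hJ htx hp hq hM]]]]].
have [t0 tT] := andP tx_in.
have stx : strip T tx by rewrite /strip /= t0 ltW.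
have stxs n : strip T (txs n) by case: (hJ n).
have [ht hx] := cvg_ulim_pair htx.
(* If an obstacle is reached, the first entry of the minimum is non-positive. Otherwise all obstacle
   inequalities are strict, hence persist along the approximating points. *)
have [[l il hl]|no] := pselect (exists2 l, i != l & vlim i tx <= vlim l tx - g i l tx).
  rewrite /system_operator ge_min; apply/orP; left.
  rewrite sube_le0 /obstacle; apply: le_trans (_ : (vlim l tx - g i l tx)%:E <= _)%E.
    by rewrite lee_fin.
  rewrite (bigD1 l) 1?eq_sym //= le_max lexx //.
have hobs l : U [set n | i != l -> vlim l (txs n) - g i l (txs n) < vlim i (txs n)].
  have [->|il] := eqVneq i l; first by apply: filterE.
  have pos : 0 < vlim i tx - (vlim l tx - g i l tx).
    by rewrite subr_gt0 ltNge; apply/negP => hl; apply: no; exists l.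
  have lim := ulimD UU (ucont_ulim (vlim_ucont i) stx stxs ht hx) (ulimN UU
    (ulimD UU (ucont_ulim (vlim_ucont l) stx stxs ht hx) (ulimN UU (ucont_ulim (g_ucont il) stx stxs ht hx)))).
  apply: filterS (lim _ pos) => n /= + _; rewrite ltr_norml => /andP[h1 _]; lra.
have FU : Filter U by typeclasses eauto.
have hall := @filter_forall nat _ _ U FU hobs.
have lim := generator_ulim i stx stxs htx hp hq hM.
have ge0 : 0 <= generator i tx p' q M.
  apply: (ulim_le UU (ulim_cst UU 0) lim); apply: filterS2 hall (before_T tx_in stxs htx) => n hn tn.
  have [_ Jn] := hJ n; have [Msn _] := Jn.
  by have := vlim_superjet tn Jn hn; rewrite -generatorE.
rewrite /system_operator ge_min; apply/orP; right.
rewrite lee_fin; move: ge0; rewrite /generator; lra.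
Qed.

End limit.
End scheme.

(** * Existence *)

Lemma within_continuous_entry (R : realType) (k a c : nat) (T : R)
    (phi : R * 'cV[R]_k -> 'M[R]_(a, c)) i j :
  {within strip T, continuous phi} -> ucont_on T (fun tx (_ : unit) => phi tx i j).
Proof.
move=> hphi tx stx e e0.
have /cvgrPdist_lt /(_ _ e0) := (subspace_continuousP _ _).1 hphi tx stx.
move=> /nbhs_enorm[r r0 hr]; exists r => // ty sty h1 h2 _.
have := normr_entry_mx (phi tx - phi ty) i j; rewrite !mxE distrC => h3.
by apply: le_lt_trans h3 _; exact: hr.
Qed.

Lemma continuous_snd_ucont (R : realType) (k : nat) (T : R) (h : 'cV[R]_k -> R) :
  continuous h -> ucont_on T (fun (tx : R * 'cV[R]_k) (_ : unit) => h tx.2).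
Proof.
move=> hc tx _ e e0; have /cvgrPdist_lt /(_ _ e0) := hc tx.2.
by move=> /nbhs_enorm_col[r r0 hr]; exists r => // ty _ _ h2 _; rewrite distrC; exact: hr.
Qed.

Lemma powR_le_expn (R : realType) (s gamma : R) : 0 <= s -> 0 <= gamma ->
  1 + s `^ gamma <= 2 * (1 + s ^+ 2) ^+ (Num.truncn gamma).+1.
Proof.
move=> s0 g0; have r1 : 1 <= 1 + s ^+ 2 by rewrite lerDl sqr_ge0.
have r0 : 0 <= 1 + s ^+ 2 by apply: le_trans r1.
have sr : s <= 1 + s ^+ 2 by have := sqr_ge0 (s - 1 / 2); lra.
have h1 : 1 <= (1 + s ^+ 2) ^+ (Num.truncn gamma).+1 by rewrite exprn_ege1.
suff : s `^ gamma <= (1 + s ^+ 2) ^+ (Num.truncn gamma).+1 by lra.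
apply: le_trans (_ : (1 + s ^+ 2) `^ gamma <= _); first by rewrite ge0_ler_powR ?nnegrE.
by rewrite -[leRHS]powR_mulrn // ler_powR // ltW // truncnS_gt.
Qed.

Lemma expn_le_powR (R : realType) (s : R) p : 0 <= s ->
  (1 + s ^+ 2) ^+ p <= 2 ^+ p * (1 + s `^ (2 * p)%:R).
Proof.
move=> s0; rewrite powR_mulrn // exprM; have := sqr_ge0 s; move: (s ^+ 2) => u u0.
have up0 : 0 <= u ^+ p by rewrite exprn_ge0.
have p20 : 0 <= 2 ^+ p :> R by rewrite exprn_ge0.
have [u1|u1] := leP u 1.
  apply: (@le_trans _ _ (2 ^+ p)); last by rewrite ler_peMr // lerDl.
  by rewrite lerXn2r ?nnegrE ?addr_ge0 //; lra.
apply: (@le_trans _ _ ((2 * u) ^+ p)).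
  by rewrite lerXn2r ?nnegrE ?addr_ge0 ?mulr_ge0 //; lra.
by rewrite exprMn ler_wpM2l // lerDr.
Qed.

(** Real exponents are traded for one natural power of [1 + s ^ 2], the form that products of
    one-step estimates can handle. As the base is at least one, summing the exponents gives a common
    one. *)
Lemma poly_growth_expn (R : realType) (I : finType) (A : Type) (P : set A) (s : A -> R)
    (phi : I -> A -> R) : (forall a, 0 <= s a) ->
  (forall i, exists C gamma, [/\ 0 <= C, 0 <= gamma &
     forall a, P a -> `|phi i a| <= C * (1 + s a `^ gamma)]) ->
  exists (C : R) (p : nat), 0 <= C /\ forall i a, P a -> `|phi i a| <= C * (1 + s a ^+ 2) ^+ p.
Proof.
move=> s0 hphi.
have /choice[Cp hCp] : forall i, exists Cp : R * nat, 0 <= Cp.1 /\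
    forall a, P a -> `|phi i a| <= Cp.1 * (1 + s a ^+ 2) ^+ Cp.2.
  move=> i; have [C [gamma [C0 g0 h1]]] := hphi i.
  exists (2 * C, (Num.truncn gamma).+1); split=> [|a Pa] /=; first by rewrite mulr_ge0.
  by rewrite (le_trans (h1 a Pa)) // [2 * C]mulrC -mulrA ler_wpM2l // powR_le_expn.
exists (\sum_i (Cp i).1), (\sum_i (Cp i).2)%N; split.
  by rewrite sumr_ge0 // => i _; case: (hCp i).
move=> i a Pa; have [C0 hi] := hCp i; apply: le_trans (hi a Pa) _.
rewrite ler_pM ?exprn_ge0 ?addr_ge0 ?sqr_ge0 //.
  by rewrite (bigD1 i) //= lerDl sumr_ge0 // => l _; case: (hCp l).
rewrite ler_weXn2l ?lerDl ?sqr_ge0 //.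
by rewrite (bigD1 i) //= leq_addr.
Qed.

Lemma rn_le (R : realType) (T r0 : R) : 0 < T -> 0 < r0 ->
  exists n0, forall n, 0 < rn T n0 n <= r0.
Proof.
move=> T0 r00; exists (Num.truncn (T / r0 ^+ 2)) => n; rewrite rn_gt0 //=.
have r20 : 0 < r0 ^+ 2 by rewrite exprn_gt0.
rewrite -(@ler_pXn2r _ 2) ?nnegrE ?(ltW r00) ?(ltW (rn_gt0 _ _ _)) // rn_sq //.
rewrite ler_pdivrMr // mulrC -ler_pdivrMr //; apply: le_trans (ltW (truncnS_gt _)) _.
by rewrite ler_nat ltnS leq_addl.
Qed.

Theorem theorem6 (R : realType) (T : R) (k d m : nat)
  (b : R * 'cV[R]_k -> 'cV[R]_k) (sigma : R * 'cV[R]_k -> 'M[R]_(k, d))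
  (f : 'I_m -> R * 'cV[R]_k -> 'cV[R]_m -> 'cV[R]_d -> R)
  (g : 'I_m -> 'I_m -> R * 'cV[R]_k -> R)
  (h : 'I_m -> 'cV[R]_k -> R)
  (T_gt0 : 0 < T) (k_gt0 : (0 < k)%N) (d_gt0 : (0 < d)%N) (m_gt0 : (0 < m)%N)
  (b_cont : {within strip T, continuous b})
  (sigma_cont : {within strip T, continuous sigma})
  (b_sigma_lip : exists C : R, [/\ 0 <= C,
     forall t x, 0 <= t <= T ->
       enorm (b (t, x)) + enorm (sigma (t, x)) <= C * (1 + enorm x) &
     forall t x x', 0 <= t <= T ->
       enorm (b (t, x) - b (t, x')) + enorm (sigma (t, x) - sigma (t, x'))
         <= C * enorm (x - x')])
  (f_cont : forall i,
     continuous_unif_on T (fun tx (yz : 'cV[R]_m * 'cV[R]_d) =>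
                             f i tx yz.1 yz.2))
  (f_lip : forall i, exists2 C : R, 0 <= C &
     forall tx y y' z z', strip T tx ->
       `|f i tx y z - f i tx y' z'|
         <= C * (\sum_(l < m) `|y l 0 - y' l 0| + enorm (z - z')))
  (f_borel : forall i, borel_on T (fun tx => f i tx 0 0))
  (f_growth : forall i, poly_growth_on T (fun tx => f i tx 0 0))
  (f_mono : forall i l, l != i ->
     forall tx (y y' : 'cV[R]_m) z, strip T tx ->
       (forall j, j != l -> y j 0 = y' j 0) -> y l 0 <= y' l 0 ->
       f i tx y z <= f i tx y' z)
  (g_cont : forall i j, i != j -> {within strip T, continuous (g i j)})
  (g_ge0 : forall i j, i != j -> forall tx, strip T tx -> 0 <= g i j tx)
  (g_growth : forall i j, i != j -> poly_growth_on T (g i j))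
  (g_noloop : forall tx, strip T tx ->
     forall (N : nat) (s : nat -> 'I_m), (3 <= N)%N -> s 1%N = s N ->
       #|[set s n.+1 | n : 'I_N]%SET| = N.-1 ->
       0 < \sum_(1 <= n < N) g (s n) (s n.+1) tx)
  (h_cont : forall i, continuous (h i))
  (h_growth : forall i, poly_growth (h i))
  (h_obstacle : forall i x,
     (obstacle (fun l j => g l j (T, x)) (fun j => h j x) i <= (h i x)%:E)%E) :
  exists v : 'I_m -> R * 'cV[R]_k -> R,
    viscosity_solution T b sigma f g h v /\
    forall i, poly_growth_on T (v i).
Proof.
have [Cb [Cb0 b_sigma_growth b_sigma_lips]] := b_sigma_lip.
have h_obst i j x : i != j -> h j x - g i j (T, x) <= h i x.
  move=> ij; rewrite -lee_fin; apply: le_trans (h_obstacle i x); rewrite /obstacle.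
  by rewrite (bigD1 j) 1?eq_sym //= le_max lexx.
have /choice[Cf hCf] := fun i => let: ex_intro2 C C0 hC := f_lip i in
  ex_intro (fun C => 0 <= C /\ forall tx y y' z z', strip T tx ->
    `|f i tx y z - f i tx y' z'| <= C * (\sum_(l < m) `|y l 0 - y' l 0| + enorm (z - z')))
   C (conj C0 hC).
pose C := \sum_i Cf i.
have Cf_ge0 i : 0 <= Cf i by case: (hCf i).
have C0 : 0 <= C by rewrite sumr_ge0.
have f_lip' i tx y y' z z' : strip T tx ->
    `|f i tx y z - f i tx y' z'| <= C * (\sum_(l < m) `|y l 0 - y' l 0| + enorm (z - z')).
  move=> stx; apply: le_trans ((hCf i).2 _ _ _ _ _ stx) _.
  rewrite ler_wpM2r ?addr_ge0 ?enorm_ge0 ?sumr_ge0 //.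
  by rewrite /C (bigD1 i) //= lerDl sumr_ge0.
have [Af [pf [Af0 hf]]] := @poly_growth_expn R 'I_m _ (strip T) (fun tx : R * 'cV[R]_k => enorm tx.2)
  (fun i tx => f i tx 0 0) (fun tx => enorm_ge0 tx.2) f_growth.
have [Ah [ph [Ah0 hh]]] := @poly_growth_expn R 'I_m _ setT (fun x : 'cV[R]_k => enorm x) h
  (fun x => enorm_ge0 x) (fun i => let: ex_intro C' (ex_intro ga (And3 h1 h2 h3)) := h_growth i in
     ex_intro _ C' (ex_intro _ ga (And3 h1 h2 (fun x _ => h3 x)))).
pose A0 := Af + Ah; pose p := (pf + ph)%N.
have A00 : 0 <= A0 by rewrite addr_ge0.
have rho1 (x : 'cV[R]_k) : 1 <= 1 + sqn x by rewrite lerDl sqn_ge0.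
have rho0 (x : 'cV[R]_k) n : 0 <= (1 + sqn x) ^+ n by rewrite exprn_ge0 // (le_trans ler01).
have f_growth' i tx : strip T tx -> `|f i tx 0 0| <= A0 * (1 + sqn tx.2) ^+ p.
  move=> stx; apply: le_trans (hf i tx stx) _; rewrite enorm_sq.
  by rewrite ler_pM ?lerDl // ler_weXn2l // leq_addr.
have h_growth' i x : `|h i x| <= A0 * (1 + sqn x) ^+ p.
  apply: le_trans (hh i x I) _; rewrite enorm_sq.
  by rewrite ler_pM ?lerDr // ler_weXn2l // leq_addl.
(* The [2] comes from [(1 + |x|) ^ 2 <= 2 * (1 + |x| ^ 2)], the [d] from the scaling of the columns;
   one constant then serves growth and Lipschitz bounds alike. *)
pose ka := 2 * Cb ^+ 2 * (1 + d%:R).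
have Cb20 : 0 <= Cb ^+ 2 by exact: sqr_ge0.
have ka0 : 0 <= ka by rewrite mulr_ge0 // mulr_ge0.
have dka : 2 * Cb ^+ 2 * d%:R <= ka by rewrite ler_wpM2l ?mulr_ge0 // lerDr.
have ka1 : 2 * Cb ^+ 2 <= ka by rewrite ler_peMr ?mulr_ge0 // lerDl.
have sq_le (a c : nat) (X : 'M[R]_(a, c)) u : enorm X <= u -> sqn X <= u ^+ 2.
  by move=> Xu; rewrite -enorm_sq lerXn2r ?nnegrE ?enorm_ge0 // (le_trans (enorm_ge0 X)).
have col_le (X : 'M[R]_(k, d)) l : sqn (Num.sqrt d%:R *: col l X) <= d%:R * sqn X.
  rewrite sqnZ sqr_sqrtr // ler_wpM2l //; apply: ler_sum => i _.
  rewrite big_ord1 mxE (bigD1 l) //= lerDl sumr_ge0 // => j _.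
  by rewrite -expr2 sqr_ge0.
have lin_growth (x : 'cV[R]_k) : (Cb * (1 + enorm x)) ^+ 2 <= 2 * Cb ^+ 2 * (1 + sqn x).
  rewrite exprMn -enorm_sq [2 * _]mulrC -[leRHS]mulrA ler_wpM2l //.
  by have := sqr_ge0 (1 - enorm x); lra.
have b_growth tx : strip T tx -> sqn (b tx) <= ka * (1 + sqn tx.2).
  case: tx => t x stx; have h1 := b_sigma_growth t x stx.
  have h2 : enorm (b (t, x)) <= Cb * (1 + enorm x) by have := enorm_ge0 (sigma (t, x)); lra.
  apply: le_trans (sq_le _ _ _ _ h2) (le_trans (lin_growth x) _).
  by rewrite ler_wpM2r // (le_trans ler01).
have sigma_growth tx : strip T tx -> forall l,
    sqn (Num.sqrt d%:R *: col l (sigma tx)) <= ka * (1 + sqn tx.2).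
  case: tx => t x stx l; have h1 := b_sigma_growth t x stx.
  have h2 : enorm (sigma (t, x)) <= Cb * (1 + enorm x) by have := enorm_ge0 (b (t, x)); lra.
  apply: le_trans (col_le _ _) _.
  apply: (@le_trans _ _ (d%:R * (2 * Cb ^+ 2 * (1 + sqn x)))).
    by rewrite ler_wpM2l // (le_trans (sq_le _ _ _ _ h2)).
  by rewrite mulrA [d%:R * _]mulrC ler_wpM2r // (le_trans ler01).
have b_lip t x y : 0 <= t <= T -> sqn (b (t, x) - b (t, y)) <= ka * sqn (x - y).
  move=> ht; have h1 := b_sigma_lips t x y ht.
  have h2 : enorm (b (t, x) - b (t, y)) <= Cb * enorm (x - y).
    by have := enorm_ge0 (sigma (t, x) - sigma (t, y)); lra.
  apply: le_trans (sq_le _ _ _ _ h2) _; rewrite exprMn enorm_sq.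
  by rewrite ler_wpM2r ?sqn_ge0 //; lra.
have sigma_lip t x y l : 0 <= t <= T ->
    sqn (Num.sqrt d%:R *: col l (sigma (t, x)) - Num.sqrt d%:R *: col l (sigma (t, y)))
      <= ka * sqn (x - y).
  move=> ht; have h1 := b_sigma_lips t x y ht.
  have h2 : enorm (sigma (t, x) - sigma (t, y)) <= Cb * enorm (x - y).
    by have := enorm_ge0 (b (t, x) - b (t, y)); lra.
  rewrite -scalerBr -linearB /=; apply: le_trans (col_le _ _) _.
  apply: (@le_trans _ _ (d%:R * (Cb ^+ 2 * sqn (x - y)))).
    by rewrite ler_wpM2l // (le_trans (sq_le _ _ _ _ h2)) // exprMn enorm_sq.
  have dC : 0 <= Cb ^+ 2 * d%:R by rewrite mulr_ge0.
  by rewrite mulrA ler_wpM2r ?sqn_ge0 //; lra.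
have f_ucont i := continuous_unif_onW (f_cont i).
have g_ucont i j ij := within_continuous_ucont (g_cont i j ij).
have h_ucont i := @continuous_snd_ucont R k T (h i) (h_cont i).
have noloop tx : strip T tx -> forall N s, simple_loop N s ->
    0 < loop_cost (fun i j => g i j tx) N s.
  by move=> stx N s [N3 s1 hc _]; exact: g_noloop.
have [U UU Uoo] := ultra_oo.
have [r0 r00 hr0] := small_exists d C0.
have [n0 hn0] := rn_le T_gt0 r00.
have rn_small n : small d C (rn T n0 n) := hr0 _ (hn0 n).
have b_ucont i := within_continuous_entry i 0 b_cont.
have sigma_ucont i l := within_continuous_entry i l sigma_cont.
exists (vlim T b sigma f g h U n0); split.
  split.
  - by move=> i; exact: (vlim_continuous g_ge0 h_obst T_gt0 d_gt0 C0 ka0 A00 b_growth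
      sigma_growth f_lip' f_mono f_growth' h_growth' b_lip sigma_lip f_ucont g_ucont h_ucont
      noloop UU Uoo rn_small).
  - exact: (vlim_supersolution g_ge0 h_obst T_gt0 d_gt0 C0 ka0 A00 b_growth
      sigma_growth f_lip' f_mono f_growth' h_growth' b_lip sigma_lip f_ucont g_ucont h_ucont
      noloop UU Uoo rn_small b_ucont sigma_ucont).
  - exact: (vlim_subsolution g_ge0 h_obst T_gt0 d_gt0 C0 ka0 A00 b_growth
      sigma_growth f_lip' f_mono f_growth' h_growth' b_lip sigma_lip f_ucont g_ucont h_ucont
      noloop UU Uoo rn_small b_ucont sigma_ucont).
move=> i; pose G := growth_bound d m T C ka A0 p.
have G0 : 0 <= G by exact: growth_bound_ge0.
exists (G * 2 ^+ p), (2 * p)%:R; split; rewrite ?ler0n //.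
  by rewrite mulr_ge0 // exprn_ge0.
move=> tx stx.
have [_ bd] := vlim_spec g T_gt0 d_gt0 C0 ka0 A00 b_growth sigma_growth f_lip' f_mono
  f_growth' h_growth' UU rn_small i stx.
apply: le_trans bd _; rewrite -mulrA ler_wpM2l // -enorm_sq.
exact/expn_le_powR/enorm_ge0.
Qed.
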